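(* For each real number $\beta>1$, there exists an infinite measure preserving transformation $T$ such that $T$ is weakly rationally ergodic, but not $\beta$-rationally ergodic.
   Context: Transformations are invertible and measure preserving on $\sigma$-finite, nonatomic Lebesgue measure spaces $(X,\mu)$; ''infinite measure preserving'' means $\mu(X)=\infty$. $I_F$ is the indicator function of $F$. For real $\beta>1$, $T$ is $\beta$-rationally ergodic if it is conservative ergodic and there exists a set $F$ of positive finite measure such that $\liminf_{n\to\infty}\frac{(\int_F\sum_{i=0}^{n-1}I_F(T^ix)\,d\mu)^\beta}{\int_F(\sum_{i=0}^{n-1}I_F(T^ix))^\beta d\mu}>0$. $T$ is weakly rationally ergodic if it is conservative ergodic and there exists a set $F$ of positive finite measure such that, with $a_n(F)=\sum_{k=0}^{n-1}\mu(F\cap T^kF)/\mu(F)^2$, one has $\lim_{n\to\infty}\frac{1}{a_n(F)}\sum_{k=0}^{n-1}\mu(A\cap T^kB)=\mu(A)\mu(B)$ for all measurable $A,B\subset F$. *)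

(* Defs.v *)
From HB Require Import structures.
From mathcomp Require Import all_boot all_order all_algebra.
From mathcomp Require Import all_classical all_reals all_analysis.

Set Implicit Arguments.
Unset Strict Implicit.
Unset Printing Implicit Defensive.
Import Order.TTheory GRing.Theory Num.Theory.
Import numFieldNormedType.Exports.

Local Open Scope classical_set_scope.
Local Open Scope ring_scope.

Definition nonatomic (R : realType) (d : measure_display) (X : measurableType d)
    (mu : {measure set X -> \bar R}) : Prop :=
  forall A : set X, measurable A -> (0 < mu A)%E ->
    exists B : set X, [/\ measurable B, B `<=` A & (0 < mu B < mu A)%E].

(* (D, mu) and (E, nu) are isomorphic modulo null sets: after discarding null
   sets, there is a bimeasurable measure-preserving bijection [f]. *)
Definition isomorphic_mod0 (R : realType) (d1 d2 : measure_display)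
    (X : measurableType d1) (Y : measurableType d2)
    (mu : {measure set X -> \bar R}) (D : set X)
    (nu : {measure set Y -> \bar R}) (E : set Y) : Prop :=
  exists (X0 : set X) (Y0 : set Y) (f : X -> Y),
    [/\ [/\ measurable X0, X0 `<=` D & mu (D `\` X0) = 0%E],
        [/\ measurable Y0, Y0 `<=` E & nu (E `\` Y0) = 0%E],
        set_bij X0 Y0 f,
        (forall A : set X, A `<=` X0 -> measurable A <-> measurable (f @` A)) &
        (forall A : set X, A `<=` X0 -> measurable A -> nu (f @` A) = mu A)].

(* Lebesgue space: a complete measure space which, off a countable set [C] of
   points (the possible atoms), is isomorphic mod 0 to an interval, bounded or
   not, with Lebesgue measure on its Lebesgue measurable subsets. *)
Definition lebesgue_space (R : realType) (d : measure_display)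
    (X : measurableType d) (mu : {measure set X -> \bar R}) : Prop :=
  measure_is_complete mu /\
  exists (C : set X) (I : interval R),
    [/\ countable C,
        (forall x : X, C x -> measurable [set x]) &
        isomorphic_mod0 mu (~` C) (@completed_lebesgue_measure R) [set` I]].

Definition invertible_measure_preserving (R : realType) (d : measure_display)
    (X : measurableType d) (mu : {measure set X -> \bar R}) (T : X -> X) : Prop :=
  [/\ bijective T,
      measurable_fun setT T,
      (forall A : set X, measurable A -> measurable (T @` A)) &
      (forall A : set X, measurable A -> mu (T @^-1` A) = mu A)].

(* every wandering set is null *)
Definition conservative (R : realType) (d : measure_display)
    (X : measurableType d) (mu : {measure set X -> \bar R}) (T : X -> X) : Prop :=
  forall W : set X, measurable W ->
    trivIset setT (fun n : nat => iter n T @^-1` W) -> mu W = 0%E.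

Definition ergodic (R : realType) (d : measure_display)
    (X : measurableType d) (mu : {measure set X -> \bar R}) (T : X -> X) : Prop :=
  forall A : set X, measurable A -> T @^-1` A = A ->
    mu A = 0%E \/ mu (~` A) = 0%E.

Definition visits (R : realType) (X : Type) (T : X -> X) (F : set X)
    (n : nat) (x : X) : R :=
  \sum_(i < n) \1_F (iter i T x).

(* For n >= 1 the integrals below are positive and finite, so the real-valued
   quotients are the usual ones; the junk value at n = 0 is irrelevant to the
   limits. *)
Definition rationally_ergodic (R : realType) (beta : R) (d : measure_display)
    (X : measurableType d) (mu : {measure set X -> \bar R}) (T : X -> X) : Prop :=
  [/\ conservative mu T, ergodic mu T &
    exists F : set X, [/\ measurable F, (0 < mu F < +oo)%E &
      (0 < limn_einf (fun n : nat =>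
         ((\int[mu]_(x in F) visits R T F n x) `^ beta /
          \int[mu]_(x in F) (visits R T F n x `^ beta))%:E))%E]].

Definition return_rate (R : realType) (d : measure_display)
    (X : measurableType d) (mu : {measure set X -> \bar R}) (T : X -> X)
    (F : set X) (n : nat) : R :=
  \sum_(k < n) fine (mu (F `&` iter k T @` F)) / fine (mu F) ^+ 2.

Definition weakly_rationally_ergodic (R : realType) (d : measure_display)
    (X : measurableType d) (mu : {measure set X -> \bar R}) (T : X -> X) : Prop :=
  [/\ conservative mu T, ergodic mu T &
    exists F : set X, [/\ measurable F, (0 < mu F < +oo)%E &
      forall A B : set X, measurable A -> measurable B -> A `<=` F -> B `<=` F ->
        (fun n : nat => (return_rate mu T F n)^-1 *
           \sum_(k < n) fine (mu (A `&` iter k T @` B))) @ \oo -->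
        fine (mu A) * fine (mu B)]].

(* Main.v *)
(* The transformation comes from a rank-one cutting and stacking construction. Column
   [N.+1] is made of [cuts = L N * K N] copies of column [N]: [2 L N] of them are
   adjacent, while all the others are at distance [L N] heights of one another, and
   spacers fill the rest. Over times of order [L N] heights of column [N], the points
   of the adjacent copies, of relative measure [2 / K N], are visited [L N] times more
   often than the other ones. If [L N / K N] is small whenever [L N] is large, the
   numbers of visits to the base, divided by their mean, are uniformly integrable;
   their correlations with unions of levels, which are dense, converge, so that the
   base witnesses weak rational ergodicity. If moreover [L N ^ beta / K N] is unbounded,
   then the normalized [beta]-moments of the numbers of visits to any set [F] are
   unbounded: [F] is approximated by a union of levels of a column whose rank depends on
   [L N] and [K N], hence each pair of values must recur for arbitrarily large [N].
   Both conditions hold for [L = s ^ a] and [K = 4 s ^ (a + 1)] when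
   [a * (beta - 1) > 1]. *)

Require Import Defs.
From mathcomp Require Import all_boot all_order all_algebra.
From mathcomp Require Import all_classical all_reals all_analysis.
From mathcomp Require Import measurable_realfun.
From mathcomp Require Import zify lra ring.

Set Implicit Arguments.
Unset Strict Implicit.
Unset Printing Implicit Defensive.
Import Order.TTheory GRing.Theory Num.Theory.
Import numFieldNormedType.Exports.

(** * Positions of the copies in a column *)

(** The measure space is the real line itself: column [N] is an interval cut into [height N] cells
    of length [1 / copies N], and a level is a cell. Heights do not follow the order of the cells,
    so each level has a position (its rank on the line) besides its height, with a recursively
    defined bijection between the two. New spacers are put on both sides of the old interval, so
    that the columns exhaust the line; and since no copy touches the bottom or the top of the next
    column, the map is a bijection defined at every point, not merely almost everywhere. The
    arguments on visits only use the record [columns]. The obstacle in refuting [beta]-rational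
    ergodicity is that the set [F] is arbitrary and may lie in no single column. One inequality,
    [s <= t + t ^ (1 - beta) * s ^ beta], is used twice: under bounded normalized moments it makes
    the visits uniformly integrable, so that [F] may be cut down to one column; with [t]
    proportional to the visits along a run, it bounds the moment from below. Runs have [2 L] copies
    so that points of their first half keep [L] copies ahead. *)

Lemma sum_periodic (P : nat -> nat) (p : nat) :
  (forall v, P (v + p) = P v) ->
  forall c a, \sum_(a <= v < a + c * p) P v = c * \sum_(0 <= v < p) P v.
Proof.
move=> Pp.
have one a : \sum_(a <= v < a + p) P v = \sum_(0 <= v < p) P v.
  elim: a => [|a <-]; first by rewrite add0n.
  case: p Pp => [|p] Pp; first by rewrite !addn0 !big_geq.
  rewrite [RHS]big_ltn; last by lia.
  by rewrite addSn big_nat_recr ?Pp 1?addnC //=; lia.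
elim=> [|c IH] a; first by rewrite !mul0n addn0 big_geq.
rewrite mulSn addnA (big_cat_nat (n := a + p)) /=; [|lia|lia].
by rewrite IH one.
Qed.

Lemma sum_periodic_le (P : nat -> nat) (p : nat) :
  (forall v, P (v + p) = P v) ->
  forall c a n, n <= c * p -> \sum_(a <= v < a + n) P v <= c * \sum_(0 <= v < p) P v.
Proof.
move=> Pp c a n nc; rewrite -(sum_periodic Pp c a).
rewrite [X in _ <= X](big_cat_nat (n := a + n)) /=; [|lia|lia].
exact: leq_addr.
Qed.

Lemma leq_sum_nat (P Q : nat -> nat) (a b : nat) :
  (forall v, a <= v < b -> P v <= Q v) ->
  \sum_(a <= v < b) P v <= \sum_(a <= v < b) Q v.
Proof. by move=> PQ; rewrite big_nat [X in _ <= X]big_nat; exact: leq_sum. Qed.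

Lemma leq_sum_sub (P : nat -> nat) (a b c d : nat) :
  c <= a -> b <= d -> \sum_(a <= v < b) P v <= \sum_(c <= v < d) P v.
Proof.
move=> ca bd; have [ab|ba] := leqP a b; last by rewrite big_geq // ltnW.
rewrite [X in _ <= X](big_cat_nat (n := a)) /=; [|lia|lia].
rewrite [X in _ <= _ + X](big_cat_nat (n := b)) /=; [|lia|lia].
by rewrite addnCA leq_addr.
Qed.

Section slots.
Variables L K : nat.
Hypotheses (L0 : 0 < L) (K4 : 4 <= K).

Definition cuts := L * K.
Definition spread := cuts * L.
(* [2 L] adjacent copies, far away from [cuts - 2 L] copies at distance [L] of
   one another. *)
Definition slot (s : nat) : bool :=
  (spread <= s < spread + 2 * L) ||
  [&& 3 * spread <= s, s < 3 * spread + (cuts - 2 * L) * L & L %| s].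
(** The adjacent copies and the sparse ones lie in [[spread, 4 * spread)], with at least [spread]
    empty places below, between and above the two groups. A window of at most [spread] places,
    forward or backward, that starts in one group therefore stays in the column and misses the other
    group. *)
Definition width := 5 * spread.

Lemma cuts_ge : 4 * L <= cuts.
Proof. by rewrite /cuts mulnC leq_mul2l K4 orbT. Qed.

Lemma spread_ge : 4 * L <= spread.
Proof. by rewrite /spread; have := cuts_ge; nia. Qed.

Variables (P : pred nat) (h : nat).
Hypotheses (h0 : 0 < h) (Ph : forall v, P (v + h) = P v).

Let S := \sum_(0 <= v < h) P v.
Let W v := P v && slot (v %/ h).

Let sumP c a : \sum_(a <= v < a + c * h) P v = c * S.
Proof. by apply: (@sum_periodic (fun v => P v : nat)) => v; rewrite Ph. Qed.

(** Sparse slots are multiples of [L], as [spread] is. Without the bounds of the sparse block the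
    condition has period [L * h], with exactly one copy in each period. *)
Let PL v := P v && (L %| v %/ h).

Let PLper v : PL (v + L * h) = PL v.
Proof.
rewrite /PL; have -> : P (v + L * h) = P v.
  by elim: L => [|k IH]; [rewrite addn0|rewrite mulSn addnCA addnC Ph IH].
by rewrite addnC divnMDl // dvdn_addr.
Qed.

Let sumPL : \sum_(0 <= v < L * h) PL v = S.
Proof.
have hL : h <= L * h by nia.
rewrite (big_cat_nat (n := h)) //=.
have -> : \sum_(h <= v < L * h) PL v = 0; last rewrite addn0.
  rewrite big_nat big1 // => v /andP[hv vL]; rewrite /PL; case: dvdnP; rewrite ?andbF // => -[k vk].
  have : v %/ h < L by rewrite ltn_divLR.
  have : 0 < v %/ h by rewrite divn_gt0.
  by rewrite vk; case: k vk => [|k] _; rewrite ?mulSn; lia.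
apply: eq_big_nat => v /andP[_ vh]; by rewrite /PL divn_small // dvdn0 andbT.
Qed.

Lemma sparse_count_le c a n : (spread + 2 * L) * h <= a -> n <= c * (L * h) ->
  \sum_(a <= v < a + n) W v <= c * S.
Proof.
move=> ha nc; rewrite -sumPL.
apply: leq_trans (@sum_periodic_le (fun v => PL v : nat) (L * h) _ c a n nc); last first.
  by move=> v; rewrite PLper.
apply: leq_sum_nat => v /andP[av _]; rewrite /W /PL /slot.
have : spread + 2 * L <= v %/ h by rewrite leq_divRL //; exact: leq_trans av.
case: (P v) => //= sv; rewrite [_ < spread + _]ltnNge sv andbF /=.
by case: (L %| _); rewrite ?andbF //; case: (_ && _).
Qed.

Lemma sparse_count t a : 3 * spread * h <= a ->
  a + t * (L * h) <= (3 * spread + (cuts - 2 * L) * L) * h ->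
  \sum_(a <= v < a + t * (L * h)) W v = t * S.
Proof.
move=> ha at_; rewrite -sumPL -(@sum_periodic (fun v => PL v : nat) (L * h) _ t a); last first.
  by move=> v; rewrite PLper.
apply: eq_big_nat => v /andP[av vt]; rewrite /W /PL /slot.
have -> : 3 * spread <= v %/ h by rewrite leq_divRL //; lia.
have -> : v %/ h < 3 * spread + (cuts - 2 * L) * L by rewrite ltn_divLR //; lia.
case: (P v) => //=; case: (L %| _); rewrite ?orbT // orbF.
have : 3 * spread <= v %/ h by rewrite leq_divRL //; lia.
by have := spread_ge; lia.
Qed.

Lemma dense_count_le a n : a + n <= 3 * spread * h ->
  \sum_(a <= v < a + n) W v <= 2 * L * S.
Proof.
move=> an; rewrite -(sumP (2 * L) (spread * h)).
apply: (@leq_trans (\sum_(0 <= v < 3 * spread * h) W v)); first exact: leq_sum_sub.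
have sp := spread_ge.
rewrite (big_cat_nat (n := spread * h)) //=; last by nia.
rewrite (big_cat_nat (n := spread * h + 2 * L * h) (m := spread * h)) //=; [|lia|nia].
rewrite [X in X + _](_ : _ = 0); last first.
  rewrite big_nat big1 // => v /andP[_ vs]; rewrite /W /slot.
  have : v %/ h < spread by rewrite ltn_divLR.
  by case: (P v) => //=; lia.
rewrite [X in _ + (_ + X)](_ : _ = 0); last first.
  rewrite big_nat big1 // => v /andP[vs vs']; rewrite /W /slot.
  have : v %/ h < 3 * spread by rewrite ltn_divLR.
  have : spread + 2 * L <= v %/ h by rewrite leq_divRL // mulnDl.
  by case: (P v) => //=; lia.
rewrite add0n addn0; apply: leq_sum_nat => v _; rewrite /W; case: (P v) => //.
exact: leq_b1.
Qed.

Lemma dense_count c a : spread * h <= a -> a + c * h <= (spread + 2 * L) * h ->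
  \sum_(a <= v < a + c * h) W v = c * S.
Proof.
move=> ha ac; rewrite -(sumP c a); apply: eq_big_nat => v /andP[av vc].
rewrite /W /slot.
have -> : spread <= v %/ h by rewrite leq_divRL //; lia.
have -> : v %/ h < spread + 2 * L by rewrite ltn_divLR //; lia.
by rewrite /= andbT.
Qed.

Lemma total_count : \sum_(0 <= v < width * h) W v = cuts * S.
Proof.
have sp := spread_ge; have ct := cuts_ge; have spE : spread = cuts * L by [].
pose b := 3 * spread * h; pose e := (cuts - 2 * L) * (L * h).
have be : b + e <= width * h by rewrite /b /e /width spE; nia.
rewrite (big_cat_nat (n := spread * h)) //=; last by rewrite /width; nia.
rewrite [X in X + _](_ : _ = 0); last first.
  rewrite big_nat big1 // => v /andP[_ vs]; rewrite /W /slot.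
  have : v %/ h < spread by rewrite ltn_divLR.
  by case: (P v) => //=; lia.
rewrite (big_cat_nat (n := spread * h + 2 * L * h)) /=; [|lia|by rewrite /width; nia].
rewrite dense_count //; last by lia.
rewrite (big_cat_nat (n := b)) /=; [|by rewrite /b; nia|lia].
rewrite [X in _ + (_ + (X + _))](_ : _ = 0); last first.
  rewrite big_nat big1 // => v /andP[vs vs']; rewrite /W /slot.
  have : v %/ h < 3 * spread by rewrite ltn_divLR.
  have : spread + 2 * L <= v %/ h by rewrite leq_divRL // mulnDl.
  by case: (P v) => //=; lia.
rewrite (big_cat_nat (n := b + e)) /=; [|lia|by []].
rewrite sparse_count //; last by rewrite /b; nia.
rewrite [X in _ + (_ + (_ + (_ + X)))](_ : _ = 0); last first.
  rewrite big_nat big1 // => v /andP[vs vs']; rewrite /W /slot.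
  have : 3 * spread + (cuts - 2 * L) * L <= v %/ h.
    by rewrite leq_divRL //; move: vs; rewrite /b /e; nia.
  move: sp; move: (v %/ h) ((cuts - 2 * L) * L) spread (P v) => z e' s [] //= sp hz.
  by case: (L %| z); rewrite ?andbF ?andbT; lia.
rewrite !add0n addn0 -mulnDl; congr (_ * _); lia.
Qed.

End slots.

Lemma slot_bounds L K s : 0 < L -> 4 <= K -> slot L K s ->
  spread L K <= s < 4 * spread L K.
Proof.
move=> L0 K4; have sp := spread_ge L0 K4; have ct := cuts_ge L K4.
have : (cuts L K - 2 * L) * L <= spread L K by rewrite /spread leq_mul2r leq_subr orbT.
by rewrite /slot => e; case/orP => [|/and3P[? ? _]]; lia.
Qed.

Lemma count_slot L K : 0 < L -> 4 <= K ->
  count (slot L K) (iota 0 (width L K)) = cuts L K.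
Proof.
move=> L0 K4.
have := total_count (P := xpredT) L0 K4 (ltn0Sn 0) (fun=> erefl).
rewrite /= muln1 big_nat1 muln1 => <-.
rewrite -sum1_count big_mkcond /index_iota subn0.
by apply: eq_bigr => i _; rewrite divn1; case: slot.
Qed.

(** * Heights of the columns and nesting of their levels *)

Section column.
Variables L K : nat -> nat.
Hypotheses (L0 : forall N, 0 < L N) (K4 : forall N, 4 <= K N).

Fixpoint height (N : nat) : nat :=
  if N is N'.+1 then width (L N') (K N') * height N' else 1.
(** Column 0 is one level of measure 1, the base; it is cut into [copies N] levels of column [N],
    which gives every level of that column the measure [1 / copies N]. *)
Fixpoint copies (N : nat) : nat :=
  if N is N'.+1 then cuts (L N') (K N') * copies N' else 1.

Lemma width_gt0 N : 0 < width (L N) (K N).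
Proof. by have := spread_ge (L0 N) (K4 N); have := L0 N; rewrite /width; lia. Qed.

Lemma height_gt0 N : 0 < height N.
Proof. by elim: N => //= N IH; rewrite muln_gt0 width_gt0. Qed.

Lemma cuts_ge4 N : 4 <= cuts (L N) (K N).
Proof. by have := cuts_ge (L N) (K4 N); have := L0 N; lia. Qed.

Lemma copies_gt0 N : 0 < copies N.
Proof. by elim: N => //= N IH; rewrite muln_gt0 IH; have := cuts_ge4 N; lia. Qed.

Lemma copies_ge N : N < copies N.
Proof. by elim: N => //= N IH; have := cuts_ge4 N; nia. Qed.

Lemma height_dvd m N : m <= N -> height m %| height N.
Proof.
by move=> /subnKC <-; elim: (N - m) => [|k IH]; rewrite ?addn0 // addnS /= dvdn_mull.
Qed.

Lemma leq_height m N : m <= N -> height m <= height N.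
Proof. by move=> /height_dvd; apply: dvdn_leq; exact: height_gt0. Qed.

Lemma height_ge N : N < height N.
Proof.
elim: N => //= N IH; have := spread_ge (L0 N) (K4 N); have := L0 N.
by rewrite /width; nia.
Qed.

(** The place occupied in column [N.+1] by a copy of column [N], read from a height [v] in any later
    column: copies start at multiples of their height, so the reduction modulo [height N.+1]
    recovers the height in column [N.+1]. *)
Definition digit (N v : nat) : nat := v %% height N.+1 %/ height N.

(* For a point of column [N] at height [v], membership in column [m <= N]. *)
Definition inner (m N v : nat) : bool :=
  all (fun k => slot (L k) (K k) (digit k v)) (iota m (N - m)).

Lemma inner_refl m v : inner m m v.
Proof. by rewrite /inner subnn. Qed.

Lemma innerS m N v : m <= N ->
  inner m N.+1 v = inner m N v && slot (L N) (K N) (digit N v).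
Proof.
by move=> mN; rewrite /inner subSn // -addn1 iotaD all_cat /= andbT subnKC.
Qed.

Lemma inner_period m N v : inner m N (v + height N) = inner m N v.
Proof.
rewrite /inner; apply: eq_in_all => k; rewrite mem_iota => /andP[mk kN].
have kN' : k.+1 <= N by lia.
congr slot; rewrite /digit; congr (_ %/ _).
by rewrite -modnDmr (eqP (height_dvd kN')) addn0.
Qed.

Lemma inner_mod m N v : inner m N (v %% height N) = inner m N v.
Proof.
rewrite /inner; apply: eq_in_all => k; rewrite mem_iota => /andP[mk kN].
have kN' : k.+1 <= N by lia.
congr slot; rewrite /digit; congr (_ %/ _).
by rewrite modn_dvdm // height_dvd.
Qed.

Lemma inner_le m N M v : m <= N -> N <= M -> inner m M v -> inner m N v.
Proof.
move=> mN /subnKC <-; elim: (M - N) => [|k IH]; rewrite ?addn0 // addnS innerS //.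
  by case/andP=> /IH.
lia.
Qed.

Definition inners (m N : nat) : nat := \sum_(0 <= v < height N) inner m N v.

(** Dropping the conditions of the stages from [N] on leaves a condition of period [height N], so
    the bound holds wherever the window lies. *)
Lemma inner_count_le m N M a n c : m <= N -> N <= M -> n <= c * height N ->
  \sum_(a <= v < a + n) inner m M v <= c * inners m N.
Proof.
move=> mN NM nc.
apply: leq_trans (@sum_periodic_le (fun v => inner m N v : nat) _ _ c a n nc).
  apply: leq_sum_nat => v _.
  by case: (boolP (inner m M v)) => // /(inner_le mN NM) ->.
by move=> v; rewrite inner_period.
Qed.

Lemma digit_small N v : v < height N.+1 -> digit N v = v %/ height N.
Proof. by move=> vN; rewrite /digit modn_small. Qed.

End column.

(** * Bijection between positions on the line and heights in a column *)

Lemma skip_inj (c e e' : nat) : ~~ (c <= e < 2 * c) -> ~~ (c <= e' < 2 * c) ->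
  (if e < c then e else e - c) = (if e' < c then e' else e' - c) -> e = e'.
Proof. by case: (ltnP e c); case: (ltnP e' c); lia. Qed.

Section numbering.
Variables L K : nat -> nat.
Hypotheses (L0 : forall N, 0 < L N) (K4 : forall N, 4 <= K N).
Local Notation height := (height L K).
Local Notation copies := (copies L K).
Let sl N := slot (L N) (K N).
Let r N := cuts (L N) (K N).
Let M N := width (L N) (K N).

(** Places of copies are listed first, so that an index is that of a copy exactly when it is below
    [cuts]. *)
Definition slot_order (N : nat) : seq nat :=
  let s := slot (L N) (K N) in
  let w := iota 0 (width (L N) (K N)) in
  seq.filter s w ++ seq.filter (predC s) w.
Definition place (N g : nat) : nat := nth 0 (slot_order N) g.

Lemma slot_order_perm N : perm_eq (slot_order N) (iota 0 (M N)).
Proof. by apply/permPl; exact: perm_filterC. Qed.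

Lemma size_slot_order N : size (slot_order N) = M N.
Proof. by rewrite (perm_size (slot_order_perm N)) size_iota. Qed.

Lemma place_lt N g : g < M N -> place N g < M N.
Proof.
move=> gM; have : place N g \in slot_order N by rewrite mem_nth // size_slot_order.
by rewrite (perm_mem (slot_order_perm N)) mem_iota.
Qed.

Lemma place_inj N g g' : g < M N -> g' < M N -> place N g = place N g' -> g = g'.
Proof.
move=> gM gM' /eqP; rewrite nth_uniq ?size_slot_order // => [/eqP //|].
by rewrite (perm_uniq (slot_order_perm N)) iota_uniq.
Qed.

Lemma slot_place N g : g < M N -> slot (L N) (K N) (place N g) = (g < r N).
Proof.
move=> gM; rewrite /place /slot_order nth_cat size_filter count_slot //.
case: ltnP => gr.
  have : nth 0 (seq.filter (sl N) (iota 0 (M N))) g \in seq.filter (sl N) (iota 0 (M N)).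
    by rewrite mem_nth // size_filter count_slot.
  by rewrite mem_filter => /andP[].
have : nth 0 (seq.filter (predC (sl N)) (iota 0 (M N))) (g - r N)
    \in seq.filter (predC (sl N)) (iota 0 (M N)).
  rewrite mem_nth // size_filter -(ltn_add2l (cuts (L N) (K N))).
  have E : cuts (L N) (K N) + count (predC (sl N)) (iota 0 (M N)) = M N.
    by rewrite -[X in X + _]count_slot // count_predC size_iota.
  by rewrite [X in _ < X]E; move: gr gM; rewrite /r /M; lia.
by rewrite mem_filter => /andP[/negbTE].
Qed.

(* Position [e] of column [N.+1] lies over position [e %/ r - height N] of column
   [N] when [e] is in the second of the blocks of [height N * r] positions;
   the other positions are spacers. *)
Definition old (N e : nat) : bool :=
  height N * cuts (L N) (K N) <= e < 2 * (height N * cuts (L N) (K N)).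

(** A level of column [N] is cut into [r] consecutive cells: the quotient of an old position by [r]
    tells the level, the remainder tells the copy that receives the cell. The other positions,
    renumbered by skipping the old block, fill the places without copies, [height N] at a time. *)
Fixpoint pos_height (N e : nat) : nat :=
  if N is N'.+1 then
    let r := cuts (L N') (K N') in
    let h := height N' in
    if old N' e then place N' (e %% r) * h + pos_height N' (e %/ r - h)
    else let e' := if e < h * r then e else e - h * r in
      place N' (r + e' %/ h) * h + e' %% h
  else e.

Let h0 N : 0 < height N. Proof. exact: height_gt0. Qed.
Let r0 N : 0 < r N. Proof. by have := cuts_ge4 L0 K4 N; rewrite -/(r N); lia. Qed.
Let rM N : 5 * r N <= M N.
Proof. by rewrite /M /width /spread leq_mul2l /= leq_pmulr. Qed.

Lemma old_div N e : old N e -> height N <= e %/ r N < 2 * height N.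
Proof. by move=> /andP[? ?]; rewrite leq_divRL // ltn_divLR // -mulnA; apply/andP. Qed.

Lemma old_sub N e : old N e -> e %/ r N - height N < height N.
Proof. move=> /old_div /andP[_]; have := h0 N; move: (_ %/ _) (height N) => a b; lia. Qed.

Let new_group N e : e < height N.+1 -> ~~ old N e ->
  r N + (if e < height N * r N then e else e - height N * r N) %/ height N < M N.
Proof.
move=> eh eo; rewrite -ltn_subRL ltn_divLR //.
have h_gt0 := h0 N; have r_gt0 := r0 N.
have rh : 0 < r N * height N by rewrite muln_gt0 r_gt0.
have : 5 * (r N * height N) <= M N * height N by rewrite mulnA leq_mul2r rM orbT.
move: eh eo; rewrite /old /= -/(M N) -/(r N) mulnBl [height N * r N]mulnC.
by case: (ltnP e (r N * height N)); lia.
Qed.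

Lemma pos_height_lt N e : e < height N -> pos_height N e < height N.
Proof.
elim: N e => //= N IH e eh; case: ifPn => eo.
  have := old_div eo => /andP[h1 h2].
  have hh : pos_height N (e %/ r N - height N) < height N by apply: IH; lia.
  have : place N (e %% r N) < M N.
    by apply: place_lt; have := rM N; have := ltn_pmod e (r0 N); lia.
  by rewrite -/(M N) -/(r N); nia.
have := place_lt (new_group eh eo); set g := place _ _ => gM.
rewrite -/(r N) -/(M N) -/g.
by have := ltn_pmod (if e < height N * r N then e else e - height N * r N) (h0 N); nia.
Qed.

Lemma pos_height_old N e : e < height N.+1 -> old N e ->
  [/\ slot (L N) (K N) (pos_height N.+1 e %/ height N),
      pos_height N.+1 e %/ height N = place N (e %% r N) &
      pos_height N.+1 e %% height N = pos_height N (e %/ r N - height N)].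
Proof.
move=> eh eo; have /andP[h1 h2] := old_div eo.
have lt : pos_height N (e %/ r N - height N) < height N by apply: pos_height_lt; lia.
have gr := ltn_pmod e (r0 N).
have gM : e %% r N < M N by have := rM N; lia.
have E : pos_height N.+1 e %/ height N = place N (e %% r N).
  by rewrite /= eo divnMDl // divn_small // addn0.
rewrite E slot_place // gr; split => //.
by rewrite /= eo modnMDl modn_small.
Qed.

Lemma pos_height_new N e : e < height N.+1 -> ~~ old N e ->
  ~~ slot (L N) (K N) (pos_height N.+1 e %/ height N).
Proof.
move=> eh eo; rewrite /= (negbTE eo) divnMDl // [(_ %% _) %/ _]divn_small ?ltn_pmod // addn0.
by rewrite slot_place ?new_group // -leqNgt leq_addr.
Qed.

Lemma pos_height_inj N e e' : e < height N -> e' < height N ->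
  pos_height N e = pos_height N e' -> e = e'.
Proof.
elim: N e e' => // N IH e e' eh eh' E.
have [eo|en] := boolP (old N e); have [eo'|en'] := boolP (old N e').
- have [_ p1 p2] := pos_height_old eh eo; have [_ p1' p2'] := pos_height_old eh' eo'.
  have /andP[a1 a2] := old_div eo; have /andP[a1' a2'] := old_div eo'.
  have q1 : e %/ r N - height N = e' %/ r N - height N.
    by apply: IH; rewrite ?old_sub // -p2 -p2' E.
  have q2 : e %% r N = e' %% r N.
    have rM' : r N <= M N by apply: leq_trans (rM N); rewrite leq_pmull.
    by apply: (@place_inj N); rewrite ?(leq_trans (ltn_pmod _ (r0 N)) rM') // -p1 -p1' E.
  have q3 : e %/ r N = e' %/ r N by rewrite -(subnK a1) q1 subnK.
  by rewrite (divn_eq e (r N)) q3 q2 -divn_eq.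
- by have [s _ _] := pos_height_old eh eo; have := pos_height_new eh' en'; rewrite -E s.
- by have [s _ _] := pos_height_old eh' eo'; have := pos_height_new eh en; rewrite E s.
have g1 := new_group eh en; have g2 := new_group eh' en'.
have E1 := congr1 (fun z => z %/ height N) E.
have E2 := congr1 (fun z => z %% height N) E.
move: E1 E2; rewrite /= (negbTE en) (negbTE en') !divnMDl // !modnMDl !modn_mod.
rewrite ![(_ %% _) %/ _]divn_small ?ltn_pmod // !addn0.
move=> /(place_inj g1 g2) /addnI E1 E2.
move: en en' E1 E2; rewrite /old -/(r N).
set a := if e < _ then _ else _; set b := if e' < _ then _ else _ => en en' E1 E2.
have : a = b by rewrite (divn_eq a (height N)) (divn_eq b (height N)) E1 E2.
exact: skip_inj.
Qed.

Definition height_pos (N v : nat) : nat :=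
  index v (map (pos_height N) (iota 0 (height N))).

Lemma height_posP N v : v < height N ->
  height_pos N v < height N /\ pos_height N (height_pos N v) = v.
Proof.
move=> vh; set s := map (pos_height N) (iota 0 (height N)).
have us : uniq s.
  rewrite map_inj_in_uniq ?iota_uniq // => a b; rewrite !mem_iota => /andP[_ ah] /andP[_ bh].
  exact: pos_height_inj.
have sub : {subset s <= iota 0 (height N)}.
  by move=> x /mapP[e]; rewrite !mem_iota /= => eh ->; exact: pos_height_lt.
(* Pigeonhole: an injective map of a finite set into itself is onto. *)
have [] := uniq_min_size us sub; first by rewrite size_map.
move=> _ eqi.
have vs : v \in s by rewrite eqi mem_iota.
have is_ : height_pos N v < height N.
  by rewrite /height_pos -[X in _ < X](size_iota 0) -(size_map (pos_height N)) index_mem.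
split => //.
by have := nth_index 0 vs; rewrite (nth_map 0) ?size_iota // nth_iota.
Qed.

Lemma pos_heightK N e : e < height N -> height_pos N (pos_height N e) = e.
Proof.
move=> eh; have [lt E] := height_posP (pos_height_lt eh).
exact: pos_height_inj E.
Qed.

End numbering.

Local Open Scope classical_set_scope.
Local Open Scope ring_scope.

(** * Completed Lebesgue measure *)

Lemma le_mu (R : realType) d (X : measurableType d) (mu : {measure set X -> \bar R})
    (A B : set X) : measurable A -> measurable B -> A `<=` B -> (mu A <= mu B)%E.
Proof. by move=> mA mB; apply: le_measure; rewrite inE. Qed.

Section completed_lebesgue.
Variable R : realType.

Definition leb : {measure set _ -> \bar R} := @completed_lebesgue_measure R.

Lemma leb_itv (x y : bool) (a b : R) : a <= b ->
  measurable ([set` Interval (BSide x a) (BSide y b)] : set (caratheodory_type (wlength (@idfun R))^*%mu)) /\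
  leb [set` Interval (BSide x a) (BSide y b)] = (b - a)%:E.
Proof.
move=> ab; split.
  apply: sub_caratheodory.
  exact: (@measurable_itv R (Interval (BSide x a) (BSide y b))).
change (lebesgue_measure [set` Interval (BSide x a) (BSide y b)] = (b - a)%:E).
rewrite lebesgue_measure_itv /= lte_fin; case: ltP => //.
by move=> ba; rewrite (@le_anti _ _ a b) ?ab// subrr.
Qed.

Let T := caratheodory_type (wlength (@idfun R))^*%mu.

Definition shift (t x : R) : R := x + t.

Lemma ocitv_translate (t : R) (A : set R) : ocitv A ->
  ocitv (shift t @` A) /\
  wlength idfun (shift t @` A) = wlength idfun A.
Proof.
move=> [[a b] _ <-] /=.
have -> : shift t @` [set` `]a, b]] = [set` `](a + t), (b + t)]].
  apply/seteqP; split=> [_ [x /= xab <-]|y /=].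
    by move: xab; rewrite /shift /= !in_itv /= ltrD2r lerD2r.
  rewrite in_itv /= => yab; exists (y - t); last by rewrite /shift subrK.
  by rewrite /= in_itv /= ltrBrDr lerBlDr.
split; first by exists (a + t, b + t).
rewrite !wlength_itv /= !lte_fin ltrD2r; case: ifP => // _.
by rewrite -!EFinB opprD addrACA subrr addr0.
Qed.

Lemma mu_ext_translate_le (t : R) (A : set R) :
  (mu_ext (wlength (@idfun R)) (shift t @` A) <=
   mu_ext (wlength (@idfun R)) (A : set (ocitv_type R)))%E.
Proof.
apply: le_ereal_inf_tmp => _ [F [mF AF] <-].
apply: ereal_inf_lbound.
exists (fun k => shift t @` F k).
  split=> [k|]; first by have [] := ocitv_translate t (mF k).
  by move=> _ [x /AF [k _ Fkx] <-]; exists k => //; exists x.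
by congr (limn _); apply/funext=> n; apply: eq_bigr => k _; have [] := ocitv_translate t (mF k).
Qed.

Lemma image_translateK (t : R) (A : set R) :
  shift (- t) @` (shift t @` A) = A.
Proof.
apply/seteqP; split=> [_ [_ [x Ax <-] <-]|x Ax]; first by rewrite /shift addrK.
by exists (x + t); [exists x|rewrite /shift addrK].
Qed.

Lemma mu_ext_translate (t : R) (A : set R) :
  (mu_ext (wlength (@idfun R)) (shift t @` A) =
   mu_ext (wlength (@idfun R)) (A : set (ocitv_type R)))%E.
Proof.
apply/eqP; rewrite eq_le mu_ext_translate_le /=.
by rewrite -{1}(image_translateK t A) mu_ext_translate_le.
Qed.

(** Caratheodory's criterion for the translate of [A], tested on [X], is the criterion for [A]
    tested on [X] translated back, and the outer measure is invariant. *)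
Lemma leb_translate (t : R) (A : set T) : measurable A ->
  measurable (shift t @` A : set T) /\
  leb (shift t @` A) = leb A.
Proof.
move=> mA; split; last exact: mu_ext_translate.
move=> X.
have tI (B : set R) : shift t @` (shift (- t) @` X `&` B) =
    X `&` shift t @` B.
  apply/seteqP; split=> [_ [_ [[x Xx <-] Bx] <-]|z [Xx [y By yz]]].
    by rewrite /shift subrK; split => //; exists (x - t) => //; rewrite /shift subrK.
  by exists y => //; split => //; exists z => //; rewrite -yz /shift addrK.
have -> : ~` (shift t @` A) = shift t @` (~` A).
  apply/seteqP; split=> [x nAx|_ [x nAx <-] [y Ay /addIr yx]].
    by exists (x - t); [move=> ?; apply: nAx; exists (x - t) => //; rewrite /shift subrK|rewrite /shift subrK].
  by apply: nAx; rewrite -yx.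
rewrite -!tI.
have e (B : set R) : (wlength (@idfun R))^*%mu (shift t @` B) = (wlength (@idfun R))^*%mu B.
  exact: mu_ext_translate.
apply: etrans (esym (mu_ext_translate (- t) X)) _.
apply: etrans (mA (shift (- t) @` X)) _.
by congr (_ + _)%E; exact: esym (mu_ext_translate t _).
Qed.

(** The definition of the outer measure covers [A] by half-open intervals with excess at most
    [eps / 3]; finitely many of them, [B n], miss at most [eps / 3] of [A]; each of these is
    replaced by a member of [G], for a last total error of [eps / 3]. *)
Lemma leb_dense (G : set (set T)) :
  (forall U, G U -> measurable U) -> G set0 ->
  (forall U V, G U -> G V -> G (U `|` V)) ->
  (forall (a b eps : R), 0 < eps -> exists2 U, G U &
     (leb (([set` `]a, b]] : set T) `+` U) <= eps%:E)%E) ->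
  forall A : set T, measurable A -> (leb A < +oo)%E -> forall eps : R, 0 < eps ->
  exists2 U, G U & (leb (A `+` U) <= eps%:E)%E.
Proof.
move=> mG G0 GU Gitv A mA Afin eps eps0.
have mY (D E : set T) : measurable D -> measurable E -> measurable (D `+` E : set T).
  by move=> mD mE; apply: measurableU; exact: measurableD.
have Afn : leb A \is a fin_num by rewrite ge0_fin_numE.
have e3 : 0 < eps / 3 by rewrite divr_gt0.
have [_ [F [mF AF] <-] Flt] := lb_ereal_inf_adherent e3 Afn.
have mF' k : measurable (F k : set T).
  by apply: sub_caratheodory; apply: sub_sigma_algebra; exact: mF.
pose B n : set T := \big[setU/set0]_(k < n) F k.
have mB n : measurable (B n) by apply: bigsetU_measurable => k _.
pose Boo : set T := \bigcup_k F k.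
have mBoo : measurable Boo by exact: bigcupT_measurable.
have lebBoo : (leb Boo < leb A + (eps / 3)%:E)%E.
  apply: le_lt_trans Flt.
  apply: le_trans (outer_measure_sigma_subadditive (wlength (@idfun R))^*%mu F) _.
  apply: lee_nneseries => // n _.
  by rewrite -((measurable_mu_extE (wlength (@idfun R))) (F n)).
have BA : (leb (Boo `\` A) <= (eps / 3)%:E)%E.
  rewrite measureD//; last by apply: lt_trans lebBoo _; rewrite lte_add_pinfty ?ltry.
  rewrite setIidr // leeBlDr // addeC; exact: ltW.
have : leb (A `\` B n) @[n --> \oo] --> 0%E.
  have -> : 0%E = leb (\bigcap_n (A `\` B n)).
    rewrite -[LHS](@measure0 _ _ _ leb); congr (leb _).
    apply/esym/seteqP; split => // x h; exfalso.
    have [Ax _] := h 0%N I; have [k _ Fk] := AF _ Ax.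
    have [_] := h k.+1 I; apply.
    rewrite /B big_ord_recr /=; by right.
  apply: nonincreasing_cvg_mu.
  - apply: le_lt_trans Afin; apply: le_mu; [exact: measurableD|by []|exact: subDsetl].
  - by move=> i; exact: measurableD.
  - by apply: bigcapT_measurable => i; exact: measurableD.
  - move=> n m nm; apply/subsetPset; apply: setDS.
    by rewrite /B -!bigcup_mkord => x [k /= kn Fk]; exists k => //=; exact: leq_trans nm.
move=> /fine_cvgP[_ /cvgrPdist_lt /(_ _ e3)[n _ /(_ n (leqnn n))/=]].
rewrite sub0r normrN => ltn.
have ABn : (leb (A `\` B n) <= (eps / 3)%:E)%E.
  have fn : leb (A `\` B n) \is a fin_num.
    rewrite ge0_fin_numE //; apply: le_lt_trans Afin.
    by apply: le_mu; [exact: measurableD|by []|exact: subDsetl].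
  rewrite -(fineK fn) lee_fin; apply: ltW; apply: le_lt_trans ltn; exact: ler_norm.
have [U GUn BU] : exists2 U, G U & (leb (B n `+` U) <= (eps / 3)%:E)%E.
  elim: n (eps / 3) e3 {ABn BA ltn Flt lebBoo} => [|n IH] e e0.
    by exists set0; rewrite // /B big_ord0 setYK measure0 lee_fin ltW.
  have e20 : 0 < e / 2 by rewrite divr_gt0.
  have [U GU1 BU] := IH _ e20.
  have [[a b] _ abF] := mF n.
  have [V GV FV] := Gitv a b _ e20.
  exists (U `|` V); first exact: GU.
  rewrite (splitr e) EFinD.
  apply: le_trans (leeD BU FV).
  have mFn : measurable ([set` `]a, b]] : set T) by rewrite [X in measurable X]abF; exact: mF'.
  have mU := mG _ GU1; have mV := mG _ GV.
  apply: le_trans (measureU2 _ (mY _ _ (mB n) mU) (mY _ _ mFn mV)).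
  apply: le_mu; [apply: mY => //; exact: measurableU|by apply: measurableU; exact: mY|].
  have -> : B n.+1 = B n `|` [set` `]a, b]] by rewrite /B big_ord_recr /= -abF.
  move=> x [[[Bx|Fx] /not_orP[nUx nVx]]|[[Ux|Vx] /not_orP[nBx nFx]]].
  - by left; left.
  - by right; left.
  - by left; right.
  - by right; right.
exists U => //.
have mU := mG _ GUn.
have -> : eps = eps / 3 + (eps / 3 + eps / 3) by lra.
rewrite !EFinD.
apply: le_trans (leeD ABn (leeD BA BU)).
have m1 := measurableD mA (mB n); have m2 := measurableD mBoo mA.
have m3 := mY _ _ (mB n) mU.
apply: le_trans (leeD2l _ (measureU2 _ m2 m3)).
apply: le_trans (measureU2 _ m1 (measurableU _ _ m2 m3)).
apply: le_mu; [exact: mY|by apply: measurableU => //; exact: measurableU|].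
move=> x [[Ax nUx]|[Ux nAx]].
  by have [Bx|nBx] := pselect (B n x); [right; right; left|left].
have [Bx|nBx] := pselect (B n x); last by right; right; right.
right; left; split => //; move: Bx; rewrite /B.
rewrite -bigcup_mkord => -[k _ Fk]; by exists k.
Qed.

(** The pieces may overlap, which allows them to be all the levels of all the columns; [seqDU]
    extracts disjoint ones for the computation of the measure. *)
Lemma piecewise_translation (f : T -> T) (E : nat -> set T) (t : nat -> R) :
  bijective f -> (forall n, measurable (E n)) ->
  (forall x, exists n, E n x) ->
  (forall n x, E n x -> f x = shift (t n) x) ->
  invertible_measure_preserving leb f.
Proof.
move=> bf mE coverE fE.
have finj := bij_inj bf.
have im A n : f @` (A `&` E n) = shift (t n) @` (A `&` E n).
  by apply/seteqP; split=> [_ [x [Ax Ex] <-]|_ [x [Ax Ex] <-]]; exists x => //; rewrite (fE n).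
have imA (F : nat -> set T) A : (forall x, exists n, F n x) ->
    f @` A = \bigcup_n f @` (A `&` F n).
  move=> coverF; rewrite -image_bigcup -setI_bigcupr; congr (_ @` _).
  apply/seteqP; split=> [x Ax|x []//]; split => //.
  by have [n Fn] := coverF x; exists n.
have mim A : measurable A -> measurable (f @` A).
  move=> mA; rewrite (imA E)//; apply: bigcupT_measurable => n.
  rewrite im; apply: (leb_translate _ _).1; exact: measurableI.
have mpre A : measurable A -> measurable (f @^-1` A).
  move=> mA.
  have -> : f @^-1` A = \bigcup_n (E n `&` shift (- t n) @` A).
    apply/seteqP; split=> [x Afx|x [n _ [Ex [y Ay yx]]]].
      have [n En] := coverE x; exists n => //; split => //.
      by exists (f x) => //; rewrite (fE n)// /shift addrK.
    rewrite /preimage/= (fE n)// -yx /shift subrK//.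
  apply: bigcupT_measurable => n; apply: measurableI => //.
  exact: (leb_translate _ _).1.
split; [exact: bf|by move=> _ Y mY; rewrite setTI; exact: mpre|exact: mim|].
move=> B mB; set A := f @^-1` B.
have mA : measurable A by exact: mpre.
have -> : B = f @` A.
  apply/seteqP; split=> [y By|_ [x Ax <-]//].
  by case: bf => g fK gK; exists (g y); rewrite ?/A/= /preimage/= gK.
pose F := seqDU E.
have mF n : measurable (F n).
  apply: measurableD => //; exact: bigsetU_measurable.
have tF : trivIset setT F by exact: trivIset_seqDU.
have coverF x : exists n, F n x.
  have [n En] := coverE x.
  have : (\bigcup_n F n) x by rewrite /F -seqDU_bigcup_eq; exists n.
  by case=> k _ Fk; exists k.
have FE n : F n `<=` E n by move=> x [].
have im' n : f @` (A `&` F n) = shift (t n) @` (A `&` F n).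
  apply/seteqP; split=> [_ [x [Ax Ex] <-]|_ [x [Ax Ex] <-]]; exists x => //; rewrite (fE n)//; exact: FE.
rewrite (imA F A)// measure_bigcup//=; last 2 first.
- by move=> n _; apply: mim; exact: measurableI.
- move=> i j _ _ [_ [[x [_ Fx] <-] [y [_ Fy] /finj yx]]].
  by apply: (tF i j I I); exists x; split => //; rewrite -yx.
have -> : leb A = leb (\bigcup_n (A `&` F n)).
  rewrite -setI_bigcupr; congr (leb _); apply/esym/setIidPl => x _.
  by have [n Fn] := coverF x; exists n.
rewrite measure_bigcup//=; last 2 first.
- by move=> n _; exact: measurableI.
- by move=> i j _ _ [x [[_ Fx] [_ Fy]]]; apply: (tF i j I I); exists x.
apply: eq_eseriesr => n _.
by rewrite im'; apply/esym/(leb_translate _ _).2; exact: measurableI.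
Qed.

End completed_lebesgue.

(* [inX N] is the union of the levels of the column [N] of a cutting and stacking
   construction, and [ht N x] is the height at which [x] occurs in it. *)
Record columns (R : realType) (d : measure_display) (X : measurableType d)
    (mu : {measure set X -> \bar R}) (T : X -> X) (L K : nat -> nat)
    (inX : nat -> pred X) (ht : nat -> X -> nat) : Prop := Columns {
  col_invertible : invertible_measure_preserving mu T;
  col_cover : forall x, exists N, inX N x;
  col_lt : forall N x, inX N x -> (ht N x < height L K N)%N;
  col_sub : forall N x, inX N x =
    inX N.+1 x && slot (L N) (K N) (ht N.+1 x %/ height L K N)%N;
  col_mod : forall N x, inX N x -> ht N x = (ht N.+1 x %% height L K N)%N;
  col_succ : forall N x, inX N x -> ((ht N x).+1 < height L K N)%N ->
    inX N (T x) /\ ht N (T x) = (ht N x).+1;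
  col_pred : forall N x, inX N x -> (0 < ht N x)%N ->
    exists y, [/\ T y = x, inX N y & (ht N y).+1 = ht N x];
  col_level : forall N v, (v < height L K N)%N ->
    measurable [set x | inX N x && (ht N x == v)] /\
    mu [set x | inX N x && (ht N x == v)] = ((copies L K N)%:R^-1)%:E;
  col_dense : forall A : set X, measurable A -> (mu A < +oo)%E ->
    forall eps : R, 0 < eps -> exists N (P : pred nat),
      (mu (A `+` [set x | inX N x && P (ht N x)]) <= eps%:E)%E }.

(** * Cutting and stacking on the real line *)

Section construction.
Variables (R : realType) (L K : nat -> nat).
Hypotheses (L0 : forall N, (0 < L N)%N) (K4 : forall N, (4 <= K N)%N).
Local Notation height := (height L K).
Local Notation copies := (copies L K).
Local Notation old := (old L K).
Local Notation pos_height := (pos_height L K).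
Local Notation height_pos := (height_pos L K).
Let r N := cuts (L N) (K N).
Let q N : R := (copies N)%:R.

Let q0 N : 0 < q N. Proof. by rewrite ltr0n copies_gt0. Qed.
Let qn0 N : q N != 0. Proof. by rewrite gt_eqF. Qed.
Let r0 N : (0 < r N)%N. Proof. by have := cuts_ge4 L0 K4 N; rewrite -/(r N); lia. Qed.
Let qS N : q N.+1 = q N * (r N)%:R. Proof. by rewrite /q /= natrM mulrC. Qed.
Let h0 N : (0 < height N)%N. Proof. exact: height_gt0. Qed.

(** Column [N] starts at the point [origin N / copies N]. The next one starts [height N] cells
    further left, which makes the old positions the second block, as in [old]; the factor [cuts]
    passes to the finer cells. *)
Fixpoint origin (N : nat) : int :=
  if N is N'.+1 then (origin N' - (height N')%:Z) * (cuts (L N') (K N'))%:Z else 0.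

Definition pos (N : nat) (x : R) : int :=
  Num.floor (x * (copies N)%:R) - origin N.

Definition inR (N : nat) (x : R) : bool := 0 <= pos N x < (height N)%:Z.

Definition hgt (N : nat) (x : R) : nat := pos_height N `|pos N x|%N.

Lemma floor_divz (y : R) (n : nat) : (0 < n)%N ->
  Num.floor y = (Num.floor (y * n%:R) %/ n%:Z)%Z.
Proof.
move=> n0; set F := Num.floor (y * n%:R).
have nR : 0 < n%:R :> R by rewrite ltr0n.
have /andP[F1 F2] := floor_itv (y * n%:R); rewrite -/F in F1 F2.
have nz : (n%:Z != 0) by lia.
have c0 := modz_ge0 F nz.
have c1 := ltz_pmod F (ltac:(lia) : 0 < n%:Z).
have FE := divz_eq F n%:Z.
set D := (F %/ n%:Z)%Z in FE *; set c := (F %% n%:Z)%Z in c0 c1 FE.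
apply/floor_def/andP; split.
  rewrite -(ler_pM2r nR); apply: le_trans F1.
  rewrite -[n%:R]/((n%:Z)%:~R) -intrM ler_int; lia.
rewrite -(ltr_pM2r nR); apply: lt_le_trans F2 _.
rewrite -[n%:R]/((n%:Z)%:~R) -intrM ler_int; lia.
Qed.

Lemma posS N x : pos N x = (pos N.+1 x %/ (r N)%:Z)%Z - (height N)%:Z.
Proof.
rewrite /pos (floor_divz _ (r0 N)) -mulrA -[X in _ * X]/(q N * _) -qS /=.
rewrite -[(cuts (L N) (K N) * copies N)%:R]/(q N.+1) -/(r N).
have rz : ((r N)%:Z != 0) by have := r0 N; lia.
rewrite [X in _ = (X %/ _)%Z - _]addrC -mulNr divzMDl //; ring.
Qed.

Lemma inRS N x : inR N x -> inR N.+1 x.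
Proof.
rewrite /inR (posS N x) => /andP[]; set p := pos N.+1 x => p1 p2.
have rz : ((r N)%:Z != 0) by have := r0 N; lia.
have c0 := modz_ge0 p rz.
have c1 := ltz_pmod p (ltac:(have := r0 N; lia) : 0 < (r N)%:Z).
have pE := divz_eq p (r N)%:Z.
have rw : (5 * r N <= width (L N) (K N))%N by rewrite /width /spread leq_mul2l /= leq_pmulr.
have h1 := h0 N; have r1 := r0 N.
have -> : (height N.+1)%:Z = (width (L N) (K N))%:Z * (height N)%:Z by rewrite -PoszM.
move: p1 p2 c0 c1 pE rw h1 r1; set a := (p %/ _)%Z; set c := (p %% _)%Z.
move: (r N) (height N) (width _ _) => R' H W p1 p2 c0 c1 -> rw h1 r1.
apply/andP; split; nia.
Qed.

Lemma inR_old N x : inR N.+1 x ->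
  inR N x = old N `|pos N.+1 x|%N /\
  (inR N x -> `|pos N x|%N = (`|pos N.+1 x| %/ r N - height N)%N).
Proof.
rewrite /inR (posS N x) => /andP[]; case: (pos N.+1 x) => // e _ _ /=.
rewrite /old -/(r N) divz_nat -leq_divRL // [(2 * _)%N]mulnA -ltn_divLR //.
move: (e %/ r N)%N (height N) => a b; split; lia.
Qed.

Lemma hgt_lt N x : inR N x -> (hgt N x < height N)%N.
Proof. by move=> /andP[p0 p1]; apply: pos_height_lt => //; lia. Qed.

Lemma pos_lt N x : inR N x -> (`|pos N x| < height N)%N.
Proof. by move=> /andP[p0 p1]; lia. Qed.

Lemma inR_sub N x :
  inR N x = inR N.+1 x && slot (L N) (K N) (hgt N.+1 x %/ height N)%N.
Proof.
have [i|i] := boolP (inR N.+1 x); last by apply/negP => /inRS; exact/negP.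
have [-> _] := inR_old i; rewrite /=.
have e := pos_lt i; have [eo|en] := boolP (old _ _).
  by have [] := pos_height_old L0 K4 e eo.
by have := pos_height_new L0 K4 e en => /negbTE.
Qed.

Lemma hgt_mod N x : inR N x -> hgt N x = (hgt N.+1 x %% height N)%N.
Proof.
move=> i; have i' := inRS i; have [E1 E2] := inR_old i'.
have := pos_height_old L0 K4 (pos_lt i'); rewrite -E1 => /(_ i) [_ _ ->].
by rewrite /hgt E2.
Qed.

(* The point of column [N] at height [v] over the same point of the base as [x]. *)
Definition move_to (N : nat) (x : R) (v : nat) : R :=
  x + ((height_pos N v)%:Z - pos N x)%:~R / (copies N)%:R.

Lemma pos_add N x (z : int) : pos N (x + z%:~R / (copies N)%:R) = pos N x + z.
Proof.
rewrite /pos mulrDl mulfVK; last exact: qn0.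
rewrite floorDrz ?intr_int // intrKfloor; ring.
Qed.

Lemma move_inR N x v : (v < height N)%N -> inR N (move_to N x v).
Proof.
move=> vN; rewrite /inR /move_to pos_add addrC subrK.
by have [] := height_posP L0 K4 vN; lia.
Qed.

Lemma hgt_move N x v : (v < height N)%N -> hgt N (move_to N x v) = v.
Proof.
move=> vN; rewrite /hgt /move_to pos_add addrC subrK absz_nat.
by have [] := height_posP L0 K4 vN.
Qed.

Lemma pos_hgt N x : inR N x -> pos N x = (height_pos N (hgt N x))%:Z.
Proof.
by move=> i; rewrite /hgt pos_heightK ?pos_lt //; case/andP: i; case: pos.
Qed.

Lemma move_hgt N x : inR N x -> move_to N x (hgt N x) = x.
Proof. by move=> i; rewrite /move_to pos_hgt // subrr mul0r addr0. Qed.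

Lemma move_move N x v w : move_to N (move_to N x v) w = move_to N x w.
Proof.
rewrite {1}/move_to [in pos N _]/move_to pos_add /move_to.
rewrite -addrA -mulrDl -intrD; congr (_ + _%:~R / _); ring.
Qed.

(** A displacement by whole cells of column [N] preserves the remainder of the finer position modulo
    [r], hence the copy of column [N] in which the point lies; within one copy the two heights
    change by the same amount. *)
Lemma move_toS N x v : inR N x -> (v < height N)%N ->
  move_to N x v = move_to N.+1 x (hgt N.+1 x - hgt N x + v)%N.
Proof.
move=> i vN; have i' := inRS i.
set y := move_to N x v.
have iy : inR N y by exact: move_inR.
have hy : hgt N y = v by exact: hgt_move.
have iy' := inRS iy.
set z := (height_pos N v)%:Z - pos N x.
have yE : y = x + (z * (r N)%:Z)%:~R / (copies N.+1)%:R.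
  rewrite /y /move_to -/z intrM -[(copies N.+1)%:R]/(q N.+1) qS.
  by rewrite -[((r N)%:Z)%:~R]/((r N)%:R : R) invfM mulrACA divff ?mulr1 // pnatr_eq0; have := r0 N; lia.
have py : pos N.+1 y = pos N.+1 x + z * (r N)%:Z by rewrite yE pos_add.
have pmod : (`|pos N.+1 y| %% r N = `|pos N.+1 x| %% r N)%N.
  have : (`|pos N.+1 y|%N)%:Z = (`|pos N.+1 x|%N)%:Z + z * (r N)%:Z.
    by case/andP: iy' => ? _; case/andP: i' => ? _; rewrite !gez0_abs.
  move: (absz (pos N.+1 y)) (absz (pos N.+1 x)) (r N) => a b R'; clear yE py; clearbody z; case: z => k E.
    have -> : a = (k * R' + b)%N by nia.
    by rewrite modnMDl.
  have -> : b = (k.+1 * R' + a)%N by move: E; rewrite NegzE; nia.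
  by rewrite modnMDl.
have hE w : inR N w -> (hgt N.+1 w =
    place L K N (`|pos N.+1 w| %% r N) * height N + hgt N w)%N.
  move=> iw; have iw' := inRS iw; have [E1 E2] := inR_old iw'.
  have := pos_height_old L0 K4 (pos_lt iw'); rewrite -E1 => /(_ iw) [_ E3 _].
  by rewrite {1}(divn_eq (hgt N.+1 w) (height N)) -hgt_mod // {1}/hgt E3.
have <- : hgt N.+1 y = (hgt N.+1 x - hgt N x + v)%N.
  by rewrite !hE // hy pmod addnK.
rewrite /move_to -pos_hgt // py {1}yE; congr (_ + _%:~R / _); ring.
Qed.

Let deep N x := inR N x && ((hgt N x).+1 < height N)%N.

(** The empty places at both ends of a column keep its copies away from its bottom and top levels.
    Hence the map and its inverse are determined at every point by a large enough column, and no
    null set has to be discarded. *)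
Lemma hgt_inner N x : inR N x ->
  (0 < hgt N.+1 x)%N && ((hgt N.+1 x).+1 < height N.+1)%N.
Proof.
move=> i; have := i; rewrite inR_sub => /andP[i' s].
have /andP[s1 s2] := slot_bounds (L0 N) (K4 N) s.
have sp := spread_ge (L0 N) (K4 N); have l0 := L0 N.
move: s1 s2 (h0 N); rewrite /= /width leq_divRL // ltn_divLR //.
move: (hgt _ _) (height N) (spread _ _) sp => a b c; nia.
Qed.

Lemma deepS N x : deep N x -> deep N.+1 x /\
  move_to N.+1 x (hgt N.+1 x).+1 = move_to N x (hgt N x).+1.
Proof.
move=> /andP[i dx]; have /andP[_ dx'] := hgt_inner i.
split; first by apply/andP; split; [exact: inRS|].
rewrite [RHS]move_toS //; congr (move_to _ _ _).
by rewrite addnS subnK // (hgt_mod i) leq_mod.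
Qed.

Lemma deep_le N M x : (N <= M)%N -> deep N x -> deep M x /\
  move_to M x (hgt M x).+1 = move_to N x (hgt N x).+1.
Proof.
move=> /subnKC <-; elim: (M - N)%N => [|k IH] dN; rewrite ?addn0 // addnS.
by have [dk <-] := IH dN; exact: deepS.
Qed.

(** The left end of the interval moves by [height N / copies N >= 1] at each stage. Together with
    [origin_ge] for the right end, this shows that column [N] covers [[- N, N)]. *)
Lemma origin_le N : origin N <= - (N%:Z * (copies N)%:Z).
Proof.
elim: N => [|N IH]; first by rewrite mul0r.
have ch : (copies N <= height N)%N.
  elim: (N) => //= n; apply: leq_mul; rewrite /width /spread.
  by have := L0 n; nia.
rewrite /= PoszM -/(r N); have := r0 N; have := copies_gt0 L0 K4 N; move: ch IH.
move: (origin N) (height N) (copies N) (r N) => o h c R'; nia.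
Qed.

Lemma origin_ge N : N%:Z * (copies N)%:Z <= origin N + (height N)%:Z.
Proof.
elim: N => [|N IH]; first by rewrite mul0r.
have ch : (copies N <= height N)%N.
  elim: (N) => //= n; apply: leq_mul; rewrite /width /spread.
  by have := L0 n; nia.
have rw : (5 * r N <= width (L N) (K N))%N by rewrite /width /spread leq_mul2l /= leq_pmulr.
rewrite -[height N.+1]/(width (L N) (K N) * height N)%N -[copies N.+1]/(r N * copies N)%N
  -[origin N.+1]/((origin N - (height N)%:Z) * (r N)%:Z); have := r0 N; have := copies_gt0 L0 K4 N; move: ch IH rw.
move: (origin N) (height N) (copies N) (r N) (width _ _) => o h c R' w ch IH rw c0 r00.
have e1 : (5 * R')%:Z * h%:Z <= w%:Z * h%:Z by rewrite -!PoszM lez_nat leq_mul2r rw orbT.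
have e2 : N%:Z * c%:Z * R'%:Z <= (o + h%:Z) * R'%:Z by rewrite ler_wpM2r.
have e3 : c%:Z * R'%:Z <= h%:Z * R'%:Z by rewrite ler_wpM2r.
by clear IH rw ch; rewrite !PoszM in e1 *; lia.
Qed.

Lemma inR_bounded N x : - N%:R <= x < N%:R -> inR N x.
Proof.
move=> /andP[x1 x2]; rewrite /inR /pos subr_ge0 ltrBlDl.
have o1 := origin_le N; have o2 := origin_ge N.
apply/andP; split.
  apply: le_trans o1 _; rewrite -[X in X <= _](@intrKfloor R) le_floor //.
  rewrite intrN intrM -mulNr; apply: ler_wpM2r => //; exact: ltW.
apply: lt_le_trans o2; by rewrite floor_lt_int intrM (ltr_pM2r (q0 N)).
Qed.

Lemma inR_cover x : exists N, inR N x.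
Proof.
have [N xN] : exists N : nat, `|x| < N%:R.
  by exists (Num.bound `|x|); exact: (archi_boundP (normr_ge0 x)).
by exists N; apply: inR_bounded; move: xN; rewrite ltr_norml => /andP[/ltW -> ->].
Qed.

Lemma deep_cover x : exists N, deep N x.
Proof.
have [N i] := inR_cover x; exists N.+1.
by have /andP[_ dx] := hgt_inner i; apply/andP; split => //; exact: inRS.
Qed.

Definition tower_map (x : R) : R :=
  let N := ex_minn (deep_cover x) in move_to N x (hgt N x).+1.

Lemma tower_mapE N x : deep N x -> tower_map x = move_to N x (hgt N x).+1.
Proof.
move=> dN; rewrite /tower_map; case: ex_minnP => M dM /(_ N dN) MN.
by have [_] := deep_le MN dM.
Qed.

Lemma hgt_tower_map N x : inR N x -> ((hgt N x).+1 < height N)%N ->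
  inR N (tower_map x) /\ hgt N (tower_map x) = (hgt N x).+1.
Proof.
move=> i dx; rewrite (@tower_mapE N); last by apply/andP.
by split; [exact: move_inR|exact: hgt_move].
Qed.

Lemma tower_map_bij : bijective tower_map.
Proof.
have inj : injective tower_map.
  move=> x y Txy; have [N dx] := deep_cover x; have [M dy] := deep_cover y.
  have [dx' _] := deep_le (leq_maxl N M) dx.
  have [dy' _] := deep_le (leq_maxr N M) dy.
  set k := maxn N M in dx' dy'.
  have /andP[ix hx] := dx'; have /andP[iy hy] := dy'.
  have [_ ex] := hgt_tower_map ix hx; have [_ ey] := hgt_tower_map iy hy.
  have hxy : hgt k x = hgt k y by apply: succn_inj; rewrite -ex -ey Txy.
  rewrite -(move_hgt ix) -(move_hgt iy) -hxy.
  rewrite -(move_move k x (hgt k x).+1) -(move_move k y (hgt k y).+1).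
  by rewrite -!tower_mapE // Txy.
have surj y : exists x, tower_map x = y.
  (* In column [N.+1] the point [y] is not on the bottom level, so the level below it exists. *)
  have [N i] := inR_cover y; have i' := inRS i; have /andP[h1 h2] := hgt_inner i.
  exists (move_to N.+1 y (hgt N.+1 y).-1).
  have lt : ((hgt N.+1 y).-1 < height N.+1)%N by lia.
  rewrite (@tower_mapE N.+1); last first.
    by rewrite /deep move_inR // hgt_move // prednK // ltnW.
  by rewrite hgt_move // prednK // move_move move_hgt.
have [g gK] := choice surj.
by exists g => // x; apply: inj; rewrite gK.
Qed.

Local Notation T0 := (caratheodory_type (wlength (@idfun R))^*%mu).

Lemma level_itv N v : (v < height N)%N ->
  [set x | inR N x && (hgt N x == v)] =
  [set` Interval (BLeft (((height_pos N v)%:Z + origin N)%:~R / (copies N)%:R))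
     (BLeft (((height_pos N v)%:Z + origin N + 1)%:~R / (copies N)%:R : R))].
Proof.
move=> vN; have [pN pE] := height_posP L0 K4 vN.
apply/seteqP; split => x /=; rewrite in_itv /= (ler_pdivrMr _ _ (q0 N)) (ltr_pdivlMr _ _ (q0 N)).
  move=> /andP[i /eqP hx]; have := pos_hgt i; rewrite hx /pos => e.
  by apply/andP; rewrite -e subrK; have /andP := floor_itv (x * (copies N)%:R).
move=> /floor_def E; have pE' : pos N x = (height_pos N v)%:Z by rewrite /pos E addrK.
by rewrite /inR /hgt pE' /= pE eqxx andbT; lia.
Qed.

Lemma leb_level N v : (v < height N)%N ->
  measurable ([set x | inR N x && (hgt N x == v)] : set T0) /\
  leb R [set x | inR N x && (hgt N x == v)] = ((copies N)%:R^-1)%:E.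
Proof.
move=> vN; rewrite level_itv //.
have lt : ((height_pos N v)%:Z + origin N)%:~R / (copies N)%:R <=
          ((height_pos N v)%:Z + origin N + 1)%:~R / (copies N)%:R :> R.
  by rewrite ler_pM2r ?invr_gt0 ?q0 // ler_int; lia.
have [mI ->] := leb_itv true true lt; split => //.
by rewrite -mulrBl -intrB addrAC subrr add0r mul1r.
Qed.

Lemma measurable_levels N (P : pred nat) :
  measurable ([set x | inR N x && P (hgt N x)] : set T0).
Proof.
have -> : [set x | inR N x && P (hgt N x)] =
    \bigcup_(v in [set v | (v < height N)%N && P v]) [set x | inR N x && (hgt N x == v)].
  apply/seteqP; split=> [x /= /andP[i Px]|x [v /= /andP[vN Pv] /andP[i /eqP hv]]].
    by exists (hgt N x) => /=; [rewrite hgt_lt|rewrite i eqxx].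
  by rewrite i hv.
by apply: bigcup_measurable => v /= /andP[vN _]; have [] := leb_level vN.
Qed.

(** Keep the levels whose left end, [l x] below, lies in []a, b]]. In a column that covers the
    interval, errors only occur within one cell to the right of [a] and of [b]. *)
Lemma itv_dense (a b eps : R) : 0 < eps -> exists N (P : pred nat),
  (leb R (([set` `]a, b]] : set T0) `+` [set x | inR N x && P (hgt N x)]) <= eps%:E)%E.
Proof.
move=> eps0.
pose N := maxn (Num.bound `|2 / eps|) (maxn (Num.bound `|a|) (Num.bound `|b|)).
have NE : 2 / eps <= N%:R.
  apply: le_trans (ler_norm _) _; apply: ltW; apply: lt_le_trans (archi_boundP (normr_ge0 _)) _.
  by rewrite ler_nat leq_maxl.
have aN : `|a| < N%:R.
  apply: lt_le_trans (archi_boundP (normr_ge0 _)) _.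
  by rewrite ler_nat; apply: leq_trans (leq_maxr _ _); exact: leq_maxl.
have bN : `|b| < N%:R.
  apply: lt_le_trans (archi_boundP (normr_ge0 _)) _.
  by rewrite ler_nat; apply: leq_trans (leq_maxr _ _); exact: leq_maxr.
have qe : (q N)^-1 + (q N)^-1 <= eps.
  rewrite -mulr2n -mulr_natl ler_pdivrMr // -ler_pdivrMl // mulrC.
  by apply: le_trans NE _; rewrite ler_nat ltnW // copies_ge.
pose l x : R := (Num.floor (x * q N))%:~R / q N.
have l_itv x : l x <= x < l x + (q N)^-1.
  have /andP[f1 f2] := floor_itv (x * q N).
  rewrite /l ler_pdivrMr // f1 /= -[X in _ + X]mul1r -mulrDl ltr_pdivlMr //.
  by rewrite intrD in f2.
pose P v := a < ((height_pos N v)%:Z + origin N)%:~R / q N <= b.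
have PE x : inR N x -> P (hgt N x) = (a < l x <= b).
  by move=> i; rewrite /P -pos_hgt // /pos subrK.
exists N, P.
have qi : 0 < (q N)^-1 by rewrite invr_gt0.
have [mA eA] := leb_itv true true (ltac:(by rewrite lerDl ltW) : a <= a + (q N)^-1).
have [mB eB] := leb_itv true true (ltac:(by rewrite lerDl ltW) : b <= b + (q N)^-1).
have mI : measurable ([set` `]a, b]] : set T0).
  by apply: sub_caratheodory; exact: (@measurable_itv R `]a, b]).
have mU := measurable_levels N P.
apply: (@le_trans _ _ (leb R ([set` `[a, a + (q N)^-1[] `|` [set` `[b, b + (q N)^-1[]))).
  apply: le_mu; [by apply: measurableU; exact: measurableD|exact: measurableU|].
  move=> x /= [[]|[]]; rewrite /= !in_itv /=; have /andP[l1 l2] := l_itv x.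
    move=> /andP[ax xb] nU; left.
    have i : inR N x.
      apply: inR_bounded; move: aN bN; rewrite !ltr_norml => /andP[a1 _] /andP[_ b2].
      by rewrite (ltW (lt_trans a1 ax)) (le_lt_trans xb b2).
    rewrite i PE //= in nU; rewrite (ltW ax) /=; apply: lt_le_trans l2 _.
    rewrite lerD2r leNgt; apply/negP => al; apply: nU.
    by rewrite al (le_trans l1 xb).
  move=> /andP[i]; rewrite PE // => /andP[al lb] nI; right.
  have bx : b < x.
    by rewrite ltNge; apply/negP => xb; apply: nI; rewrite xb (lt_le_trans al l1).
  by rewrite (ltW bx) /=; apply: lt_le_trans l2 _; rewrite lerD2r.
apply: le_trans (measureU2 _ mA mB) _.
apply: (@le_trans _ _ ((a + (q N)^-1 - a)%:E + (b + (q N)^-1 - b)%:E)%E).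
  by apply: leeD; [rewrite -eA|rewrite -eB].
by rewrite -EFinD lee_fin; move: qe; lra.
Qed.

Lemma leb_columns : columns (leb R) (tower_map : T0 -> T0) L K inR hgt.
Proof.
split.
- pose E n : set T0 := if (unpickle n : option (nat * nat)) is Some (N, v)
    then (if (v.+1 < height N)%N then [set x | inR N x && (hgt N x == v)] else set0)
    else set0.
  pose t n : R := if (unpickle n : option (nat * nat)) is Some (N, v)
    then ((height_pos N v.+1)%:Z - (height_pos N v)%:Z)%:~R / (copies N)%:R else 0.
  apply: (piecewise_translation (E := E) (t := t)).
  + exact: tower_map_bij.
  + move=> n; rewrite /E; case: unpickle => [[N v]|//]; case: ifP => // vN.
    by have [] := leb_level (ltnW vN).
  + move=> x; have [N /andP[i dx]] := deep_cover x.
    by exists (pickle (N, hgt N x)); rewrite /E pickleK dx /= i eqxx.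
  + move=> n x; rewrite /E /t; case: unpickle => [[N v]|//]; case: ifP => // vN.
    move=> /andP[i /eqP hx]; rewrite (@tower_mapE N); last by rewrite /deep i hx.
    by rewrite /move_to (pos_hgt i) hx.
- exact: inR_cover.
- exact: hgt_lt.
- exact: inR_sub.
- exact: hgt_mod.
- by move=> N x; exact: hgt_tower_map.
- move=> N x i hx; exists (move_to N x (hgt N x).-1).
  have lt : ((hgt N x).-1 < height N)%N.
    by apply: leq_ltn_trans (hgt_lt i); exact: leq_pred.
  have hy := hgt_move x lt; have iy := move_inR x lt; rewrite hy prednK //; split=> //.
  rewrite (@tower_mapE N); last by rewrite /deep iy hy prednK // hgt_lt.
  by rewrite hy prednK // move_move move_hgt.
- by move=> N v; exact: leb_level.
- move=> A mA Afin eps eps0.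
  pose G U := exists N (P : pred nat), U = [set x | inR N x && P (hgt N x)].
  (* Unions of levels remain so in later columns, so that two of them can be joined in a common
     column. *)
  have GS N M (P : pred nat) : exists P' : pred nat,
      [set x | inR N x && P (hgt N x)] = [set x | inR (N + M) x && P' (hgt (N + M) x)].
    elim: M => [|M [P' ->]]; first by exists P; rewrite addn0.
    exists (fun v => slot (L (N + M)) (K (N + M)) (v %/ height (N + M)) && P' (v %% height (N + M))%N).
    apply/seteqP; split => x /=; rewrite addnS andbA -inR_sub => /andP[i];
      by rewrite i -hgt_mod.
  have [U [N [P UE]] UA] : exists2 U, G U & (leb R (A `+` U) <= eps%:E)%E.
    apply: leb_dense => //.
    + by move=> U [N [P ->]]; exact: measurable_levels.
    + by exists 0%N, pred0; apply/esym/seteqP; split => // x /=; rewrite andbF.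
    + move=> U V [N [P ->]] [M [Q ->]].
      have [P' ->] := GS N M P; have [Q' ->] := GS M N Q; rewrite [(M + N)%N]addnC.
      exists (N + M)%N, (predU P' Q'); apply/seteqP; split => x /=.
        by case=> /andP[-> ->]; rewrite ?orbT.
      by case/andP=> -> /orP[->|->]; [left|right].
    + move=> a b e e0; have [N [P le]] := itv_dense a b e0.
      by exists [set x | inR N x && P (hgt N x)] => //; exists N, P.
  by exists N, P; rewrite -UE.
Qed.
End construction.

(** * The line as an infinite nonatomic Lebesgue space *)

Section leb_space.
Variable R : realType.
Local Notation T0 := (caratheodory_type (wlength (@idfun R))^*%mu).

Lemma leb_sigma_finite : sigma_finite setT (leb R).
Proof. exact: sigma_finiteT. Qed.

Lemma leb_setT : leb R setT = +oo%E.
Proof.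
change (lebesgue_measure (setT : set R) = +oo%E).
by rewrite -set_itvNyy lebesgue_measure_itv.
Qed.

Lemma leb_lebesgue_space : lebesgue_space (leb R).
Proof.
split; first exact: completed_lebesgue_measure_is_complete.
exists set0, `]-oo, +oo[; split => //.
exists setT, setT, id; split.
- by split; [exact: measurableT|rewrite setC0|rewrite setDT measure0].
- by split; [exact: measurableT|rewrite set_itvNyy|rewrite setDT measure0].
- by split => //; exists x.
- by move=> A _; rewrite image_id.
- by move=> A _ _; rewrite image_id.
Qed.

(** The line is cut into countably many cells of a length [e] below the measure of [A]: one of them
    meets [A] in a set of positive measure, at most [e]. *)
Lemma leb_nonatomic : nonatomic (leb R).
Proof.
move=> A mA A0.
have [e e0 eA] : exists2 e : R, 0 < e & (e%:E < leb R A)%E.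
  move: A0; case E : (leb R A) => [a| |//] A0; last by exists 1; rewrite // ltry.
  by exists (a / 2); rewrite ?lte_fin ?divr_gt0 //; move: A0; rewrite lte_fin; lra.
pose c n : set T0 := if (unpickle n : option int) is Some k
  then [set` Interval (BLeft (k%:~R * e)) (BLeft ((k + 1)%:~R * e))] else set0.
have lt (k : int) : k%:~R * e <= (k + 1)%:~R * e by rewrite ler_pM2r // ler_int; lia.
have mc n : measurable (c n).
  by rewrite /c; case: unpickle => // k; have [] := leb_itv true true (lt k).
have ce n : (leb R (c n) <= e%:E)%E.
  rewrite /c; case: unpickle => [k|]; last by rewrite measure0 lee_fin ltW.
  have [_ ->] := leb_itv true true (lt k).
  by rewrite intrD mulrDl mul1r addrAC subrr add0r.
have Ac : A = \bigcup_n (A `&` c n).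
  rewrite -setI_bigcupr; apply/esym/setIidPl => x _.
  exists (pickle (Num.floor (x / e))); first by [].
  rewrite /c pickleK /= in_itv /=.
  by rewrite -ler_pdivlMr // -ltr_pdivrMr // floor_itv.
have [n n0] : exists n, (0 < leb R (A `&` c n))%E.
  apply: contrapT => /forallNP h.
  have : (leb R).-negligible A.
    rewrite Ac; apply: negligible_bigcup => n.
    exists (A `&` c n); split => //; first exact: measurableI.
    by apply/eqP; rewrite eq_le measure_ge0 andbT leNgt; apply/negP; exact: h.
  by move=> /(measure_negligible mA) A1; move: A0; rewrite [X in (_ < X)%E]A1 ltxx.
exists (A `&` c n); split => //; first exact: measurableI.
rewrite n0 /=; apply: le_lt_trans eA; apply: le_trans (ce n).
by apply: le_mu => //; exact: measurableI.
Qed.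

End leb_space.

(** * Double counting of visits, and arithmetic of finite measures *)

Section measure_counting.
Context (R : realType) (d : measure_display) (X : measurableType d)
  (mu : {measure set X -> \bar R}).
Variables (E : set X) (G : nat -> set X) (n : nat).
Hypotheses (mE : measurable E) (Efin : (mu E < +oo)%E)
  (mG : forall k, measurable (G k)).

Lemma sum_measure_integral : (\sum_(k < n) mu (E `&` G k) =
  \int[mu]_(x in E) (\sum_(k < n) (x \in G k)%:R)%:E)%E.
Proof.
under eq_integral do rewrite -sumEFin.
rewrite ge0_integral_sum //; last first.
- move=> k; apply/measurable_EFinP.
  have -> : (fun x => (x \in G k)%:R) = \1_(G k) :> (X -> R).
    by apply/funext => x; rewrite indicE.
  by apply: measurable_indic.
apply: eq_bigr => k _; rewrite setIC -integral_indic //.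
Qed.

Let fin k : mu (E `&` G k) \is a fin_num.
Proof.
rewrite ge0_fin_numE //; apply: le_lt_trans Efin.
by apply: le_mu => //; exact: measurableI.
Qed.

Let sum_fineE : (\sum_(k < n) fine (mu (E `&` G k)))%:E = (\sum_(k < n) mu (E `&` G k))%E.
Proof. by rewrite -sumEFin; apply: eq_bigr => k _; rewrite fineK ?fin. Qed.

Let Efn : mu E \is a fin_num. Proof. by rewrite ge0_fin_numE. Qed.

Let m_count : measurable_fun E (fun x => (\sum_(k < n) (x \in G k)%:R)%:E : \bar R).
Proof.
apply/measurable_EFinP; apply: measurable_sum => k.
have -> : (fun x => (x \in G k)%:R) = \1_(G k) :> (X -> R).
  by apply/funext => x; rewrite indicE.
by apply: measurable_funTS; exact: measurable_indic.
Qed.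

Lemma sum_measure_le (c : nat) :
  (forall x, E x -> (\sum_(k < n) (x \in G k) <= c)%N) ->
  \sum_(k < n) fine (mu (E `&` G k)) <= c%:R * fine (mu E).
Proof.
move=> Ec; rewrite -lee_fin sum_fineE sum_measure_integral EFinM fineK //.
rewrite -integral_cst //; apply: ge0_le_integral => //.
- by move=> x _; rewrite lee_fin sumr_ge0.
- by move=> x /Ec; rewrite lee_fin -natr_sum ler_nat.
Qed.

Lemma sum_measure_ge (c : nat) :
  (forall x, E x -> (c <= \sum_(k < n) (x \in G k))%N) ->
  c%:R * fine (mu E) <= \sum_(k < n) fine (mu (E `&` G k)).
Proof.
move=> Ec; rewrite -lee_fin sum_fineE sum_measure_integral EFinM fineK //.
rewrite -integral_cst //; apply: ge0_le_integral => //.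
- by move=> x _; rewrite lee_fin.
- by move=> x /Ec; rewrite lee_fin -natr_sum ler_nat.
Qed.

End measure_counting.

Section fine_measure.
Context (R : realType) (d : measure_display) (X : measurableType d)
  (mu : {measure set X -> \bar R}).
Implicit Types A B C : set X.

Lemma mu_sub_lty A B : measurable A -> measurable B -> A `<=` B ->
  (mu B < +oo)%E -> (mu A < +oo)%E.
Proof. by move=> mA mB AB; apply: le_lt_trans; exact: le_mu. Qed.

Lemma mu_setU_lty A B : measurable A -> measurable B ->
  (mu A < +oo)%E -> (mu B < +oo)%E -> (mu (A `|` B) < +oo)%E.
Proof.
by move=> mA mB fA fB; apply: le_lt_trans (measureU2 _ mA mB) _; exact: lte_add_pinfty.
Qed.

Lemma fine_mu_ge0 A : 0 <= fine (mu A).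
Proof. exact: fine_ge0. Qed.

Lemma fine_le_mu A B : measurable A -> measurable B -> A `<=` B ->
  (mu B < +oo)%E -> fine (mu A) <= fine (mu B).
Proof.
move=> mA mB AB fB; have fA := mu_sub_lty mA mB AB fB.
by apply: fine_le; rewrite ?ge0_fin_numE //; exact: le_mu.
Qed.

Lemma fine_mu_cover A B C : measurable A -> measurable B -> measurable C ->
  A `<=` B `|` C -> (mu B < +oo)%E -> (mu C < +oo)%E ->
  fine (mu A) <= fine (mu B) + fine (mu C).
Proof.
move=> mA mB mC ABC fB fC; have fU := mu_setU_lty mB mC fB fC.
have mU := measurableU _ _ mB mC.
apply: le_trans (fine_le_mu mA mU ABC fU) _.
rewrite -fineD ?ge0_fin_numE //; apply: fine_le; last exact: measureU2.
  by rewrite ge0_fin_numE.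
by rewrite fin_numD !ge0_fin_numE // fB fC.
Qed.

Lemma fine_mu_split A B : measurable A -> measurable B -> (mu A < +oo)%E ->
  fine (mu A) = fine (mu (A `\` B)) + fine (mu (A `&` B)).
Proof.
move=> mA mB fA; rewrite (measureDI mu mA mB) fineD //.
  by rewrite ge0_fin_numE //; apply: mu_sub_lty fA => //; exact: measurableD.
by rewrite ge0_fin_numE //; apply: mu_sub_lty fA => //; exact: measurableI.
Qed.

End fine_measure.

(** * Visits to unions of levels *)

Section orbits.
Context (R : realType) (d : measure_display) (X : measurableType d)
  (mu : {measure set X -> \bar R}) (T : X -> X) (L K : nat -> nat)
  (inX : nat -> pred X) (ht : nat -> X -> nat).
Hypotheses (L0 : forall N, (0 < L N)%N) (K4 : forall N, (4 <= K N)%N).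
Hypothesis col : columns mu T L K inX ht.
Local Notation height := (height L K).
Local Notation copies := (copies L K).
Local Notation inner := (inner L K).
Local Notation inners := (inners L K).

Let h0 N : (0 < height N)%N. Proof. exact: height_gt0. Qed.

Definition level_union (N : nat) (P : pred nat) : set X :=
  [set x | inX N x && P (ht N x)].

Lemma inX_inner m M x : (m <= M)%N -> inX m x = inX M x && inner m M (ht M x).
Proof.
move=> /subnKC <-; elim: (M - m)%N => [|k IH].
  by rewrite addn0 inner_refl andbT.
rewrite addnS IH (col_sub col (m + k)) innerS ?leq_addr //.
have [i'|] := boolP (inX (m + k).+1 x) => //=.
have [s|] := boolP (slot _ _ _); last first.
  by move=> s; rewrite digit_small ?(negbTE s) ?andbF //; exact: (col_lt col).
have i : inX (m + k) x by rewrite (col_sub col) i' s.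
by rewrite /= (col_mod col i) inner_mod // digit_small ?s ?andbT //; exact: (col_lt col).
Qed.

Lemma inX_le N M x : (N <= M)%N -> inX N x -> inX M x.
Proof. by move=> NM; rewrite (inX_inner _ NM) => /andP[]. Qed.

Lemma ht_mod N M x : (N <= M)%N -> inX N x -> ht N x = (ht M x %% height N)%N.
Proof.
move=> /subnKC <- i; elim: (M - N)%N => [|k IH].
  by rewrite addn0 modn_small //; exact: (col_lt col).
have i' : inX (N + k) x by apply: inX_le i; exact: leq_addr.
by rewrite addnS IH (col_mod col i') modn_dvdm // height_dvd // leq_addr.
Qed.

Lemma ht_iter M x k : inX M x -> (ht M x + k < height M)%N ->
  inX M (iter k T x) /\ ht M (iter k T x) = (ht M x + k)%N.
Proof.
move=> i; elim: k => [|k IH]; first by rewrite addn0.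
rewrite addnS => lt; have [i' hk] := IH (ltnW lt).
have lt' : ((ht M (iter k T x)).+1 < height M)%N by rewrite hk.
by have [i'' hk'] := col_succ col i' lt'; rewrite /= hk' hk.
Qed.

Lemma ht_iter_pred M x k : inX M x -> (k <= ht M x)%N ->
  exists y, [/\ iter k T y = x, inX M y & ht M y = (ht M x - k)%N].
Proof.
move=> i; elim: k => [|k IH] lt; first by exists x; rewrite subn0.
have [y [yx iy hy]] := IH (ltnW lt).
have h_gt0 : (0 < ht M y)%N by rewrite hy subn_gt0.
have [z [zy iz hz]] := col_pred col iy h_gt0.
exists z; split => //; first by rewrite iterSr zy.
by apply: succn_inj; rewrite hz hy subnSK.
Qed.

Lemma slot_room N v : (v < height N.+1)%N -> slot (L N) (K N) (v %/ height N)%N ->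
  (spread (L N) (K N) * height N <= v < 4 * spread (L N) (K N) * height N)%N.
Proof.
move=> vN /(slot_bounds (L0 N) (K4 N)).
by rewrite leq_divRL // ltn_divLR.
Qed.

(** The empty places at the ends of column [M.+1] leave room for [height M >= n] heights on both
    sides of any copy of column [M]. Visits of any point, during any time, can thus be counted
    inside one column. *)
Lemma deep_window x n N0 : exists M, [/\ (N0 <= M)%N, inX M x, (n <= ht M x)%N &
  (ht M x + n <= height M)%N].
Proof.
have [N i] := col_cover col x.
pose M := (maxn N (maxn n N0)).
have iM : inX M x by apply: inX_le i; exact: leq_maxl.
have nh : (n <= height M)%N.
  apply: ltnW; apply: leq_ltn_trans (height_ge L0 K4 M).
  by apply: leq_trans (leq_maxr _ _); exact: leq_maxl.
have i' : inX M.+1 x by apply: inX_le iM.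
exists M.+1; split => //.
  by apply: leqW; apply: leq_trans (leq_maxr _ _); exact: leq_maxr.
all: have lt := col_lt col i'; move: iM; rewrite (col_sub col) => /andP[_ /(slot_room lt)].
all: have sp := spread_ge (L0 M) (K4 M); have l0 := L0 M.
  move=> /andP[+ _]; apply: leq_trans; apply: leq_trans nh _; apply: leq_pmull; lia.
move=> /andP[_ h2]; rewrite /= /width -ltnS.
apply: (@leq_trans (4 * spread (L M) (K M) * height M + height M)%N); first lia.
by rewrite -mulSnr; apply: leqW; rewrite leq_mul2r; apply/orP; right; lia.
Qed.

(* The orbit meets [A] at time [k] if [b], at time [- k] otherwise. *)
Definition hits (b : bool) (A : set X) (k : nat) : set X :=
  if b then iter k T @^-1` A else iter k T @` A.

Lemma hits_sub b A B k : A `<=` B -> hits b A k `<=` hits b B k.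
Proof. by case: b => AB x /=; [exact: AB|case=> y /AB By <-; exists y]. Qed.

Lemma bij_iter k : bijective (iter k T).
Proof.
elim: k => [|k IH]; first by exists id.
by have [bT _ _ _] := col_invertible col; exact: bij_comp bT IH.
Qed.

(** Times become heights. The backward window contains time 0, so it ends at height [ht M x]
    included and starts at [(ht M x).+1 - n]. *)
Lemma hits_window b M x n N P : inX M x -> (N <= M)%N -> (n <= (ht M x).+1)%N ->
  (ht M x + n <= height M)%N ->
  (\sum_(k < n) (x \in hits b (level_union N P) k) =
  \sum_((if b then ht M x else (ht M x).+1 - n) <= v <
      (if b then ht M x else (ht M x).+1 - n) + n)
    (inner N M v && P (v %% height N)))%N.
Proof.
move=> i NM n1 n2.
have lev y : inX M y -> (y \in level_union N P) = inner N M (ht M y) && P (ht M y %% height N)%N.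
  move=> iy; apply/idP/idP.
    rewrite inE /level_union /= => /andP[iN]; rewrite -ht_mod // => ->.
    by move: iN; rewrite (inX_inner _ NM) => /andP[_ ->].
  move=> /andP[iN]; have iN' : inX N y by rewrite (inX_inner _ NM) iy iN.
  by rewrite -ht_mod // => Py; rewrite inE /level_union /= iN' Py.
case: b; rewrite /hits.
  rewrite -{1}[ht M x]add0n [X in (\sum_(_ <= _ < X) _)%N]addnC big_addn addnK big_mkord.
  apply: eq_bigr => k _.
  have kn : (ht M x + k < height M)%N by apply: leq_trans n2; rewrite ltn_add2l.
  have [ik hk] := ht_iter i kn.
  by rewrite addnC -hk -lev // !inE.
rewrite subnK // -{1}[((ht M x).+1 - n)%N]add0n -{2}(subnK n1).
rewrite [X in (\sum_(_ <= _ < X) _)%N]addnC big_addn addnK big_mkord.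
rewrite (reindex_inj rev_ord_inj); apply: eq_bigr => k _ /=.
have le : (n - k.+1 <= ht M x)%N by have := ltn_ord k; lia.
have [y [yx iy hy]] := ht_iter_pred i le.
have -> : (k + ((ht M x).+1 - n) = ht M y)%N by rewrite hy; have := ltn_ord k; lia.
rewrite -lev //; congr nat_of_bool; apply/idP/idP; rewrite !inE; last by move=> ?; exists y.
by case=> z lz; rewrite -yx => /(bij_inj (bij_iter _)) <-.
Qed.

End orbits.

(** * Visits and measures within one stage of the construction *)

Section stage.
Context (R : realType) (d : measure_display) (X : measurableType d)
  (mu : {measure set X -> \bar R}) (T : X -> X) (L K : nat -> nat)
  (inX : nat -> pred X) (ht : nat -> X -> nat).
Hypotheses (L0 : forall N, (0 < L N)%N) (K4 : forall N, (4 <= K N)%N).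
Hypothesis col : columns mu T L K inX ht.
Local Notation height := (height L K).
Local Notation copies := (copies L K).
Local Notation inner := (inner L K).
Local Notation inners := (inners L K).
Local Notation level_union := (level_union inX ht).
Local Notation hits := (hits T).
Local Notation sp N := (spread (L N) (K N)).

Let h0 N : (0 < height N)%N. Proof. exact: height_gt0. Qed.
Let q0 N : 0 < (copies N)%:R :> R. Proof. by rewrite ltr0n copies_gt0. Qed.

Lemma level_union_mu N P : measurable (level_union N P) /\
  mu (level_union N P) = ((\sum_(0 <= v < height N) P v)%:R / (copies N)%:R)%:E.
Proof.
pose A v := if (v < height N)%N && P v then [set x | inX N x && (ht N x == v)] else set0.
have mA v : measurable (A v).
  by rewrite /A; case: ifP => // /andP[vN _]; have [] := col_level col vN.
have UA : level_union N P = \big[setU/set0]_(v < height N) A v.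
  rewrite -bigcup_mkord; apply/seteqP; split=> x.
    move=> /andP[i Px]; exists (ht N x); first exact: (col_lt col).
    by rewrite /A (col_lt col) // Px /= i eqxx.
  case=> v /= vN; rewrite /A vN /=; case: ifP => // Pv /andP[i /eqP hv].
  by rewrite /level_union /= i hv.
split; first by rewrite UA; exact: bigsetU_measurable.
rewrite UA measure_bigsetU //.
  rewrite natr_sum mulr_suml -sumEFin big_mkord; apply: eq_bigr => v _; rewrite /A ltn_ord /=.
  case: ifP => Pv; last by rewrite measure0 mul0r.
  by rewrite mul1r; have [_ ->] := col_level col (ltn_ord v).
apply/trivIsetP => v w _ _ vw; apply/seteqP; split => // x; rewrite /A => -[].
case: ifP => // _ /andP[_ /eqP hv]; case: ifP => // _ /andP[_ /eqP hw].
by move: vw; rewrite -hv -hw eqxx.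
Qed.

Lemma level_unionE N M P : (N <= M)%N ->
  level_union N P = level_union M (fun v => inner N M v && P (v %% height N)%N).
Proof.
move=> NM; apply/seteqP; split => x; rewrite /level_union /= andbA -(inX_inner col _ NM) => /andP[i];
  by rewrite i (ht_mod col NM i).
Qed.

Lemma level_union_fin N P : (mu (level_union N P) < +oo)%E.
Proof. by have [_ ->] := level_union_mu N P; rewrite ltry. Qed.

Lemma level_union_inners m N : (m <= N)%N ->
  level_union m predT = level_union N (inner m N).
Proof.
by move=> mN; rewrite (level_unionE _ mN); congr level_union; apply/funext => v; rewrite andbT.
Qed.

Lemma inners_mu m N : (m <= N)%N ->
  (inners m N)%:R = fine (mu (level_union m predT)) * (copies N)%:R :> R.
Proof.
move=> mN; rewrite (level_union_inners mN); have [_ ->] := level_union_mu N (inner m N).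
by rewrite /= divfK // gt_eqF.
Qed.

Lemma base_mu : mu (level_union 0 predT) = 1%E.
Proof. by have [_ ->] := level_union_mu 0 predT; rewrite /= big_nat1 divr1. Qed.

Lemma inners0 N : inners 0 N = copies N.
Proof.
by apply/eqP; rewrite -(eqr_nat R) inners_mu // base_mu mul1r.
Qed.

(** A bound valid at every point of the space, whatever its place in column [N]: it combines
    [deep_window] with the periodic bound [inner_count_le]. *)
Lemma hits_le b x m N n c : (m <= N)%N -> (n <= c * height N)%N ->
  (\sum_(k < n) (x \in hits b (level_union m predT) k) <= c * inners m N)%N.
Proof.
move=> mN nc; have [M [NM i h1 h2]] := deep_window L0 K4 col x n N.
rewrite (hits_window col b predT i (leq_trans mN NM) (leqW h1) h2).
apply: leq_trans (inner_count_le _ mN NM nc).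
by apply: leq_sum_nat => v _; rewrite andbT; case: inner.
Qed.

Lemma stage_window b x N n P : inX N.+1 x -> (n <= (ht N.+1 x).+1)%N ->
  (ht N.+1 x + n <= height N.+1)%N ->
  (\sum_(k < n) (x \in hits b (level_union N P) k) =
   \sum_((if b then ht N.+1 x else (ht N.+1 x).+1 - n) <= v <
       (if b then ht N.+1 x else (ht N.+1 x).+1 - n) + n)
     (P (v %% height N) && slot (L N) (K N) (v %/ height N)))%N.
Proof.
move=> i h1 h2; set a := (if b then _ else _).
rewrite (hits_window col b P i (leqnSn N) h1 h2) -/a; apply: eq_big_nat => v /andP[_ va].
rewrite innerS // inner_refl /= digit_small 1?andbC //.
by move: va (col_lt col i) h1 h2; rewrite /a; case: b {a}; lia.
Qed.

Let Pper N (P : pred nat) v : P ((v + height N) %% height N)%N = P (v %% height N)%N.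
Proof. by rewrite modnDr. Qed.

Let Psum N (P : pred nat) : (\sum_(0 <= v < height N) P (v %% height N) = \sum_(0 <= v < height N) P v)%N.
Proof. by apply: eq_big_nat => v /andP[_ vh]; rewrite modn_small. Qed.

Lemma stage_room x N : inX N x -> inX N.+1 x /\
  (sp N * height N <= ht N.+1 x < 4 * sp N * height N)%N.
Proof.
move=> i; have := i; rewrite (col_sub col) => /andP[i' s]; split => //.
by apply: slot_room => //; exact: (col_lt col).
Qed.

(** A copy past the adjacent ones has its place beyond [3 * spread], so that even a backward window
    of [spread] places does not reach the run. *)
Lemma sparse_hits_le b x n c N P : inX N x ->
  ((sp N + 2 * L N) * height N <= ht N.+1 x)%N ->
  (n <= sp N * height N)%N -> (n <= c * (L N * height N))%N ->
  (\sum_(k < n) (x \in hits b (level_union N P) k) <= c * \sum_(0 <= v < height N) P v)%N.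
Proof.
move=> i hx n1 nc; have [i' /andP[r1 r2]] := stage_room i.
have := i; rewrite (col_sub col) => /andP[_ s].
have hx' : (3 * sp N * height N <= ht N.+1 x)%N.
  have : (sp N + 2 * L N <= ht N.+1 x %/ height N)%N by rewrite leq_divRL.
  by rewrite -leq_divRL //; move: s; rewrite /slot; lia.
have sg := spread_ge (L0 N) (K4 N).
have [eh hh] : height N.+1 = (5 * (sp N * height N))%N /\ (4 * L N * height N <= sp N * height N)%N.
  by split; [rewrite /= /width mulnA|rewrite leq_mul2r sg orbT].
have w1 : (n <= (ht N.+1 x).+1)%N by lia.
have w2 : (ht N.+1 x + n <= height N.+1)%N by lia.
rewrite (stage_window b P i' w1 w2).
rewrite -Psum; apply: (sparse_count_le (P := fun v => P (v %% height N)%N) (L0 N) (K4 N)) => //.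
by rewrite mulnDl; case: b; lia.
Qed.

Lemma dense_hits_le b x n N P : inX N x ->
  (ht N.+1 x < (sp N + 2 * L N) * height N)%N -> (n <= sp N * height N)%N ->
  (\sum_(k < n) (x \in hits b (level_union N P) k) <= 2 * L N * \sum_(0 <= v < height N) P v)%N.
Proof.
move=> i hx n1; have [i' /andP[r1 r2]] := stage_room i.
have sg := spread_ge (L0 N) (K4 N).
have [eh hh] : height N.+1 = (5 * (sp N * height N))%N /\ (4 * L N * height N <= sp N * height N)%N.
  by split; [rewrite /= /width mulnA|rewrite leq_mul2r sg orbT].
have w1 : (n <= (ht N.+1 x).+1)%N by lia.
have w2 : (ht N.+1 x + n <= height N.+1)%N by lia.
rewrite (stage_window b P i' w1 w2).
rewrite -Psum; apply: (dense_count_le (P := fun v => P (v %% height N)%N) (L0 N) (K4 N)) => //.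
by move: hx; rewrite mulnDl; case: b; lia.
Qed.

Lemma sparse_hits x t N P : inX N x -> (3 * sp N * height N <= ht N.+1 x)%N ->
  (ht N.+1 x + t * (L N * height N) <=
    (3 * sp N + (cuts (L N) (K N) - 2 * L N) * L N) * height N)%N ->
  (\sum_(k < t * (L N * height N)) (x \in hits true (level_union N P) k) =
     t * \sum_(0 <= v < height N) P v)%N.
Proof.
move=> i h1 h2; have [i' /andP[r1 r2]] := stage_room i.
have sg : ((cuts (L N) (K N) - 2 * L N) * L N * height N <= sp N * height N)%N.
  by rewrite leq_mul2r /spread leq_mul2r leq_subr !orbT.
have eh : height N.+1 = (5 * (sp N * height N))%N by rewrite /= /width mulnA.
have w1 : (t * (L N * height N) <= (ht N.+1 x).+1)%N by lia.
have w2 : (ht N.+1 x + t * (L N * height N) <= height N.+1)%N by lia.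
rewrite (stage_window true P i' w1 w2).
rewrite -Psum; apply: (sparse_count (P := fun v => P (v %% height N)%N) (L0 N) (K4 N)) => //.
Qed.

Lemma dense_hits x c N P : inX N x -> (sp N * height N <= ht N.+1 x)%N ->
  (ht N.+1 x + c * height N <= (sp N + 2 * L N) * height N)%N ->
  (\sum_(k < c * height N) (x \in hits true (level_union N P) k) =
     c * \sum_(0 <= v < height N) P v)%N.
Proof.
move=> i h1 h2; have [i' /andP[r1 r2]] := stage_room i.
have sg := spread_ge (L0 N) (K4 N).
have [eh hh] : height N.+1 = (5 * (sp N * height N))%N /\ (4 * L N * height N <= sp N * height N)%N.
  by split; [rewrite /= /width mulnA|rewrite leq_mul2r sg orbT].
rewrite mulnDl in h2.
have w1 : (c * height N <= (ht N.+1 x).+1)%N by lia.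
have w2 : (ht N.+1 x + c * height N <= height N.+1)%N by lia.
rewrite (stage_window true P i' w1 w2).
rewrite -Psum; apply: (dense_count (P := fun v => P (v %% height N)%N) (L0 N) (K4 N)) => //.
by rewrite mulnDl.
Qed.

(** [P] chooses levels of column [N], the bounds choose copies of it by their height in column
    [N.+1]. Sets of points with a known number of visits have this form. *)
Definition slice (N : nat) (P : pred nat) (a b : nat) : set X :=
  [set x | [&& inX N x, P (ht N x) & (a <= ht N.+1 x < b)%N]].

Lemma slice_mu N P a b : (b <= height N.+1)%N -> measurable (slice N P a b) /\
  mu (slice N P a b) = ((\sum_(a <= v < b)
    (P (v %% height N) && slot (L N) (K N) (v %/ height N)))%:R / (copies N.+1)%:R)%:E.
Proof.
move=> bh.
pose Q v := [&& P (v %% height N)%N, slot (L N) (K N) (v %/ height N) & (a <= v < b)%N].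
have -> : slice N P a b = level_union N.+1 Q.
  apply/seteqP; split => x; rewrite /slice /level_union /= /Q.
    move=> /and3P[i Px ab]; rewrite -(col_mod col i) Px ab andbT.
    by have := i; rewrite (col_sub col) => /andP[-> ->].
  move=> /andP[i' /and3P[Px s ab]]; have i : inX N x by rewrite (col_sub col) i' s.
  by rewrite i (col_mod col i) Px.
have [mQ ->] := level_union_mu N.+1 Q; split => //; congr ((_%:R / _)%:E).
have [ab|ba] := leqP a b; last first.
  rewrite (big_geq (ltnW ba)); apply: big1 => v _; rewrite /Q.
  have [/andP[av vb]|nab] := boolP (a <= v < b)%N; last by rewrite !andbF.
  by move: ba; rewrite ltnNge (leq_trans av (ltnW vb)).
rewrite (big_cat_nat (n := a)) //=; last exact: leq_trans ab bh.
rewrite (big_cat_nat (n := b) (m := a)) //=.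
rewrite big_nat big1 ?add0n; last by move=> v /andP[_ va]; rewrite /Q leqNgt va /= !andbF.
rewrite [X in (_ + X)%N]big_nat [X in (_ + X)%N]big1 ?addn0; last first.
  by move=> v /andP[vb _]; rewrite /Q [(v < b)%N]ltnNge vb /= !andbF.
by apply: eq_big_nat => v vab; rewrite /Q vab andbT.
Qed.

Lemma slice_fin N P a b : (b <= height N.+1)%N -> (mu (slice N P a b) < +oo)%E.
Proof. by move=> bh; have [_ ->] := slice_mu P a bh; rewrite ltry. Qed.

Lemma dense_slice_mu N P c : (c <= 2 * L N)%N ->
  fine (mu (slice N P (sp N * height N) ((sp N + c) * height N))) =
  fine (mu (level_union N P)) * c%:R / (cuts (L N) (K N))%:R.
Proof.
move=> cL; have sg := spread_ge (L0 N) (K4 N).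
have bh : ((sp N + c) * height N <= height N.+1)%N.
  by rewrite /= /width leq_mul2r; apply/orP; right; lia.
have [_ ->] := slice_mu P (sp N * height N) bh; have [_ ->] := level_union_mu N P.
rewrite mulnDl (dense_count (P := fun v => P (v %% height N)%N) (L0 N) (K4 N)) //; last first.
  by rewrite mulnDl leq_add2l leq_mul2r cL orbT.
rewrite Psum /= !natrM invfM; ring.
Qed.

Lemma sparse_slice_mu N P t : (2 * t <= cuts (L N) (K N))%N ->
  fine (mu (slice N P (3 * sp N * height N) ((3 * sp N + t * L N) * height N))) =
  fine (mu (level_union N P)) * t%:R / (cuts (L N) (K N))%:R.
Proof.
move=> tr; have cg := cuts_ge (L N) (K4 N).
have tL : (t * L N <= (cuts (L N) (K N) - 2 * L N) * L N)%N.
  by rewrite leq_mul2r; apply/orP; right; lia.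
have tL2 : (t * L N <= sp N)%N by apply: leq_trans tL _; rewrite /spread leq_mul2r leq_subr orbT.
have bh : ((3 * sp N + t * L N) * height N <= height N.+1)%N.
  by rewrite /= /width leq_mul2r; apply/orP; right; lia.
have [_ ->] := slice_mu P (3 * sp N * height N) bh; have [_ ->] := level_union_mu N P.
rewrite mulnDl -[(t * L N * height N)%N]mulnA.
rewrite (sparse_count (P := fun v => P (v %% height N)%N) (L0 N) (K4 N)) //; last first.
  by rewrite mulnDl leq_add2l mulnA leq_mul2r tL orbT.
rewrite Psum /= !natrM invfM; ring.
Qed.

End stage.

(** * Conservativity and ergodicity *)

Section recurrence.
Context (R : realType) (d : measure_display) (X : measurableType d)
  (mu : {measure set X -> \bar R}) (T : X -> X) (L K : nat -> nat)
  (inX : nat -> pred X) (ht : nat -> X -> nat).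
Hypotheses (L0 : forall N, (0 < L N)%N) (K4 : forall N, (4 <= K N)%N).
Hypothesis col : columns mu T L K inX ht.
Local Notation height := (height L K).
Local Notation copies := (copies L K).
Local Notation level_union := (level_union inX ht).

Lemma preimage_iter k (A : set X) : measurable A ->
  measurable (iter k T @^-1` A) /\ mu (iter k T @^-1` A) = mu A.
Proof.
have [_ mT _ eT] := col_invertible col.
elim: k A => [|k IH] A mA //.
have -> : iter k.+1 T @^-1` A = iter k T @^-1` (T @^-1` A) by [].
have mTA : measurable (T @^-1` A) by rewrite -[X in measurable X]setTI; exact: mT.
by have [? ->] := IH _ mTA; rewrite eT.
Qed.

Lemma preimage_image k (A : set X) : iter k T @^-1` (iter k T @` A) = A.
Proof.
apply/seteqP; split=> [x [y Ay]|x Ax]; last by exists x.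
by move=> /(bij_inj (bij_iter col k)) <-.
Qed.

Lemma image_iter k (A : set X) : measurable A ->
  measurable (iter k T @` A) /\ mu (iter k T @` A) = mu A.
Proof.
move=> mA; have mI : measurable (iter k T @` A).
  elim: k => [|k IH]; first by rewrite image_id.
  have [_ _ mT _] := col_invertible col.
  have -> : iter k.+1 T @` A = T @` (iter k T @` A) by rewrite image_comp.
  exact: mT.
split => //; rewrite -{2}(preimage_image k A).
by have [_ ->] := preimage_iter k mI.
Qed.

Lemma measurable_hits b k (A : set X) : measurable A -> measurable (hits T b A k).
Proof. by case: b => mA; [have [] := preimage_iter k mA|have [] := image_iter k mA]. Qed.

Lemma mu_hits b k (A : set X) : measurable A -> mu (hits T b A k) = mu A.
Proof. by case: b => mA; [have [] := preimage_iter k mA|have [] := image_iter k mA]. Qed.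

Lemma hits_swap b k (A B : set X) : measurable A -> measurable B ->
  mu (A `&` hits T b B k) = mu (B `&` hits T (~~ b) A k).
Proof.
move=> mA mB; rewrite -(mu_hits (~~ b) k (measurableI _ _ mA (measurable_hits b k mB))).
congr (mu _); case: b => /=.
  apply/seteqP; split=> [_ [x [Ax Bx] <-]|y [By [x Ax xy]]]; first by split => //; exists x.
  by exists x => //; split => //; rewrite /preimage /= xy.
have -> : iter k T @^-1` (A `&` iter k T @` B) = (iter k T @^-1` A) `&` (iter k T @^-1` (iter k T @` B)) by [].
by rewrite preimage_image setIC.
Qed.

Lemma image_level N k : (k < height N)%N ->
  iter k T @` level_union N (pred1 0%N) = level_union N (pred1 k).
Proof.
move=> kN; apply/seteqP; split=> [_ [x /andP[i /eqP hx] <-]|x /andP[i /eqP hx]].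
  have lt : (ht N x + k < height N)%N by rewrite hx.
  by have [i' h'] := ht_iter col i lt; rewrite /level_union /= i' h' hx /=.
have le : (k <= ht N x)%N by rewrite hx.
have [y [yx iy hy]] := ht_iter_pred col i le.
by exists y => //; rewrite /level_union /= iy hy hx subnn.
Qed.

Lemma level_union_sum N P (A : set X) : measurable A ->
  fine (mu (A `&` level_union N P)) =
  \sum_(0 <= v < height N | P v) fine (mu (A `&` level_union N (pred1 v))).
Proof.
move=> mA; have mU Q := (level_union_mu col N Q).1.
have fU Q : mu (A `&` level_union N Q) \is a fin_num.
  rewrite ge0_fin_numE //; apply: mu_sub_lty (level_union_fin col N Q) => //.
  by apply: measurableI.
pose F v := if P v then A `&` level_union N (pred1 v) else set0.
have -> : A `&` level_union N P = \big[setU/set0]_(v < height N) F v.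
  rewrite -bigcup_mkord; apply/seteqP; split=> [x [Ax /andP[i Px]]|x [v /= vN]].
    exists (ht N x); first exact: (col_lt col).
    by rewrite /F Px; split => //; rewrite /level_union /= i /=.
  rewrite /F; case: ifP => // Pv [Ax /andP[i /eqP hx]].
  by split => //; rewrite /level_union /= i hx.
rewrite measure_bigsetU; last 2 first.
- by move=> v; rewrite /F; case: ifP => // _; exact: measurableI.
- apply/trivIsetP => v w _ _ vw; apply/seteqP; split => // x; rewrite /F => -[].
  case: ifP => // _ [_ /andP[_ /eqP hv]]; case: ifP => // _ [_ /andP[_ /eqP hw]].
  by move: vw; rewrite -hv -hw eqxx.
have fF v : mu (F v) \is a fin_num by rewrite /F; case: ifP => // _; rewrite measure0.
rewrite [in RHS]big_mkcond big_mkord -[RHS]/(fine (_%:E)) -sumEFin; congr fine.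
apply: eq_bigr => v _; apply: (etrans (esym (fineK (fF v)))); congr (_%:E).
by rewrite /F; case: (P v); rewrite ?measure0.
Qed.

Lemma null_in_columns (A : set X) : measurable A ->
  (forall m, fine (mu (A `&` level_union m predT)) = 0) -> mu A = 0%E.
Proof.
move=> mA A0; have mU m := (level_union_mu col m predT).1.
have -> : A = \bigcup_m (A `&` level_union m predT).
  rewrite -setI_bigcupr; apply/esym/setIidPl => x _.
  by have [N i] := col_cover col x; exists N => //; rewrite /level_union /= i.
apply: measure_negligible; first by apply: bigcupT_measurable => m; exact: measurableI.
apply: negligible_bigcup => m; exists (A `&` level_union m predT); split => //.
  exact: measurableI.
have f : mu (A `&` level_union m predT) \is a fin_num.
  rewrite ge0_fin_numE //; apply: mu_sub_lty (level_union_fin col m predT) => //.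
  by apply: measurableI.
by rewrite -(fineK f) A0.
Qed.

(* Over each point of the base of a column a wandering set occurs at most once. *)
Lemma columns_conservative : conservative mu T.
Proof.
move=> W mW tW; apply: null_in_columns => // m.
have mU N P := (level_union_mu col N P).1; have fU N P := level_union_fin col N P.
have bound N : (m <= N)%N -> fine (mu (W `&` level_union m predT)) <= (copies N)%:R^-1.
  move=> mN.
  apply: (@le_trans _ _ (fine (mu (W `&` level_union N predT)))).
    apply: fine_le_mu; [exact: measurableI|exact: measurableI| |].
      apply: setIS => x /andP[i _]; rewrite /level_union /= andbT.
      exact: inX_le col _ _ _ mN i.
    by apply: mu_sub_lty (fU N predT) => //; exact: measurableI.
  rewrite level_union_sum // big_mkord.
  have -> : (copies N)%:R^-1 = 1%:R * fine (mu (level_union N (pred1 0%N))).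
    by rewrite mul1r; have [_ ->] := col_level col (height_gt0 L0 K4 N).
  (* The traces of [W] on the levels are pulled back to the bottom level, where they are disjoint;
     their total measure is thus at most that of one level. *)
  rewrite (eq_bigr (fun k : 'I_(height N) => fine (mu (level_union N (pred1 0%N) `&` hits T true W k)))).
    apply: sum_measure_le => // [k|x _]; first exact: measurable_hits.
    have [/existsP[k xk]|] := boolP [exists k : 'I_(height N), x \in hits T true W k].
      rewrite (bigD1 k) //= big1 ?addn0 ?leq_b1 // => j jk.
      apply/eqP; rewrite eqb0; apply/negP => xj.
      move: xk xj; rewrite !inE => xk xj; move/eqP: jk; apply; apply: val_inj.
      by apply: (tW j k) => //; exists x.
    rewrite negb_exists => /forallP nx; rewrite big1 // => k _.
    by rewrite (negbTE (nx k)).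
  move=> k _; rewrite -(image_level (ltn_ord k)); congr fine.
  exact: (hits_swap false).
apply/eqP; rewrite eq_le fine_mu_ge0 andbT leNgt; apply/negP.
set e := fine _ => e0.
pose N := maxn m (Num.bound (e^-1)).
have := bound N (leq_maxl _ _); rewrite -/e leNgt => /negP; apply.
rewrite invf_plt ?posrE ?ltr0n ?copies_gt0 //.
apply: lt_trans (archi_boundP _) _; first by rewrite invr_ge0 ltW.
rewrite ltr_nat; apply: leq_ltn_trans (copies_ge L0 K4 N); exact: leq_maxr.
Qed.

(** All levels of a column are images of its bottom level, so [A] has the same mass in each of them.
    The common density is read on the base, a union of levels of every column, of measure 1. *)
Lemma invariant_density (A : set X) : measurable A -> T @^-1` A = A ->
  forall N P, fine (mu (A `&` level_union N P)) =
    fine (mu (A `&` level_union 0 predT)) * fine (mu (level_union N P)).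
Proof.
move=> mA TA N; pose e := fine (mu (A `&` level_union N (pred1 0%N))).
have Ak k : iter k T @^-1` A = A.
  by elim: k => // k IH; rewrite -[in RHS]IH -[in RHS]TA.
have lev k : (k < height N)%N -> fine (mu (A `&` level_union N (pred1 k))) = e.
  move=> kN; rewrite -(image_level kN); congr fine.
  rewrite (hits_swap false) //; last exact: (level_union_mu col N _).1.
  by rewrite /= Ak setIC.
have dens P : fine (mu (A `&` level_union N P)) = (\sum_(0 <= v < height N) P v)%:R * e.
  rewrite level_union_sum // big_mkcond natr_sum mulr_suml; apply: eq_big_nat => v /andP[_ vN].
  by case: (P v); rewrite ?mul1r ?mul0r ?lev.
move=> P; rewrite (level_union_inners col (leq0n N)) !dens -/(inners L K 0 N) (inners0 L0 K4 col).
have [_ ->] := level_union_mu col N P; rewrite /=.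
by rewrite [RHS]mulrC mulrA divfK 1?mulrC // pnatr_eq0 -lt0n copies_gt0.
Qed.

(** A non-null invariant set is nearly a union of levels somewhere, while its density on unions of
    levels is constant; this density must be 1. A set and its complement cannot both have density 1
    in the base. *)
Lemma columns_ergodic : ergodic mu T.
Proof.
have mU N P := (level_union_mu col N P).1; have fU N P := level_union_fin col N P.
have main (A : set X) : measurable A -> T @^-1` A = A -> mu A != 0%E ->
    1 <= fine (mu (A `&` level_union 0 predT)).
  move=> mA TA A0; set a := fine _.
  have [m m0] : exists m, 0 < fine (mu (A `&` level_union m predT)).
    apply: contrapT => /forallNP h; move/eqP: A0; apply; apply: null_in_columns => // m.
    by apply/eqP; rewrite eq_le fine_mu_ge0 andbT leNgt; apply/negP.
  set B := A `&` level_union m predT in m0.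
  have mB : measurable B by exact: measurableI.
  have fB : (mu B < +oo)%E by apply: mu_sub_lty (fU m predT) => //; exact: subIsetr.
  rewrite leNgt; apply/negP => a1.
  have a0 : 0 <= a by exact: fine_mu_ge0.
  (* The approximation yields [b - e <= a * (b + e)], hence [b * (1 - a) <= (1 + a) * e <= 2 * e],
     which this choice of [e] contradicts. *)
  pose b := fine (mu B); pose e := b * (1 - a) / 4.
  have e0 : 0 < e by rewrite divr_gt0 // mulr_gt0 // subr_gt0.
  have [N [P UP]] := col_dense col mB fB e0.
  set U := [set x | _] in UP.
  have mBU := measurableD mB (mU N P); have mUB := measurableD (mU N P) mB.
  have fY : (mu (B `+` U) < +oo)%E by apply: le_lt_trans UP _; rewrite ltry.
  have mY : measurable (B `+` U) by exact: measurableU.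
  have eY : fine (mu (B `+` U)) <= e.
    by rewrite -lee_fin fineK // ge0_fin_numE.
  have mAU : measurable (A `&` U) by apply: measurableI => //; exact: mU.
  have fAU : (mu (A `&` U) < +oo)%E.
    by apply: mu_sub_lty (fU N P) => //; exact: subIsetr.
  have BsubU : B `<=` (A `&` U) `|` (B `+` U).
    by move=> x Bx; have [Ux|nUx] := pselect (U x); [left; split => //; have [] := Bx|right; left].
  have UsubB : U `<=` B `|` (B `+` U).
    by move=> x Ux; have [Bx|nBx] := pselect (B x); [left|right; right].
  have h1 : b <= fine (mu (A `&` U)) + e.
    by apply: le_trans (fine_mu_cover mB mAU mY BsubU fAU fY) _; rewrite lerD2l.
  have h2 : fine (mu U) <= b + e.
    by apply: le_trans (fine_mu_cover (mU N P) mB mY UsubB fB fY) _; rewrite lerD2l.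
  have h3 : fine (mu (A `&` U)) = a * fine (mu U) by exact: invariant_density.
  have h4 : a * fine (mu U) <= a * (b + e) by rewrite ler_wpM2l.
  have h5 : a * e <= e by rewrite ler_piMl // ltW.
  have h6 : b * (1 - a) = 4 * e by rewrite /e; field.
  by rewrite h3 in h1; clear -h1 h4 h5 h6 e0; lra.
move=> A mA TA.
have [/eqP|A0] := boolP (mu A == 0%E); first by left.
have [/eqP|B0] := boolP (mu (~` A) == 0%E); first by right.
have a1 := main A mA TA A0.
have TB : T @^-1` (~` A) = ~` A by rewrite -[in RHS]TA.
have b1 := main (~` A) (measurableC mA) TB B0.
have one : fine (mu (level_union 0 predT)) = 1 :> R by rewrite (base_mu col).
have := fine_mu_split (mU 0%N predT) mA (fU 0%N predT).
rewrite one setDE setIC [X in _ + fine (mu X)]setIC => e.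
have : 1 + 1 <= fine (mu (~` A `&` level_union 0 predT)) + fine (mu (A `&` level_union 0 predT)).
  exact: lerD.
by rewrite -e -subr_ge0 opprD addrA subrr add0r oppr_ge0 ler10.
Qed.

End recurrence.

(** * Weak rational ergodicity *)

Section growth.
Context (R : realType) (d : measure_display) (X : measurableType d)
  (mu : {measure set X -> \bar R}) (T : X -> X) (L K : nat -> nat)
  (inX : nat -> pred X) (ht : nat -> X -> nat).
Hypotheses (L0 : forall N, (0 < L N)%N) (K4 : forall N, (4 <= K N)%N).
Hypothesis col : columns mu T L K inX ht.
Local Notation height := (height L K).
Local Notation copies := (copies L K).
Local Notation inner := (inner L K).
Local Notation inners := (inners L K).
Local Notation level_union := (level_union inX ht).
Local Notation slice := (slice inX ht).
Local Notation hits := (hits T).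
Local Notation sp N := (spread (L N) (K N)).
Local Notation r N := (cuts (L N) (K N)).
Local Notation F := (level_union 0 predT).

Let mF : measurable F. Proof. exact: (level_union_mu col 0 predT).1. Qed.
Let fF : (mu F < +oo)%E. Proof. exact: (level_union_fin col). Qed.
Let h0 N : (0 < height N)%N. Proof. exact: height_gt0. Qed.

(** The integral over [E] of the number of visits to the base. Since the base has measure 1,
    [corr false F] is its return rate. Both directions of time occur because an error on the target
    of a correlation becomes, by [hits_swap], an error on the starting set for the reversed time. *)
Definition corr (b : bool) (E : set X) (n : nat) : R :=
  \sum_(k < n) fine (mu (E `&` hits b F k)).
Local Notation a := (corr false F).

Let mH b k : measurable (hits b F k). Proof. exact: (measurable_hits col). Qed.
Let finI E A : measurable E -> measurable A -> E `<=` F -> (mu (E `&` A) < +oo)%E.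
Proof.
move=> mE mA EF; apply: mu_sub_lty fF => //; first exact: measurableI.
by move=> x [/EF].
Qed.

Lemma corr_bool b n : corr b F n = a n.
Proof.
case: b => //; apply: eq_bigr => k _; congr fine.
by rewrite (hits_swap col true).
Qed.

Lemma corr_ge0 b E n : 0 <= corr b E n.
Proof. by apply: sumr_ge0 => k _; exact: fine_mu_ge0. Qed.

Lemma corr_le_time b E m n : (m <= n)%N -> corr b E m <= corr b E n.
Proof.
move=> mn; rewrite /corr -!(big_mkord xpredT (fun k => fine (mu (E `&` hits b F k)))).
rewrite [leRHS](big_cat_nat (n := m)) //= lerDl; apply: sumr_ge0 => k _.
exact: fine_mu_ge0.
Qed.

Lemma corr_le b E E' n : measurable E -> measurable E' -> E `<=` E' -> E' `<=` F ->
  corr b E n <= corr b E' n.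
Proof.
move=> mE mE' EE' E'F; apply: ler_sum => k _; apply: fine_le_mu.
- exact: measurableI.
- exact: measurableI.
- exact: setSI.
- exact: finI.
Qed.

Lemma corr_split b E D n : measurable E -> measurable D -> E `<=` F ->
  corr b E n = corr b (E `\` D) n + corr b (E `&` D) n.
Proof.
move=> mE mD EF; rewrite -big_split; apply: eq_bigr => k _ /=.
rewrite (fine_mu_split (measurableI _ _ mE (mH b k)) mD (finI mE (mH b k) EF)).
by rewrite !setDE -!setIA [hits b F k `&` ~` D]setIC [hits b F k `&` D]setIC.
Qed.

Let quarter N : (r N <= 8 * (r N %/ 4))%N.
Proof.
have := cuts_ge4 L0 K4 N; have := divn_eq (r N) 4; have := ltn_pmod (r N) (isT : 0 < 4)%N.
by move: (r N %/ 4)%N (r N %% 4)%N (r N) => u v w; lia.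
Qed.

Let r0 N : 0 < (r N)%:R :> R.
Proof. by rewrite ltr0n; have := cuts_ge4 L0 K4 N; lia. Qed.

Let q0 N : 0 < (copies N)%:R :> R. Proof. by rewrite ltr0n copies_gt0. Qed.

Let F_stage N : F = level_union N (inner 0 N).
Proof. exact: (level_union_inners col). Qed.

Let F_count N : (\sum_(0 <= v < height N) inner 0 N v = copies N)%N.
Proof. exact: (inners0 L0 K4 col). Qed.

(** The points of the base in the first [u = r N %/ 4] sparse copies have measure
    [u / r N >= 1 / 8]. At least half of the copies are sparse, so these points stay among them for
    [t] periods and make [t * copies N] visits. *)
Lemma growth N t n : (t <= r N %/ 4)%N -> (t * (L N * height N) <= n)%N ->
  (copies N * t)%:R / 8 <= a n.
Proof.
move=> tr tn; pose u := (r N %/ 4)%N.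
have ur : (u * 4 <= r N)%N by exact: leq_trunc_div.
have u2 : (2 * u <= r N)%N by lia.
pose b := ((3 * sp N + u * L N) * height N)%N.
have cg := cuts_ge (L N) (K4 N).
have uL : (2 * (u * L N) <= (r N - 2 * L N) * L N)%N.
  by rewrite mulnA leq_mul2r; apply/orP; right; lia.
have uL2 : (u * L N <= sp N)%N by rewrite /spread leq_mul2r; apply/orP; right; lia.
have bh : (b <= height N.+1)%N.
  by rewrite /b /= /width leq_mul2r; apply/orP; right; lia.
pose E := slice N (inner 0 N) (3 * sp N * height N) b.
have [mE _] := slice_mu col (inner 0 N) (3 * sp N * height N) bh.
have EF : E `<=` F.
  by move=> x /and3P[i Px _]; rewrite (F_stage N) /level_union /= i Px.
rewrite -(corr_bool true); apply: le_trans (corr_le_time true F tn).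
apply: le_trans (corr_le true _ mE mF EF (@subset_refl _ F)).
apply: le_trans (sum_measure_ge (c := (t * copies N)%N) mE (slice_fin col _ _ bh) (mH true) _).
  rewrite (sparse_slice_mu L0 K4 col (inner 0 N) u2) -F_stage (base_mu col) mul1r.
  rewrite mulnC ler_wpM2l // ler_pdivlMr // mulrC ler_pdivrMr // -natrM ler_nat mulnC.
  exact: quarter.
move=> x /and3P[i Px /andP[x1 x2]].
rewrite (F_stage N) (sparse_hits L0 K4 col _ i x1) ?F_count //.
move: x2; rewrite /b !mulnDl => x2.
have tu : (t * L N * height N <= u * L N * height N)%N by rewrite !leq_mul2r tr !orbT.
have uLh : (2 * (u * L N) * height N <= (r N - 2 * L N) * L N * height N)%N.
  by rewrite leq_mul2r uL orbT.
rewrite mulnA; move: uLh tu x2; rewrite -mulnA.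
move: (u * L N * height N)%N (t * L N * height N)%N (3 * sp N * height N)%N => y z w.
lia.
Qed.

Lemma growth_stage N n : (height N.+1 <= n)%N -> (copies N.+1)%:R <= 64 * a n.
Proof.
move=> hn; have := @growth N (r N %/ 4) n (leqnn _).
have le : (r N %/ 4 * (L N * height N) <= n)%N.
  apply: leq_trans hn; rewrite /= /width mulnA leq_mul2r; apply/orP; right.
  apply: (@leq_trans (r N * L N)); last by rewrite -/(sp N) leq_pmull.
  by rewrite leq_mul2r leq_div orbT.
move=> /(_ le); rewrite ler_pdivrMr // => g.
have : (copies N.+1)%:R <= 8 * (copies N * (r N %/ 4))%:R :> R.
  by rewrite -natrM ler_nat /= mulnC mulnCA leq_mul2l quarter orbT.
lra.
Qed.

Definition run (N : nat) : set X :=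
  slice N predT (sp N * height N) ((sp N + 2 * L N) * height N).

Let run_h N : ((sp N + 2 * L N) * height N <= height N.+1)%N.
Proof.
have := spread_ge (L0 N) (K4 N).
by rewrite /= /width leq_mul2r => ?; apply/orP; right; lia.
Qed.

Lemma measurable_run N : measurable (run N).
Proof. by have [] := slice_mu col predT (sp N * height N) (run_h N). Qed.

Lemma run_mu N : fine (mu (F `&` run N)) = 2 / (K N)%:R.
Proof.
have -> : F `&` run N = slice N (inner 0 N) (sp N * height N) ((sp N + 2 * L N) * height N).
  rewrite (F_stage N); apply/seteqP; split=> x.
    by move=> [/andP[_ Px] /and3P[i _ ab]]; apply/and3P.
  by move=> /and3P[i Px ab]; split; [rewrite /level_union /= i Px|apply/and3P].
rewrite (dense_slice_mu L0 K4 col) // -F_stage (base_mu col) mul1r /cuts !natrM.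
have LR : (L N)%:R != 0 :> R by rewrite pnatr_eq0 -lt0n L0.
have KR : (K N)%:R != 0 :> R by rewrite pnatr_eq0; have := K4 N; case: (K N).
by field; rewrite LR KR.
Qed.

(** Up to [spread] copies of column [S], a point off the run meets at most [t + 1] sparse copies and
    a point on it at most [2 L] copies; both are compared with [a n] by [growth]. For larger [n],
    [a n] is already of the order of [copies S.+1], which bounds the visits of every point. *)
Lemma corr_upper b N n E : (height N.+1 <= n < height N.+2)%N ->
  measurable E -> E `<=` F ->
  corr b E n <= a n * (128 * (fine (mu E) + (L N.+1)%:R * fine (mu (E `&` run N.+1)))).
Proof.
move=> /andP[n1 n2] mE EF; set S := N.+1.
have fE : (mu E < +oo)%E by apply: mu_sub_lty fF.
have q64 := growth_stage n1; rewrite -/S in q64.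
have a0 : 0 <= a n by exact: corr_ge0.
have mR := measurable_run S.
have mED := measurableD mE mR; have mEI := measurableI _ _ mE mR.
have fED : (mu (E `\` run S) < +oo)%E by apply: mu_sub_lty fE => //; exact: subDsetl.
have fEI : (mu (E `&` run S) < +oo)%E by apply: mu_sub_lty fE => //; exact: subIsetl.
have iE x : E x -> inX S x.
  by move=> /EF; rewrite (F_stage S) => /andP[].
set e := fine (mu E); set e' := fine (mu (E `&` run S)).
have e0 : 0 <= e by exact: fine_mu_ge0. have e'0 : 0 <= e' by exact: fine_mu_ge0.
have [nsp|nsp] := leqP n (sp S * height S).
  pose t := (n %/ (L S * height S))%N.
  have Lh : (0 < L S * height S)%N by rewrite muln_gt0 L0 h0.
  (* Both [t * copies S] and [copies S] are at most [64 * a n]; for large [t], the bound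
     [t <= r S <= 8 * (r S %/ 4)] adds a factor 8 to the one in [growth]. *)
  have tq : (t.+1 * copies S)%:R <= 128 * a n.
    have tn : (t * (L S * height S) <= n)%N by exact: leq_trunc_div.
    suff : (copies S * t)%:R <= 64 * a n.
      by move=> ?; rewrite mulSn natrD mulnC; lra.
    have [tr|tr] := leqP t (r S %/ 4).
      by have := growth tr tn; rewrite ler_pdivrMr //; lra.
    have rn : (r S %/ 4 * (L S * height S) <= n)%N.
      by apply: leq_trans tn; rewrite leq_mul2r ltnW ?orbT.
    have := growth (leqnn _) rn; rewrite ler_pdivrMr // => g.
    have tr' : (t <= r S)%N.
      by apply: leq_trans (leq_div2r _ nsp) _; rewrite /spread -mulnA mulnK.
    have : (copies S * t)%:R <= 8 * (copies S * (r S %/ 4))%:R :> R.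
      rewrite -natrM ler_nat mulnCA leq_mul2l; apply/orP; right.
      exact: leq_trans tr' (quarter S).
    lra.
  have s1 : corr b (E `\` run S) n <= (t.+1 * copies S)%:R * fine (mu (E `\` run S)).
    apply: sum_measure_le => // x [Ex nR].
    rewrite (F_stage S) -(F_count S); apply: (sparse_hits_le L0 K4 col) => //.
    - exact: iE.
    - have [_ /andP[l1 l2]] := stage_room L0 K4 col (iE _ Ex).
      rewrite leqNgt; apply/negP => l3; apply: nR.
      by rewrite /run /slice /= (iE _ Ex) l1 l3.
    - by apply: ltnW; exact: ltn_ceil.
  have s2 : corr b (E `&` run S) n <= (2 * L S * copies S)%:R * e'.
    apply: sum_measure_le => // x [Ex /and3P[_ _ /andP[_ l2]]].
    rewrite (F_stage S) -(F_count S); apply: (dense_hits_le L0 K4 col) => //.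
    exact: iE.
  have s3 : fine (mu (E `\` run S)) <= e by apply: fine_le_mu => //; exact: subDsetl.
  have s4 : 0 <= fine (mu (E `\` run S)) by exact: fine_mu_ge0.
  rewrite (corr_split b n mE mR EF).
  have s5 : (t.+1 * copies S)%:R * fine (mu (E `\` run S)) <= 128 * a n * e.
    by apply: ler_pM.
  have s6 : (2 * L S * copies S)%:R * e' <= 128 * a n * ((L S)%:R * e').
    rewrite natrM [in leRHS]mulrA ler_wpM2r // natrM mulrAC.
    by rewrite [leRHS]mulrC [leLHS]mulrC mulrC [leRHS]mulrC ler_wpM2r //; lra.
  by move: s1 s2 s5 s6; rewrite mulrDr; lra.
have s1 : corr b E n <= (copies S.+1)%:R * e.
  apply: sum_measure_le => // x _.
  rewrite -(inners0 L0 K4 col S.+1) -[leqRHS]mul1n.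
  by apply: (hits_le L0 K4 col) => //; rewrite mul1n ltnW.
have rn : (r S %/ 4 * (L S * height S) <= n)%N.
  apply: leq_trans (ltnW nsp); rewrite /spread mulnA leq_mul2r; apply/orP; right.
  by rewrite leq_mul2r leq_div orbT.
have g := growth (leqnn _) rn; rewrite ler_pdivrMr // in g.
have g2 : (copies S.+1)%:R <= 8 * (copies S * (r S %/ 4))%:R :> R.
  by rewrite -natrM ler_nat /= mulnC mulnCA leq_mul2l quarter orbT.
apply: le_trans s1 _; rewrite mulrA; apply: ler_pM => //; first lra.
by rewrite lerDl mulr_ge0.
Qed.

End growth.

(** * From correlations of levels to correlations of arbitrary sets *)

Lemma sum_shift_le (R : realType) (f g : nat -> R) (s n : nat) :
  (forall k, 0 <= g k <= 1) -> (forall k, f k = g (k + s)%N) ->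
  `|\sum_(k < n) f k - \sum_(k < n) g k| <= s%:R.
Proof.
move=> g01 fg; rewrite (eq_bigr (fun k : 'I_n => g (k + s)%N)) //.
rewrite -(big_mkord xpredT (fun k => g (k + s)%N)) -(big_mkord xpredT g).
have bnd u : 0 <= \sum_(u <= k < u + s) g k <= s%:R.
  apply/andP; split; first by apply: sumr_ge0 => k _; have /andP[] := g01 k.
  have -> : s%:R = \sum_(u <= k < u + s) (1 : R).
    by rewrite big_const_nat addKn iter_addr_0.
  by apply: ler_sum => k _; have /andP[] := g01 k.
have -> : \sum_(0 <= k < n) g (k + s)%N = \sum_(s <= k < s + n) g k.
  by rewrite -{2}[s]add0n big_addn addKn.
have E : \sum_(0 <= k < 0 + s) g k + \sum_(s <= k < s + n) g k =
    \sum_(0 <= k < n) g k + \sum_(n <= k < n + s) g k.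
  by rewrite add0n -!big_cat_nat //= ?leq_addr // addnC.
have /andP[b1 b2] := bnd 0%N; have /andP[b3 b4] := bnd n.
by rewrite ler_distl; apply/andP; split; move: E b1 b2 b3 b4; rewrite add0n; lra.
Qed.

Section weakly_rationally_ergodic.
Context (R : realType) (d : measure_display) (X : measurableType d)
  (mu : {measure set X -> \bar R}) (T : X -> X) (L K : nat -> nat)
  (inX : nat -> pred X) (ht : nat -> X -> nat).
Hypotheses (L0 : forall N, (0 < L N)%N) (K4 : forall N, (4 <= K N)%N).
Hypothesis col : columns mu T L K inX ht.
Hypothesis LK : forall e : R, 0 < e ->
  exists B : nat, forall N, (L N)%:R <= e * (K N)%:R \/ (L N <= B)%N.
Local Notation height := (height L K).
Local Notation copies := (copies L K).
Local Notation inner := (inner L K).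
Local Notation level_union := (level_union inX ht).
Local Notation hits := (hits T).
Local Notation F := (level_union 0 predT).
Local Notation corr := (corr mu T inX ht).
Local Notation a := (corr false F).

Let mF : measurable F. Proof. exact: (level_union_mu col 0 predT).1. Qed.
Let fF : (mu F < +oo)%E. Proof. exact: (level_union_fin col). Qed.
Let mH b k A : measurable A -> measurable (hits b A k). Proof. exact: (measurable_hits col). Qed.
Let oneF : fine (mu F) = 1. Proof. by rewrite (base_mu col). Qed.
Let q0 N : 0 < (copies N)%:R :> R. Proof. by rewrite ltr0n copies_gt0. Qed.

(* Along a run of [L N] copies the visits are up to [L N] times more numerous than on
   average, but runs have relative measure of order [1 / K N]. *)
Lemma uniformly_integrable e : 0 < e -> exists C : R, 0 <= C /\
  forall b n E, (height 1 <= n)%N -> measurable E -> E `<=` F ->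
    corr b E n <= a n * (C * fine (mu E) + e).
Proof.
(* If [L <= e / 256 * K], the contribution of the run in [corr_upper], at most [128 * L * (2 / K)],
   is at most [e]; otherwise [L <= B], and it is absorbed by [128 * B * fine (mu E)]. *)
move=> e0; have e1 : 0 < e / 256 by rewrite divr_gt0 ?ltr0n.
have [B LB] := LK e1; exists (128 * (1 + B%:R)); split; first by rewrite mulr_ge0 // addr_ge0.
move=> b n E n1 mE EF.
have [N /andP[N1 N2]] : exists N, (height N.+1 <= n < height N.+2)%N.
  have ex : exists N, (n < height N)%N by exists n; exact: height_ge.
  case: (ex_minnP ex) => -[|[|N]] hN min; [|by move: n1; rewrite leqNgt hN|].
    by move: n1; rewrite leqNgt (leq_trans hN (leq_height L0 K4 (leq0n 1))).
  exists N; rewrite hN andbT leqNgt; apply/negP => /min; by rewrite ltnn.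
apply: le_trans (corr_upper L0 K4 col b (ltac:(by apply/andP) : (height N.+1 <= n < height N.+2)%N) mE EF) _.
apply: ler_wpM2l; first exact: corr_ge0.
have mR := measurable_run L0 K4 col N.+1.
set l := (L N.+1)%:R; set m' := fine (mu (E `&` _)); set m := fine (mu E).
have fE : (mu E < +oo)%E by apply: mu_sub_lty fF.
have m0 : 0 <= m by exact: fine_mu_ge0.
have m'0 : 0 <= m' by exact: fine_mu_ge0.
have m'm : m' <= m by apply: fine_le_mu => //; exact: measurableI.
have K0 : 0 < (K N.+1)%:R :> R by rewrite ltr0n; have := K4 N.+1; case: (K _).
have m'K : m' <= 2 / (K N.+1)%:R.
  rewrite -(run_mu L0 K4 col); apply: fine_le_mu; [exact: measurableI|exact: measurableI|exact: setSI|].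
  by apply: mu_sub_lty fF => //; exact: measurableI.
have lm : l * m' <= e / 128 + B%:R * m.
  case: (LB N.+1) => [le|le]; rewrite -/l in le.
    apply: (@le_trans _ _ (e / 256 * (K N.+1)%:R * (2 / (K N.+1)%:R))).
      by apply: ler_pM => //; rewrite /l.
    have -> : e / 256 * (K N.+1)%:R * (2 / (K N.+1)%:R) = e / 128.
      by field; rewrite gt_eqF.
    by rewrite lerDl mulr_ge0.
  apply: (@le_trans _ _ (B%:R * m)); last by rewrite lerDr divr_ge0 // ltW.
  by apply: ler_pM => //; rewrite /l ?ler_nat.
lra.
Qed.

Lemma growth_unbounded (C : R) : \forall n \near \oo, C <= a n.
Proof.
pose N := Num.bound (64 * `|C|).
exists (height N.+1) => // n /= hn.
have := growth_stage L0 K4 col hn.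
have : 64 * `|C| < (copies N.+1)%:R.
  apply: lt_trans (archi_boundP _) _; first by rewrite mulr_ge0.
  by rewrite ltr_nat; apply: leq_trans (copies_ge L0 K4 N.+1); rewrite -/N.
have := ler_norm C; lra.
Qed.

Definition corr2 (A B : set X) (n : nat) : R :=
  \sum_(k < n) fine (mu (A `&` hits false B k)).

Lemma hits_add j k (A : set X) : iter j T @` hits false A k = hits false A (k + j)%N.
Proof.
rewrite /hits /=; apply/seteqP; split=> [_ [_ [x Ax <-] <-]|_ [x Ax <-]].
  by exists x => //=; rewrite addnC iterD.
by exists (iter k T x); [exists x|rewrite /= addnC iterD].
Qed.

(** By invariance the measure of [T^v J] meeting [T^(k + w) J] depends only on [k + w - v], so both
    sums are shifts of one sequence with values in [[0, 1]], by [v] and by [w]. *)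
Lemma corr2_levels N v w n : (v < height N)%N -> (w < height N)%N ->
  `|corr2 (level_union N (pred1 v)) (level_union N (pred1 w)) n -
    corr2 (level_union N (pred1 0%N)) (level_union N (pred1 0%N)) n| <= (v + w)%:R.
Proof.
move=> vN wN; set J := level_union N (pred1 0%N).
have mJ : measurable J by exact: (level_union_mu col _ _).1.
have JE j : (j < height N)%N -> mu (level_union N (pred1 j)) = ((copies N)%:R^-1)%:E.
  by move=> jN; have [_] := col_level col jN.
pose g k : R := fine (mu (J `&` hits false J k)).
pose u k : R := fine (mu (level_union N (pred1 v) `&` hits false (level_union N (pred1 w)) k)).
have b01 A B : measurable A -> mu A = ((copies N)%:R^-1)%:E -> measurable B ->
    0 <= fine (mu (A `&` B)) <= 1.
  move=> mA eA mB; rewrite fine_mu_ge0 /=.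
  apply: (@le_trans _ _ (fine (mu A))).
    by apply: fine_le_mu => //; [exact: measurableI|rewrite eA ltry].
  by rewrite eA /= invf_le1 // ler1n copies_gt0.
have ug k : u (k + v)%N = g (k + w)%N.
  rewrite /u /g -(image_level col vN) -(image_level col wN); congr fine.
  rewrite -[in LHS]hits_add -[iter w T @` J]/(hits false J w) /=.
  have -> : iter v T @` level_union N (pred1 0%N) `&` iter v T @` (iter k T @` hits false J w) =
      iter v T @` (J `&` hits false J (k + w)%N).
    rewrite [iter k T @` _]hits_add [(w + k)%N]addnC.
    apply/seteqP; split=> [_ [[x Jx <-] [y Hy /(bij_inj (bij_iter col v)) yx]]|_ [x [Jx Hx] <-]].
      by exists x => //; split => //; rewrite -yx.
    by split; exists x.
  by have [_ ->] := image_iter col v (measurableI _ _ mJ (mH false (k + w)%N mJ)).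
have s1 := @sum_shift_le _ (fun k => u (k + v)%N) u v n
  (fun k => b01 _ _ (level_union_mu col _ _).1 (JE _ vN) (mH false k (level_union_mu col _ _).1)) (fun=> erefl).
have s2 := @sum_shift_le _ (fun k => u (k + v)%N) g w n
  (fun k => b01 _ _ mJ (JE _ (height_gt0 L0 K4 N)) (mH false k mJ)) ug.
rewrite distrC in s1; rewrite natrD; apply: le_trans (lerD s1 s2).
exact: ler_distD.
Qed.

(** The error depends on the column but not on [n], hence is negligible against [a n]. Applied to
    the base as well, the estimate eliminates the correlation of the bottom level with itself. *)
Lemma corr2_level_unions N (P Q : pred nat) n :
  `|corr2 (level_union N P) (level_union N Q) n -
    (\sum_(0 <= v < height N) P v)%:R * (\sum_(0 <= v < height N) Q v)%:R *
      corr2 (level_union N (pred1 0%N)) (level_union N (pred1 0%N)) n| <=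
  ((height N) ^ 2 * (2 * height N))%:R.
Proof.
set c0 := corr2 (level_union N (pred1 0%N)) _ _.
have mU P' : measurable (level_union N P') by exact: (level_union_mu col _ _).1.
have E : corr2 (level_union N P) (level_union N Q) n =
    \sum_(0 <= v < height N | P v) \sum_(0 <= w < height N | Q w)
      corr2 (level_union N (pred1 v)) (level_union N (pred1 w)) n.
  rewrite /corr2.
  under [RHS]eq_bigr do rewrite exchange_big /=.
  rewrite [RHS]exchange_big /=; apply: eq_bigr => k _.
  rewrite setIC (level_union_sum col N P (mH false k (mU Q))).
  apply: eq_bigr => v _.
  rewrite setIC (hits_swap col false k (mU _) (mU _)) setIC.
  rewrite (level_union_sum col N Q (mH true k (mU _))).
  by apply: eq_bigr => w _; rewrite setIC (hits_swap col true).
have c00 : 0 <= c0 by apply: sumr_ge0 => k _; exact: fine_mu_ge0.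
have S (P' : pred nat) : (\sum_(0 <= v < height N | P' v) (1 : R)) = (\sum_(0 <= v < height N) P' v)%:R.
  by rewrite natr_sum big_mkcond; apply: eq_bigr => v _; case: (P' v).
rewrite -2!S mulr_suml mulr_suml E -sumrB.
apply: le_trans (ler_norm_sum _ _ _) _.
have -> : ((height N) ^ 2 * (2 * height N))%:R =
    \sum_(0 <= v < height N) \sum_(0 <= w < height N) (2 * height N)%:R :> R.
  by rewrite !sumr_const_nat subn0 -!mulrnA; congr (_ *+ _); rewrite -mulnn; lia.
rewrite [leLHS]big_mkcond /= big_nat [leRHS]big_nat; apply: ler_sum => v /andP[_ vN].
case: (P v) => //; last by apply: sumr_ge0.
rewrite mul1r mulr_suml -sumrB; apply: le_trans (ler_norm_sum _ _ _) _.
rewrite [leLHS]big_mkcond /= big_nat [leRHS]big_nat; apply: ler_sum => w /andP[_ wN].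
case: (Q w) => //; rewrite mul1r; apply: le_trans (corr2_levels n vN wN) _.
by rewrite ler_nat mul2n -addnn leq_add // ltnW.
Qed.

(** The approximating union of levels is intersected with the base, which is itself such a union.
    Validity in all later columns allows one column for two sets. *)
Lemma approx_in_base (A : set X) (e : R) : measurable A -> A `<=` F -> 0 < e ->
  exists N, forall M, (N <= M)%N -> exists P : pred nat,
    level_union M P `<=` F /\ fine (mu (A `+` level_union M P)) <= e.
Proof.
move=> mA AF e0; have fA : (mu A < +oo)%E by exact: mu_sub_lty mA mF AF fF.
have [N [P UP]] := col_dense col mA fA e0; exists N => M NM.
pose Q v := inner N M v && P (v %% height N)%N; exists (fun v => inner 0 M v && Q v).
have UE : level_union M (fun v => inner 0 M v && Q v) = F `&` level_union N P.
  rewrite (level_unionE col P NM) (level_union_inners col (leq0n M)).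
  apply/seteqP; split=> x; rewrite /level_union /=.
    by move=> /andP[i /andP[i0 Qx]]; split; apply/andP.
  by move=> [/andP[i i0] /andP[_ Qx]]; apply/and3P.
rewrite UE; split; first exact: subIsetl.
have mU : measurable (level_union N P) by exact: (level_union_mu col N P).1.
have fY : (mu (A `+` level_union N P) < +oo)%E by apply: le_lt_trans UP _; rewrite ltry.
have mY : measurable (A `+` level_union N P) by apply: measurableU; exact: measurableD.
apply: (@le_trans _ _ (fine (mu (A `+` level_union N P)))).
  apply: fine_le_mu => //.
    by apply: measurableU; apply: measurableD => //; exact: measurableI.
  move=> x [[Ax nx]|[[Fx Ux] nA]]; last by right.
  by left; split => // Ux; apply: nx; split => //; exact: AF.
by rewrite -lee_fin fineK // ge0_fin_numE.
Qed.

(** An orbit segment from [B] to [A] that does not go from [B'] to [A'] has its end in the symmetric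
    difference of [A] and [A'] or its start in that of [B] and [B']; its other end lies in the
    base. *)
Lemma corr2_close (A A' B B' : set X) n :
  measurable A -> measurable A' -> measurable B -> measurable B' ->
  A `<=` F -> A' `<=` F -> B `<=` F -> B' `<=` F ->
  corr2 A B n <= corr2 A' B' n + (corr false (A `+` A') n + corr true (B `+` B') n).
Proof.
move=> mA mA' mB mB' AF A'F BF B'F; rewrite /corr2 /corr -!big_split /=.
apply: ler_sum => k _.
have mY C C' : measurable C -> measurable C' -> measurable (C `+` C' : set X).
  by move=> mC mC'; apply: measurableU; exact: measurableD.
have YF C C' : C `<=` F -> C' `<=` F -> C `+` C' `<=` F.
  by move=> CF C'F x [[/CF]|[/C'F]].
have fin C C' : measurable C -> measurable C' -> C `<=` F -> (mu (C `&` C') < +oo)%E.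
  move=> mC mC' CF; apply: mu_sub_lty fF => //; first exact: measurableI.
  by move=> x [/CF].
rewrite (hits_swap col true k (mY _ _ mB mB') mF) /=.
have m1 := measurableI _ _ (mY _ _ mA mA') (mH false k mF).
have m2 := measurableI _ _ mF (mH false k (mY _ _ mB mB')).
have f1 := fin _ _ (mY _ _ mA mA') (mH false k mF) (YF _ _ AF A'F).
have f2 := fin _ _ mF (mH false k (mY _ _ mB mB')) (@subset_refl _ F).
have m0 := measurableI _ _ mA' (mH false k mB').
have f0 := fin _ _ mA' (mH false k mB') A'F.
have f12 := mu_setU_lty m1 m2 f1 f2.
apply: le_trans (lerD (lexx _) (fine_mu_cover (measurableU _ _ m1 m2) m1 m2 (fun x h => h) f1 f2)).
apply: (fine_mu_cover (measurableI _ _ mA (mH false k mB)) m0 (measurableU _ _ m1 m2) _ f0 f12).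
move=> x [Ax [y By yx]].
  have [A'x|nA'x] := pselect (A' x); last first.
    by right; left; split; [left|exists y => //; exact: BF].
  have [B'y|nB'y] := pselect (B' y); first by left; split => //; exists y.
  by right; right; split; [exact: AF|exists y => //; left].
Qed.

Lemma columns_weakly_rationally_ergodic : weakly_rationally_ergodic mu T.
Proof.
split; [exact: columns_conservative col|exact: columns_ergodic col|].
exists F; split => //; first by rewrite (base_mu col) lte01 ltry.
move=> A B mA mB AF BF.
have aE n : return_rate mu T F n = a n.
  by rewrite /return_rate oneF -mulr_suml expr1n divr1.
apply/cvgrPdist_le => e e0.
have e8 : 0 < e / 8 by rewrite divr_gt0 ?ltr0n.
have [C [C0 UI]] := uniformly_integrable e8.
(* Chosen so that [C * dl + e / 8 <= e / 4]: by [UI], subsets of the base of measure at most [dl]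
   then account for at most [a n * (e / 4)] visits. *)
pose dl := e / 8 / (C + 1).
have C1 : 0 < C + 1 by rewrite ltr_wpDl.
have dl0 : 0 < dl by rewrite divr_gt0.
have dlE : C * dl + dl = e / 8.
  by rewrite /dl -[X in _ + X]mul1r -mulrDl mulrC divfK // gt_eqF.
have [N1 ap1] := approx_in_base mA AF dl0; have [N2 ap2] := approx_in_base mB BF dl0.
pose N := maxn N1 N2.
have [P [UF AU]] := ap1 N (leq_maxl _ _); have [Q [VF BV]] := ap2 N (leq_maxr _ _).
set U := level_union N P in UF AU; set V := level_union N Q in VF BV.
have mU : measurable U by exact: (level_union_mu col _ _).1.
have mV : measurable V by exact: (level_union_mu col _ _).1.
have mY D E : measurable D -> measurable E -> measurable (D `+` E : set X).
  by move=> mD mE; apply: measurableU; exact: measurableD.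
have YF D E : D `<=` F -> E `<=` F -> D `+` E `<=` F by move=> DF EF x [[/DF]|[/EF]].
have fin E : measurable E -> E `<=` F -> (mu E < +oo)%E.
  by move=> mE EF; exact: mu_sub_lty mE mF EF fF.
pose m E := fine (mu E).
have m01 E : measurable E -> E `<=` F -> 0 <= m E <= 1.
  by move=> mE EF; rewrite fine_mu_ge0 -oneF; apply: fine_le_mu.
have close D E : measurable D -> measurable E -> D `<=` F -> E `<=` F ->
    m (D `+` E) <= dl -> `|m D - m E| <= dl.
  move=> mD mE DF EF DE; rewrite ler_distl; apply/andP; split.
    rewrite lerBlDr; have fY := fin _ (mY _ _ mD mE) (YF _ _ DF EF).
    apply: le_trans (fine_mu_cover mE mD (mY _ _ mD mE) _ (fin _ mD DF) fY) _.
      by move=> x Ex; have [Dx|nDx] := pselect (D x); [left|right; right].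
    by rewrite lerD2l.
  have fY := fin _ (mY _ _ mD mE) (YF _ _ DF EF).
  apply: le_trans (fine_mu_cover mD mE (mY _ _ mD mE) _ (fin _ mE EF) fY) _.
    by move=> x Ex; have [Dx|nDx] := pselect (E x); [left|right; left].
  by rewrite lerD2l.
have /andP[A0 A1] := m01 A mA AF; have /andP[B0 B1] := m01 B mB BF.
have /andP[U0 U1] := m01 U mU UF; have /andP[V0 V1] := m01 V mV VF.
have cAU := close A U mA mU AF UF AU; have cBV := close B V mB mV BF VF BV.
pose D : R := ((height N) ^ 2 * (2 * height N))%:R.
have D0 : 0 <= D by [].
near=> n.
have n1 : (height 1 <= n)%N by near: n; exact: nbhs_infty_ge.
(* Two uses of [corr2_level_unions] cost [2 * D], here at most [a n * (e / 4)]. The approximation of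
   the correlations costs [a n * (e / 2)] and that of the measures [a n * (e / 4)], for a total of
   [e * a n]. *)
have an : 8 * D / e + 1 <= a n by near: n; exact: growth_unbounded.
rewrite aE -/(corr2 A B n).
have a0 : 0 < a n by apply: lt_le_trans an; rewrite ltr_wpDl // divr_ge0 ?mulr_ge0 // ltW.
have aD : 2 * D <= a n * (e / 4).
  have : 8 * D / e <= a n by apply: le_trans an; rewrite lerDl.
  by rewrite ler_pdivrMr //; lra.
have ui b E : measurable E -> E `<=` F -> m E <= dl -> corr b E n <= a n * (e / 4).
  move=> mE EF Edl; apply: le_trans (UI b n E n1 mE EF) _; rewrite ler_wpM2l ?ltW //.
  by have := ler_wpM2l C0 Edl; rewrite -/(m E); lra.
have E1 : `|corr2 A B n - corr2 U V n| <= a n * (e / 2).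
  have uA := ui false _ (mY _ _ mA mU) (YF _ _ AF UF) AU.
  have uB := ui true _ (mY _ _ mB mV) (YF _ _ BF VF) BV.
  have c1 := corr2_close n mA mU mB mV AF UF BF VF.
  have c2 := corr2_close n mU mA mV mB UF AF VF BF.
  rewrite [U `+` A]setYC [V `+` B]setYC in c2.
  by rewrite ler_distl; apply/andP; split; lra.
set c0 := corr2 (level_union N (pred1 0%N)) (level_union N (pred1 0%N)) n.
have E2 := corr2_level_unions N P Q n; rewrite -/U -/V -/c0 -/D in E2.
have E3 := corr2_level_unions N (inner 0 N) (inner 0 N) n.
rewrite -(level_union_inners col (leq0n N)) -/(inners L K 0 N) (inners0 L0 K4 col) -/c0 -/D in E3.
rewrite -[corr2 F F n]/(a n) in E3.
have UE : (\sum_(0 <= v < height N) P v)%:R = m U * (copies N)%:R.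
  by rewrite /m /U; have [_ ->] := level_union_mu col N P; rewrite /= divfK // gt_eqF.
have VE : (\sum_(0 <= v < height N) Q v)%:R = m V * (copies N)%:R.
  by rewrite /m /V; have [_ ->] := level_union_mu col N Q; rewrite /= divfK // gt_eqF.
rewrite UE VE in E2.
have UV1 : m U * m V <= 1 by rewrite mulr_ile1.
have E4 : `|corr2 U V n - m U * m V * a n| <= 2 * D.
  have -> : corr2 U V n - m U * m V * a n =
    (corr2 U V n - m U * (copies N)%:R * (m V * (copies N)%:R) * c0) -
    m U * m V * (a n - (copies N)%:R * (copies N)%:R * c0) by ring.
  apply: le_trans (ler_normB _ _) _; rewrite normrM [`|m U * m V|]ger0_norm ?mulr_ge0 //.
  have : m U * m V * `|a n - (copies N)%:R * (copies N)%:R * c0| <= 1 * D.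
    by apply: ler_pM => //; exact: mulr_ge0.
  by move: E2; lra.
have E5 : `|m U * m V - m A * m B| <= e / 4.
  have -> : m U * m V - m A * m B = m U * (m V - m B) + (m U - m A) * m B by ring.
  apply: le_trans (ler_normD _ _) _; rewrite !normrM (ger0_norm U0) (ger0_norm B0).
  rewrite distrC in cAU; rewrite distrC in cBV.
  have h1 : m U * `|m V - m B| <= 1 * dl by apply: ler_pM.
  have h2 : `|m U - m A| * m B <= dl * 1 by apply: ler_pM.
  have : dl <= e / 8 by rewrite -dlE lerDr mulr_ge0 // ltW.
  by lra.
have E6 : `|m A * m B * a n - corr2 A B n| <= e * a n.
  have -> : m A * m B * a n - corr2 A B n =
    - (corr2 A B n - corr2 U V n) - (corr2 U V n - m U * m V * a n) - (m U * m V - m A * m B) * a n by ring.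
  apply: le_trans (ler_normB _ _) _; rewrite [`|(_ - _) * a n|]normrM [`|a n|]gtr0_norm //.
  have h1 : `|m U * m V - m A * m B| * a n <= e / 4 * a n by rewrite ler_wpM2r // ltW.
  have h2 := ler_normB (- (corr2 A B n - corr2 U V n)) (corr2 U V n - m U * m V * a n).
  rewrite normrN in h2.
  by move: E1 E4 h1 h2 aD; lra.
have -> : m A * m B - (a n)^-1 * corr2 A B n = (m A * m B * a n - corr2 A B n) / a n.
  by field; rewrite gt_eqF.
by rewrite normrM normfV [`|a n|]gtr0_norm // ler_pdivrMr.
Unshelve. all: by end_near.
Qed.
End weakly_rationally_ergodic.

(** * Moments of the numbers of visits *)

Lemma limn_einf_gt0 (R : realType) (u : nat -> R) :
  (0 < limn_einf (fun n => (u n)%:E))%E ->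
  exists (c : R) (n0 : nat), 0 < c /\ forall n, (n0 <= n)%N -> c <= u n.
Proof.
rewrite /limn_einf -[X in (0 < X)%E]/(limf_einf _ _) limf_einfE.
move=> /ereal_sup_gt [_ [V [n0 _ Vn0] <-] lt].
have inf n : (n0 <= n)%N -> (ereal_inf [set (u x)%:E | x in V] <= (u n)%:E)%E.
  by move=> n0n; apply: ereal_inf_lbound; exists n => //; exact: Vn0.
move: lt inf; case: (ereal_inf _) => [c| |//] lt inf.
  by exists c, n0; split => [|n /inf]; rewrite -?lte_fin // lee_fin.
by have := inf n0 (leqnn _); rewrite leNgt ltry.
Qed.

(** Truncation at the level [t]: beyond it, [s / t >= 1] is at most its own power of exponent
    [beta]. *)
Lemma ler_tangent_powR (R : realType) (beta s t : R) : 1 <= beta -> 0 <= s -> 0 < t ->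
  s <= t + t / t `^ beta * s `^ beta.
Proof.
move=> b1 s0 t0; have p0 : 0 <= t / t `^ beta * s `^ beta.
  by rewrite !mulr_ge0 ?invr_ge0 ?powR_ge0 // ltW.
have [st|ts] := leP s t; first by apply: le_trans st _; rewrite lerDl.
apply: (@le_trans _ _ (t / t `^ beta * s `^ beta)); last by rewrite lerDr ltW.
have st1 : 1 <= s / t by rewrite ler_pdivlMr // mul1r ltW.
have -> : s `^ beta = t `^ beta * (s / t) `^ beta.
  by rewrite -powRM ?divr_ge0 // ?[t * _]mulrC ?divfK ?gt_eqF // ltW.
rewrite mulrA divfK ?gt_eqF ?powR_gt0 //.
have : (s / t) `^ 1 <= (s / t) `^ beta by rewrite ler_powR.
rewrite powRr1 ?divr_ge0 ?(ltW t0) // => h.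
apply: le_trans (ler_wpM2l (ltW t0) h); by rewrite [t * _]mulrC divfK ?gt_eqF.
Qed.

Section moments.
Context (R : realType) (d : measure_display) (X : measurableType d)
  (mu : {measure set X -> \bar R}) (T : X -> X) (F : set X).
Hypotheses (mF : measurable F) (fF : (mu F < +oo)%E)
  (mH : forall k, measurable (hits T true F k)).

Lemma visitsE n x : visits R T F n x = \sum_(k < n) (x \in hits T true F k)%:R.
Proof.
by apply: eq_bigr => k _; rewrite indicE; congr (nat_of_bool _)%:R.
Qed.

Lemma visits_ge0 n x : 0 <= visits R T F n x.
Proof. by rewrite visitsE; apply: sumr_ge0. Qed.

Lemma visits_le n x : visits R T F n x <= n%:R.
Proof.
rewrite visitsE -natr_sum ler_nat.
by rewrite -[leqRHS]card_ord -sum1_card; apply: leq_sum => k _; exact: leq_b1.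
Qed.

Lemma measurable_visits n (D : set X) : measurable_fun D (visits R T F n).
Proof.
rewrite (_ : visits R T F n = fun x => \sum_(k < n) \1_(hits T true F k) x); last first.
  by apply/funext => x; rewrite visitsE; apply: eq_bigr => k _; rewrite indicE.
apply: measurable_sum => k.
by apply: measurable_funTS; exact: measurable_indic.
Qed.

Lemma visits_integral n :
  \int[mu]_(x in F) visits R T F n x = \sum_(k < n) fine (mu (F `&` hits T true F k)).
Proof.
rewrite /Rintegral.
have -> : (\int[mu]_(x in F) (visits R T F n x)%:E = \sum_(k < n) mu (F `&` hits T true F k))%E.
  rewrite sum_measure_integral //; apply: eq_integral => x _; by rewrite visitsE.
rewrite -[RHS]/(fine (_%:E)) -sumEFin; congr fine; apply: eq_bigr => k _.
rewrite fineK // ge0_fin_numE //; apply: mu_sub_lty fF => //; exact: measurableI.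
Qed.

(** Used in both directions: an upper bound on the moment limits the visits made from a small set,
    and many visits made from a small set force a large moment. *)
Lemma moment_bound (beta t : R) (n : nat) (E : set X) : 1 <= beta -> 0 < t ->
  measurable E -> E `<=` F ->
  \sum_(k < n) fine (mu (E `&` hits T true F k)) <=
    t * fine (mu E) + t / t `^ beta * \int[mu]_(x in F) (visits R T F n x `^ beta).
Proof.
move=> b1 t0 mE EF; have fE : (mu E < +oo)%E := mu_sub_lty mE mF EF fF.
have b0 : 0 <= beta by apply: le_trans b1.
pose S x : R := visits R T F n x `^ beta.
have mS D : measurable_fun D (fun x => (S x)%:E).
  apply/measurable_EFinP.
  by apply: (measurableT_comp (@measurable_powR R beta)); exact: measurable_visits.
have S0 x : (0 <= (S x)%:E)%E by rewrite lee_fin powR_ge0.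
have finI : (\int[mu]_(x in F) (S x)%:E < +oo)%E.
  apply: (@le_lt_trans _ _ (\int[mu]_(x in F) (cst (n%:R `^ beta)%:E x))%E).
    apply: ge0_le_integral => // x _; rewrite lee_fin.
    by apply: ge0_ler_powR; rewrite ?nnegrE ?visits_ge0 ?visits_le.
  by rewrite integral_cst // lte_mul_pinfty // lee_fin powR_ge0.
have IfinE : (\int[mu]_(x in F) (S x)%:E)%E = (\int[mu]_(x in F) (visits R T F n x `^ beta))%:E.
  have I0 : (0 <= \int[mu]_(x in F) (S x)%:E)%E by apply: integral_ge0 => x _; exact: S0.
  rewrite /Rintegral fineK // ge0_fin_numE; [exact: finI|exact: I0].
have mV D : measurable_fun D (fun x => (visits R T F n x)%:E).
  by apply/measurable_EFinP; exact: measurable_visits.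
have k0 : 0 <= t / t `^ beta by rewrite divr_ge0 ?powR_ge0 // ltW.
have mkS D : measurable_fun D (fun x => ((t / t `^ beta)%:E * (S x)%:E)%E).
  under eq_fun do rewrite -EFinM.
  apply/measurable_EFinP; apply: measurable_funM => //.
  by have /measurable_EFinP := mS D.
rewrite -lee_fin -sumEFin.
under eq_bigr => k _.
  rewrite fineK; first over.
  rewrite ge0_fin_numE //; apply: mu_sub_lty fE => //; exact: measurableI.
rewrite sum_measure_integral //.
apply: (@le_trans _ _ (\int[mu]_(x in E) (cst t%:E x + (t / t `^ beta)%:E * (S x)%:E))%E).
  apply: ge0_le_integral => //.
  - by move=> x _; rewrite lee_fin sumr_ge0.
  - by apply: emeasurable_funD; [exact: measurable_cst|exact: mkS].
  - move=> x _; rewrite -visitsE /cst -EFinM -EFinD lee_fin.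
    by apply: ler_tangent_powR => //; exact: visits_ge0.
have c0 x : E x -> (0 <= cst t%:E x :> \bar R)%E by move=> _; rewrite lee_fin ltW.
have p0 x : E x -> (0 <= (t / t `^ beta)%:E * (S x)%:E)%E.
  by move=> _; rewrite mule_ge0 // lee_fin.
rewrite (ge0_integralD _ mE c0 (@measurable_cst _ _ _ _ E t%:E) p0 (mkS E)).
rewrite integral_cst // ge0_integralZl_EFin // EFinD; apply: leeD.
  by rewrite EFinM fineK // ge0_fin_numE.
rewrite [leRHS]EFinM -IfinE; apply: lee_wpmul2l; first by rewrite lee_fin.
exact: ge0_subset_integral.
Qed.

End moments.

(** * Unbounded normalized moments for every set *)

Section not_rationally_ergodic.
Context (R : realType) (d : measure_display) (X : measurableType d)
  (mu : {measure set X -> \bar R}) (T : X -> X) (L K : nat -> nat)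
  (inX : nat -> pred X) (ht : nat -> X -> nat).
Hypotheses (L0 : forall N, (0 < L N)%N) (K4 : forall N, (4 <= K N)%N).
Hypothesis col : columns mu T L K inX ht.
Local Notation height := (height L K).
Local Notation copies := (copies L K).
Local Notation inner := (inner L K).
Local Notation inners := (inners L K).
Local Notation level_union := (level_union inX ht).
Local Notation slice := (slice inX ht).
Local Notation hits := (hits T).
Local Notation sp N := (spread (L N) (K N)).
Local Notation m A := (fine (mu A)).

Let mH b k A : measurable A -> measurable (hits b A k). Proof. exact: (measurable_hits col). Qed.
Let mU N P : measurable (level_union N P). Proof. exact: (level_union_mu col N P).1. Qed.
Let fU N P : (mu (level_union N P) < +oo)%E. Proof. exact: (level_union_fin col). Qed.
Let q0 N : 0 < (copies N)%:R :> R. Proof. by rewrite ltr0n copies_gt0. Qed.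
Let K0 N : 0 < (K N)%:R :> R. Proof. by rewrite ltr0n; have := K4 N; case: (K N). Qed.
Let LR0 N : 0 < (L N)%:R :> R. Proof. by rewrite ltr0n. Qed.
Let mY (A B : set X) : measurable A -> measurable B -> measurable (A `+` B).
Proof. by move=> mA mB; apply: measurableU; exact: measurableD. Qed.

Lemma approx_level (A : set X) (e : R) : measurable A -> (mu A < +oo)%E -> 0 < e ->
  exists N, forall M, (N <= M)%N -> exists P : pred nat,
    (mu (A `+` level_union M P) <= e%:E)%E.
Proof.
move=> mA fA e0; have [N [P UP]] := col_dense col mA fA e0; exists N => M NM.
exists (fun v => inner N M v && P (v %% height N)%N).
by rewrite -(level_unionE col P NM).
Qed.

Lemma level_union_run N P c : (c <= 2 * L N)%N ->
  let D := slice N predT (sp N * height N) ((sp N + c) * height N) in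
  measurable D /\ m (level_union N P `&` D) = m (level_union N P) * c%:R / (cuts (L N) (K N))%:R.
Proof.
move=> cL D; have sg := spread_ge (L0 N) (K4 N).
have bh : ((sp N + c) * height N <= height N.+1)%N.
  by rewrite /= /width leq_mul2r; apply/orP; right; lia.
split; first by have [] := slice_mu col predT (sp N * height N) bh.
rewrite -(dense_slice_mu L0 K4 col P cL); congr (fine (mu _)).
apply/seteqP; split=> x.
  by move=> [/andP[_ Px] /and3P[i _ ab]]; apply/and3P.
by move=> /and3P[i Px ab]; split; [rewrite /level_union /= i Px|apply/and3P].
Qed.

Let inners_w j N : (j <= N)%N -> (inners j N)%:R = m (level_union j predT) * (copies N)%:R :> R.
Proof. exact: (inners_mu L0 K4 col). Qed.

Let sum_le_hits b j N n c (A : set X) : (j <= N)%N -> (n <= c * height N)%N ->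
  measurable A -> (mu A < +oo)%E ->
  \sum_(k < n) m (A `&` hits b (level_union j predT) k) <=
    c%:R * (m (level_union j predT) * (copies N)%:R) * m A.
Proof.
move=> jN nc mA fA; rewrite -(inners_w jN) -natrM.
apply: sum_measure_le => // [k|x _]; first exact: mH.
exact: (hits_le L0 K4 col).
Qed.

(** The time is one period of the sparse copies: in column [N] off the run, a point meets a single
    copy, with at most [w * copies N] visits. The rest of [A], on the run or outside column [N], may
    have [L N] times more visits, but is covered by the run part of [U] and the symmetric difference
    of [A] and [U]. *)
Lemma visits_upper (A : set X) j N P (e : R) : measurable A -> (mu A < +oo)%E -> (j <= N)%N ->
  (mu (A `+` level_union N P) <= e%:E)%E ->
  \sum_(k < L N * height N) m (A `&` hits false (level_union j predT) k) <=
    m (level_union j predT) * (copies N)%:R *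
      (m A + (L N)%:R * (2 * (m A + e) / (K N)%:R + e + e)).
Proof.
move=> mA fA jN; set U := level_union N P => AU; set w := m (level_union j predT).
have mAU := mY mA (mU N P); rewrite -/U in mAU.
have fAU : (mu (A `+` U) < +oo)%E by apply: le_lt_trans AU _; rewrite ltry.
have eAU : m (A `+` U) <= e by rewrite -lee_fin fineK // ge0_fin_numE.
have w0 : 0 <= w by exact: fine_mu_ge0.
have [mRun runE] := level_union_run P (leqnn (2 * L N)); set D := slice _ _ _ _ in mRun runE.
pose G := level_union N predT `\` D.
have mG : measurable G by apply: measurableD => //; exact: mU.
have mAG := measurableI _ _ mA mG; have mAnG := measurableD mA mG.
have fAG : (mu (A `&` G) < +oo)%E by apply: mu_sub_lty fA => //; exact: subIsetl.
have fAnG : (mu (A `\` G) < +oo)%E by apply: mu_sub_lty fA => //; exact: subDsetl.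
have s1 : \sum_(k < L N * height N) m ((A `&` G) `&` hits false (level_union j predT) k) <=
    w * (copies N)%:R * m A.
  apply: (@le_trans _ _ (w * (copies N)%:R * m (A `&` G))); last first.
    apply: ler_wpM2l; first by rewrite mulr_ge0.
    by apply: fine_le_mu => //; exact: subIsetl.
  rewrite -(inners_w jN); apply: sum_measure_le => // [k|x [Ax [/andP[i _] nD]]].
    exact: mH.
  rewrite (level_union_inners col jN) -[leqRHS]mul1n.
  apply: (sparse_hits_le L0 K4 col) => //.
  - have [_ /andP[l1 l2]] := stage_room L0 K4 col i.
    by rewrite leqNgt; apply/negP => l3; apply: nD; apply/and3P; split => //; rewrite l1.
  - by rewrite /spread leq_mul2r leq_pmull ?orbT //; exact: leq_trans (cuts_ge4 L0 K4 N).
  - by rewrite mul1n.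
have mAG2 : m (A `\` G) <= 2 * (m A + e) / (K N)%:R + e + e.
  have UD : m (U `&` D) <= 2 * (m A + e) / (K N)%:R.
    rewrite runE /cuts !natrM -/U.
    have -> : m U * (2 * (L N)%:R) / ((L N)%:R * (K N)%:R) = 2 * m U / (K N)%:R.
      by field; rewrite !gt_eqF.
    rewrite ler_pM2r ?invr_gt0 // ler_pM2l //.
    apply: le_trans (fine_mu_cover (mU N P) mA mAU _ fA fAU) _; last by rewrite lerD2l.
    by move=> x Ux; have [?|?] := pselect (A x); [left|right; right].
  have mUD := measurableI _ _ (mU N P) mRun.
  have fUD : (mu (U `&` D) < +oo)%E by apply: mu_sub_lty (fU N P) => //; exact: subIsetl.
  apply: le_trans (fine_mu_cover mAnG mUD mAU _ fUD fAU) _; last first.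
    have e0 : 0 <= e by apply: le_trans eAU; exact: fine_mu_ge0.
    by move: UD eAU e0; lra.
  move=> x [Ax nG]; have [Ux|nUx] := pselect (U x); last by right; left.
  left; split => //; apply: contrapT => nD; apply: nG; split => //.
  by case/andP: Ux => i _; rewrite /level_union /= i.
have s2 := sum_le_hits false jN (leqnn (L N * height N)) mAnG fAnG.
rewrite -/w in s2.
have s3 : \sum_(k < L N * height N) m (A `&` hits false (level_union j predT) k) <=
    \sum_(k < L N * height N) m ((A `&` G) `&` hits false (level_union j predT) k) +
    \sum_(k < L N * height N) m ((A `\` G) `&` hits false (level_union j predT) k).
  rewrite -big_split; apply: ler_sum => k _ /=.
  have mh := mH false k (mU j predT).
  apply: fine_mu_cover; try exact: measurableI.
  - by move=> x [Ax hx]; have [Gx|nGx] := pselect (G x); [left|right].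
  - by apply: (mu_sub_lty (measurableI _ _ mAG mh) mAG) => //; exact: subIsetl.
  - by apply: (mu_sub_lty (measurableI _ _ mAnG mh) mAnG) => //; exact: subIsetl.
apply: le_trans s3 _; rewrite mulrDr; apply: lerD => //.
apply: le_trans s2 _.
have -> : (L N)%:R * (w * (copies N)%:R) * m (A `\` G) =
    w * (copies N)%:R * ((L N)%:R * m (A `\` G)) by ring.
by apply: ler_wpM2l; [exact: mulr_ge0|exact: ler_wpM2l].
Qed.

Definition half_run (N : nat) : set X :=
  slice N predT (sp N * height N) ((sp N + L N) * height N).

(** Each point of [U] in the first half of the run still has [L N] copies ahead, hence meets [U]
    exactly [L N] times the number of its levels; these points have measure [m U / K N]. Passing
    from [U] to [A] loses the visits that start or end in their symmetric difference, bounded by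
    [hits_le] in both directions of time, hence the factor 2. *)
Lemma visits_lower (A : set X) j N P (e : R) : measurable A ->
  A `<=` level_union j predT -> level_union N P `<=` level_union j predT -> (j <= N)%N ->
  (mu (A `+` level_union N P) <= e%:E)%E ->
  (L N)%:R * (copies N)%:R *
     (m (level_union N P) ^+ 2 / (K N)%:R - 2 * m (level_union j predT) * e) <=
  \sum_(k < L N * height N) m ((A `&` half_run N) `&` hits true A k).
Proof.
move=> mA AX UX jN; set U := level_union N P in UX *; set w := m (level_union j predT) => AU.
set D := half_run N.
have mAU := mY mA (mU N P); rewrite -/U in mAU.
have fAU : (mu (A `+` U) < +oo)%E by apply: le_lt_trans AU _; rewrite ltry.
have eAU : m (A `+` U) <= e by rewrite -lee_fin fineK // ge0_fin_numE.
have w0 : 0 <= w by exact: fine_mu_ge0.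
have [mD runE] := level_union_run P (leq_pmull (L N) (isT : 0 < 2)%N); rewrite -/(half_run N) -/D in mD runE.
have mUD := measurableI _ _ (mU N P) mD; have mAD := measurableI _ _ mA mD.
have fUD : (mu (level_union N P `&` D) < +oo)%E.
  by apply: mu_sub_lty (fU N P) => //; exact: subIsetl.
have s1 : (L N)%:R * (copies N)%:R * (m U ^+ 2 / (K N)%:R) <=
    \sum_(k < L N * height N) m ((U `&` D) `&` hits true U k).
  apply: le_trans (sum_measure_ge (c := (L N * \sum_(0 <= v < height N) P v)%N) mUD fUD _ _).
  - rewrite natrM runE -/U.
    have -> : (\sum_(0 <= v < height N) P v)%:R = m U * (copies N)%:R.
      by rewrite /U; have [_ ->] := level_union_mu col N P; rewrite /= divfK // gt_eqF.
    rewrite /cuts natrM le_eqVlt; apply/orP; left; apply/eqP; field.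
    by rewrite !gt_eqF.
  - by move=> k; exact: (mH true k (mU N P)).
  - move=> x [/andP[i Px] /and3P[_ _ /andP[l1 l2]]].
    rewrite (dense_hits L0 K4 col P i l1) //.
    by move: l2; rewrite !mulnDl mul0n addn0 addnA leq_add2r => /ltnW.
pose Y := A `+` U.
have s2 : \sum_(k < L N * height N) m ((U `&` D) `&` hits true U k) <=
    \sum_(k < L N * height N) m ((A `&` D) `&` hits true A k) +
    (\sum_(k < L N * height N) m (Y `&` hits true (level_union j predT) k) +
     \sum_(k < L N * height N) m (Y `&` hits false (level_union j predT) k)).
  rewrite -!big_split; apply: ler_sum => k _ /=.
  rewrite (hits_swap col false k mAU (mU j predT)) /=.
  have m1 := measurableI _ _ mAU (mH true k (mU j predT)).
  have m2 := measurableI _ _ (mU j predT) (mH true k mAU).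
  have m3 := measurableI _ _ mAD (mH true k mA).
  have f1 : (mu (Y `&` hits true (level_union j predT) k) < +oo)%E.
    by apply: mu_sub_lty fAU => //; exact: subIsetl.
  have f2 : (mu (level_union j predT `&` hits true (A `+` U) k) < +oo)%E.
    by apply: mu_sub_lty (fU j predT) => //; exact: subIsetl.
  have f3 : (mu ((A `&` D) `&` hits true A k) < +oo)%E.
    by apply: mu_sub_lty (fU j predT) => // x [[/AX]].
  have f12 := mu_setU_lty m1 m2 f1 f2.
  apply: le_trans (lerD (lexx _) (fine_mu_cover (measurableU _ _ m1 m2) m1 m2 (fun x h => h) f1 f2)).
  apply: (fine_mu_cover (measurableI _ _ mUD (mH true k (mU N P))) m3 (measurableU _ _ m1 m2) _ f3 f12).
  move=> x [[Ux Dx] Ukx].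
  have [Ax|nAx] := pselect (A x); last by right; left; split; [right|exact: UX].
  have [Akx|nAkx] := pselect (A (iter k T x)); first by left.
  by right; right; split; [exact: UX|right].
have t1 := sum_le_hits true jN (leqnn (L N * height N)) mAU fAU.
have t2 := sum_le_hits false jN (leqnn (L N * height N)) mAU fAU.
rewrite -/w -/Y in t1 t2.
have t3 : (L N)%:R * (w * (copies N)%:R) * m Y <= (L N)%:R * (w * (copies N)%:R) * e.
  by rewrite ler_wpM2l // !mulr_ge0 // ltW.
have -> : (L N)%:R * (copies N)%:R * (m U ^+ 2 / (K N)%:R - 2 * w * e) =
    (L N)%:R * (copies N)%:R * (m U ^+ 2 / (K N)%:R) - 2 * ((L N)%:R * (w * (copies N)%:R) * e).
  by ring.
by move: s1 s2 t1 t2 t3; lra.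
Qed.

Variable beta : R.
Hypothesis beta1 : 1 < beta.
Hypothesis types : forall B : R, exists l k : nat,
  [/\ B < l%:R `^ beta / k%:R, (l <= k)%N &
      forall N0, exists N, [/\ (N0 <= N)%N, L N = l & K N = k]].

(** The order of the choices matters: [eta], [j0], [c1] and [s] depend on [F], [c] and [n0] only;
    [types] then gives [l] and [k]; the tolerance [e] depends on these; finally [N] is taken with
    this very pair, beyond the ranks required by the approximations. *)
Lemma columns_not_rationally_ergodic : ~ rationally_ergodic beta mu T.
Proof.
case=> _ _ [F [mF /andP[F0 fF]]] /limn_einf_gt0 [c [n0 [c0 cn]]].
have b0 : 0 < beta by apply: lt_trans beta1.
set M := m F.
have M0 : 0 < M by rewrite -lte_fin fineK // ge0_fin_numE.
pose A n : R := \sum_(k < n) m (F `&` hits true F k).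
pose I n := \int[mu]_(x in F) (visits R T F n x `^ beta).
have mHF k : measurable (hits true F k) by exact: mH.
have I0 n : 0 <= I n.
  by rewrite /I /Rintegral fine_ge0 // integral_ge0 // => x _; rewrite lee_fin powR_ge0.
have cI n : (n0 <= n)%N -> c * I n <= A n `^ beta.
  move=> /cn; rewrite visits_integral // -/(A n) -/(I n) => h.
  (* If the moment vanished, the quotient would be 0 by the convention on inverses, against
     [c > 0]. *)
  have [E|In] := eqVneq (I n) 0; first by move: h; rewrite E invr0 mulr0 leNgt c0.
  have I1 : 0 < I n by rewrite lt_def In I0.
  by rewrite -ler_pdivlMr.
have AM n : (0 < n)%N -> M <= A n.
  case: n => // n _; rewrite /A big_ord_recl /=.
  have -> : F `&` iter 0 T @^-1` F = F by rewrite /= setIid.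
  by rewrite lerDl; apply: sumr_ge0 => k _; exact: fine_mu_ge0.
have moment t n E : 0 < t -> measurable E -> E `<=` F ->
    \sum_(k < n) m (E `&` hits true F k) <= t * m E + t / t `^ beta * I n.
  by move=> t0 mE EF; apply: moment_bound => //; exact: ltW.
(* Bounded moments of order [beta > 1] make the visits uniformly integrable. *)
have [eta [eta0 etaM half]] : exists eta : R, [/\ 0 < eta, eta <= M / 4 &
    forall n E, (n0 <= n)%N -> (0 < n)%N -> measurable E -> E `<=` F -> m E <= eta ->
      \sum_(k < n) m (E `&` hits true F k) <= A n / 2].
  (* At the truncation level [kap * A n], the identity [kap ^ (beta - 1) = 4 / c] and
     [c * I n <= A n ^ beta] bound the moment term by [A n / 4]; a measure at most [1 / (4 * kap)]
     bounds the other term by [A n / 4]. *)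
  pose kap := (4 / c) `^ (beta - 1)^-1.
  have c4 : 0 < 4 / c by rewrite divr_gt0.
  have kap0 : 0 < kap by exact: powR_gt0.
  have kapE : kap `^ beta = kap * (4 / c).
    have -> : kap `^ beta = kap * kap `^ (beta - 1) by rewrite mulr_powRB1 // ltW.
    by rewrite /kap -powRrM mulVf ?powRr1 ?(ltW c4) // subr_eq0 gt_eqF.
  exists (Num.min (M / 4) (4 * kap)^-1); split.
  - by rewrite lt_min !divr_gt0 //= invr_gt0 mulr_gt0.
  - by rewrite ge_min lexx.
  move=> n E n0n np mE EF; rewrite le_min => /andP[_ mEk].
  have A0 : 0 < A n by apply: lt_le_trans (AM n np).
  have t0 : 0 < kap * A n by exact: mulr_gt0.
  apply: le_trans (moment _ n E t0 mE EF) _.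
  have h1 : kap * A n * m E <= A n / 4.
    have : kap * m E <= 1 / 4.
      by move: mEk; rewrite -[X in _ <= X]mul1r ler_pdivlMr ?mulr_gt0 //; lra.
    by move=> /(ler_wpM2r (ltW A0)); lra.
  have h2 : kap * A n / (kap * A n) `^ beta * I n <= A n / 4.
    have Ab : 0 < A n `^ beta by exact: powR_gt0.
    rewrite (powRM _ (ltW kap0) (ltW A0)) kapE.
    have -> : kap * A n / (kap * (4 / c) * A n `^ beta) * I n =
        A n / 4 * (c * I n / A n `^ beta).
      by field; rewrite !gt_eqF.
    apply: ler_piMr; first by rewrite divr_ge0 // ltW.
    by rewrite ler_pdivrMr // mul1r; exact: cI.
  lra.
(* Only visits to a single column can be bounded. [H] is the part of [F] in column [j0]; at most
   half of the visits start outside it, and those starting in it are, reversing time, visits from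
   [F] to [H]. *)
have [j0 [P0 UP0]] := col_dense col mF fF eta0.
pose H := F `&` level_union j0 predT; set w := m (level_union j0 predT).
have mHset : measurable H by apply: measurableI => //; exact: mU.
have fH : (mu H < +oo)%E by apply: mu_sub_lty fF => //; exact: subIsetl.
have HF : H `<=` F by exact: subIsetl.
have mFH : measurable (F `\` H) by exact: measurableD.
have fFH : (mu (F `\` H) < +oo)%E by apply: mu_sub_lty fF => //; exact: subDsetl.
have FH : m (F `\` H) <= eta.
  have mF0 := mY mF (mU j0 P0).
  have fF0 : (mu (F `+` level_union j0 P0) < +oo)%E by apply: le_lt_trans UP0 _; rewrite ltry.
  apply: (@le_trans _ _ (m (F `+` level_union j0 P0))).
    apply: fine_le_mu => // x [Fx nH]; left; split => // /andP[i _]; apply: nH; split => //.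
    by rewrite /level_union /= i.
  by rewrite -lee_fin fineK // ge0_fin_numE.
have HM : M / 2 <= m H.
  have := fine_mu_split mF mHset fF; rewrite (setIidr HF) -/M.
  by move: FH etaM; lra.
have w0 : 0 < w.
  apply: (@lt_le_trans _ _ (m H)); first by apply: lt_le_trans HM; rewrite divr_gt0.
  exact: fine_le_mu mHset (mU j0 predT) (@subIsetr _ _ _) (fU j0 predT).
(* [c1] is the constant of [upper], twice [6 * M * w]. The value of [s] makes [t * (3 * M / k)], for
   [t = l * q * s], half of the number [l * q * M ^ 2 / (32 * k)] of visits made from the half
   run. *)
pose s := M / (8 * 24); pose c1 := 12 * M * w.
have s0 : 0 < s by rewrite divr_gt0 ?mulr_gt0 ?ltr0n.
have c10 : 0 < c1 by rewrite !mulr_gt0 ?ltr0n.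
have [l [k [lk lek tlk]]] := types ((c1 / s) `^ beta / (3 * M * c)).
have [N' [_ LN' KN']] := tlk 0%N.
have l0 : 0 < l%:R :> R by rewrite -LN'.
have k0 : 0 < k%:R :> R by rewrite -KN'.
have k4 : 4 <= k%:R :> R by rewrite ler_nat -KN'.
have lk1 : l%:R <= k%:R :> R by rewrite ler_nat.
(* The first bound keeps the measure of [F] in the half run below [3 * M / k], and gives
   [e <= M / 4] as [k >= 4]; the second gives [2 * l * e <= M] in [upper]; the third makes the error
   [2 * w * e] at most half of [(M / 4) ^ 2 / k] in [lower]. *)
pose e := Num.min (M / k%:R) (Num.min (M / (2 * l%:R)) (M ^+ 2 / (64 * k%:R * w))).
have e0 : 0 < e.
  rewrite !lt_min; apply/and3P; split; apply: divr_gt0 => //; first by rewrite mulr_gt0.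
    by rewrite exprn_gt0.
  by apply: mulr_gt0 => //; apply: mulr_gt0 => //; rewrite ltr0n.
have e1 : e <= M / k%:R by rewrite ge_min lexx.
have e2 : e <= M / (2 * l%:R) by rewrite !ge_min lexx orbT.
have e3 : e <= M ^+ 2 / (64 * k%:R * w) by rewrite !ge_min lexx !orbT.
have eM : e <= M / 4.
  by apply: le_trans e1 _; rewrite ler_pM2l // lef_pV2 ?posrE.
have [N1 ap1] := approx_level mF fF e0; have [N2 ap2] := approx_level mHset fH e0.
pose N0 := maxn n0 (maxn j0 (maxn N1 N2)).
have [N [N0N LN KN]] := tlk N0.
have le4 : [/\ (n0 <= N)%N, (j0 <= N)%N, (N1 <= N)%N & (N2 <= N)%N].
  by move: N0N; rewrite !geq_max => /and4P[].
have [n0N j0N N1N N2N] := le4.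
have [P UP] := ap1 N N1N; have [P2 VP] := ap2 N N2N.
pose Q v := inner j0 N v && P2 v.
have QE : level_union N Q = level_union j0 predT `&` level_union N P2.
  rewrite (level_union_inners col j0N); apply/seteqP; split=> x.
    by move=> /andP[i /andP[i0 Px]]; split; apply/andP.
  by move=> [/andP[i i0] /andP[_ Px]]; apply/and3P.
have VQ : (mu (H `+` level_union N Q) <= e%:E)%E.
  apply: le_trans VP; apply: le_mu; [exact: mY|exact: mY|].
  rewrite QE => x [[Hx nx]|[[Xx Ux] nH]]; last by right.
  by left; split => // Ux; apply: nx; split => //; case: Hx.
have HX : H `<=` level_union j0 predT by exact: subIsetr.
have QX : level_union N Q `<=` level_union j0 predT by rewrite QE; exact: subIsetl.
pose n := (L N * height N)%N; pose q : R := (copies N)%:R.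
have n0n : (n0 <= n)%N.
  apply: leq_trans n0N _; apply: leq_trans (ltnW (height_ge L0 K4 N)) _.
  by rewrite /n leq_pmull.
have np : (0 < n)%N by rewrite muln_gt0 L0 height_gt0.
have qq : 0 < q by exact: q0.
have upper : A n <= c1 * q.
  have h1 : A n <= 2 * \sum_(k < n) m (H `&` hits true F k).
    have h2 := half n (F `\` H) n0n np mFH (@subDsetl _ _ _) FH.
    have h3 : A n <= \sum_(k < n) m (H `&` hits true F k) + \sum_(k < n) m ((F `\` H) `&` hits true F k).
      rewrite -big_split; apply: ler_sum => i _ /=.
      have m1 := measurableI _ _ mHset (mHF i); have m2 := measurableI _ _ mFH (mHF i).
      apply: (fine_mu_cover (measurableI _ _ mF (mHF i)) m1 m2).
      - by move=> x [Fx hx]; have [Hx|nHx] := pselect (H x); [left|right].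
      - by apply: (mu_sub_lty m1 mHset) => //; exact: subIsetl.
      - by apply: (mu_sub_lty m2 mFH) => //; exact: subIsetl.
    by move: h2 h3; lra.
  have h4 : \sum_(k < n) m (H `&` hits true F k) <= \sum_(k < n) m (F `&` hits false (level_union j0 predT) k).
    apply: ler_sum => i _; rewrite (hits_swap col true) //=.
    have mh x : measurable x -> measurable (F `&` hits false x i).
      by move=> mx; apply: measurableI => //; exact: mH.
    apply: fine_le_mu; [exact: mh|exact: mh (mU _ _)| |].
      by apply: setIS; exact: (@hits_sub _ _ T false _ _ i HX).
    by apply: (mu_sub_lty (mh _ (mU _ _)) mF) => //; exact: subIsetl.
  have h5 := visits_upper mF fF j0N UP.
  rewrite -/n -/w -/q -/M LN KN in h5.
  have h6 : l%:R * (2 * (M + e) / k%:R + e + e) <= 5 * M.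
    have t1 : l%:R * (2 * (M + e) / k%:R) <= 2 * (M + e).
      rewrite mulrA ler_pdivrMr // mulrC ler_wpM2l //.
      by rewrite mulr_ge0 // addr_ge0 // ltW.
    have t2 : l%:R * e * 2 <= M.
      by move: e2; rewrite ler_pdivlMr ?mulr_gt0 //; lra.
    rewrite !mulrDr; move: t1 t2 eM M0; lra.
  have h7 : w * q * (M + l%:R * (2 * (M + e) / k%:R + e + e)) <= w * q * (6 * M).
    by apply: ler_wpM2l; [rewrite mulr_ge0 // ltW|move: h6; lra].
  rewrite /c1; move: h1 h4 h5 h7; lra.
(* The first half of the run carries [L N] times more visits than the average. *)
have lower : (l%:R * q * s) `^ beta * (3 * M / k%:R) <= I n.
  have [mD runE] := level_union_run P (leq_pmull (L N) (isT : 0 < 2)%N).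
  rewrite -/(half_run N) in mD runE.
  have mE := measurableI _ _ mF mD.
  have h1 := visits_lower mHset HX QX j0N VQ.
  rewrite -/n -/w -/q LN KN in h1.
  have mHQ := mY mHset (mU N Q); have mFP := mY mF (mU N P).
  have fHQ : (mu (H `+` level_union N Q) < +oo)%E by apply: le_lt_trans VQ _; rewrite ltry.
  have fFP : (mu (F `+` level_union N P) < +oo)%E by apply: le_lt_trans UP _; rewrite ltry.
  have HQ : M / 4 <= m (level_union N Q).
    have sub : H `<=` level_union N Q `|` (H `+` level_union N Q).
      by move=> x Hx; have [?|?] := pselect (level_union N Q x); [left|right; left].
    have := fine_mu_cover mHset (mU N Q) mHQ sub (fU N Q) fHQ.
    have : m (H `+` level_union N Q) <= e by rewrite -lee_fin fineK // ge0_fin_numE.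
    by move: HM eM; lra.
  have h2 : M ^+ 2 / (32 * k%:R) <= m (level_union N Q) ^+ 2 / k%:R - 2 * w * e.
    have t1 : (M / 4) ^+ 2 / k%:R <= m (level_union N Q) ^+ 2 / k%:R.
      by rewrite ler_pM2r ?invr_gt0 // lerXn2r ?nnegrE ?divr_ge0 ?fine_mu_ge0 // ltW.
    have t2 : 2 * w * e <= M ^+ 2 / (32 * k%:R).
      have t3 := ler_wpM2l (ltW w0) e3.
      have : w * (M ^+ 2 / (64 * k%:R * w)) = M ^+ 2 / (32 * k%:R) / 2.
        by field; rewrite !gt_eqF.
      by move: t3; lra.
    have : (M / 4) ^+ 2 / k%:R = M ^+ 2 / (32 * k%:R) * 2 by field; rewrite gt_eqF.
    by move: t1 t2; lra.
  have h3 : l%:R * q * (M ^+ 2 / (32 * k%:R)) <=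
      \sum_(k < n) m ((F `&` half_run N) `&` hits true F k).
    apply: (@le_trans _ _ (\sum_(k < n) m ((H `&` half_run N) `&` hits true H k))).
      apply: le_trans h1; rewrite ler_wpM2l //.
      by rewrite mulr_ge0 // ltW.
    apply: ler_sum => i _; apply: fine_le_mu.
    - by apply: measurableI; [exact: measurableI|exact: mH].
    - exact: measurableI.
    - by apply: setISS; [exact: setSI|exact: (@hits_sub _ _ T true _ _ i HF)].
    - apply: (mu_sub_lty (measurableI _ _ mE (mHF i)) mF) => // x [[]] //.
  pose t := l%:R * q * s.
  have t0 : 0 < t by rewrite !mulr_gt0.
  have Em : m (F `&` half_run N) <= 3 * M / k%:R.
    have mUD := measurableI _ _ (mU N P) mD.
    have fUD : (mu (level_union N P `&` half_run N) < +oo)%E.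
      by apply: (mu_sub_lty mUD (mU N P)) => //; exact: subIsetl.
    have sub : F `&` half_run N `<=` (level_union N P `&` half_run N) `|` (F `+` level_union N P).
      by move=> x [Fx Dx]; have [?|?] := pselect (level_union N P x); [left|right; left].
    have a1 := fine_mu_cover mE mUD mFP sub fUD fFP.
    have eFP : m (F `+` level_union N P) <= e by rewrite -lee_fin fineK // ge0_fin_numE.
    have sub2 : level_union N P `<=` F `|` (F `+` level_union N P).
      by move=> x Ux; have [?|?] := pselect (F x); [left|right; right].
    have a2 := fine_mu_cover (mU N P) mF mFP sub2 fF fFP.
    have a3 : m (level_union N P `&` half_run N) = m (level_union N P) / k%:R.
      by rewrite runE /cuts natrM LN KN; field; rewrite !gt_eqF.
    have a4 : m (level_union N P) / k%:R <= (M + M) / k%:R.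
      rewrite ler_pM2r ?invr_gt0 //; apply: le_trans a2 _; rewrite -/M lerD2l.
      by move: eFP eM M0; lra.
    by rewrite a3 in a1; move: a1 a4 eFP e1; lra.
  have h4 := moment t n _ t0 mE (@subIsetl _ _ _).
  have h5 : t * m (F `&` half_run N) <= l%:R * q * (M ^+ 2 / (32 * k%:R)) / 2.
    have := ler_wpM2l (ltW t0) Em; have -> : t * (3 * M / k%:R) = l%:R * q * (M ^+ 2 / (32 * k%:R)) / 2.
      by rewrite /t /s; field; rewrite gt_eqF.
    by [].
  have h6 : l%:R * q * (M ^+ 2 / (32 * k%:R)) / 2 <= t / t `^ beta * I n.
    by move: h3 h4 h5; lra.
  have tb : 0 < t `^ beta by exact: powR_gt0.
  have -> : t `^ beta * (3 * M / k%:R) =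
      t `^ beta / t * (l%:R * q * (M ^+ 2 / (32 * k%:R)) / 2).
    by rewrite /t /s; field; rewrite !gt_eqF ?powR_gt0.
  have := ler_wpM2l (ltW (divr_gt0 tb t0)) h6.
  have -> : t `^ beta / t * (t / t `^ beta * I n) = I n by field; rewrite !gt_eqF.
  by [].
(* The factor [(q * s) ^ beta] cancels, leaving [l ^ beta / k <= (c1 / s) ^ beta / (3 * M * c)],
   against the choice of [l] and [k]. *)
have h1 : c * ((l%:R * q * s) `^ beta * (3 * M / k%:R)) <= (c1 * q) `^ beta.
  apply: le_trans (ler_wpM2l (ltW c0) lower) _; apply: le_trans (cI n n0n) _.
  have A0 : 0 <= A n by apply: le_trans (AM n np); exact: ltW.
  by apply: ge0_ler_powR => //; [exact: ltW|rewrite nnegrE; exact: ltW (mulr_gt0 c10 qq)].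
have E1 : (l%:R * q * s) `^ beta = l%:R `^ beta * (q * s) `^ beta.
  by rewrite -[X in X `^ _ = _]mulrA; exact: powRM (ltW l0) (ltW (mulr_gt0 qq s0)).
have E2 : (c1 * q) `^ beta = (c1 / s) `^ beta * (q * s) `^ beta.
  rewrite -powRM; [|by rewrite divr_ge0 // ltW|by rewrite mulr_ge0 // ltW].
  by congr (_ `^ _); field; rewrite gt_eqF.
have qs : 0 < (q * s) `^ beta by rewrite powR_gt0 // mulr_gt0.
rewrite E1 E2 in h1.
move: lk; rewrite ltNge => /negP; apply.
rewrite ler_pdivlMr ?mulr_gt0 // -(ler_pM2r qs); apply: le_trans h1.
by rewrite le_eqVlt; apply/orP; left; apply/eqP; ring.
Qed.

End not_rationally_ergodic.

(** * Choice of the parameters *)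

(* Each value of [stage] occurs infinitely often. *)
Definition stage (N : nat) : nat := (logn 2 N.+1).+1.
Definition run_length (a N : nat) : nat := (stage N ^ a)%N.
(** The factor 4 provides [4 <= K], and the exponent makes [L / K] equal to [1 / (4 * stage N)]. *)
Definition rarity (a N : nat) : nat := (4 * stage N ^ a.+1)%N.

Lemma run_length_gt0 a N : (0 < run_length a N)%N.
Proof. by rewrite expn_gt0. Qed.

Lemma rarity_ge4 a N : (4 <= rarity a N)%N.
Proof. by rewrite leq_pmulr // expn_gt0. Qed.

Lemma stage_recurs j N0 : exists2 N, (N0 <= N)%N & stage N = j.+1.
Proof.
(* The odd factor makes the index large without changing the exponent of 2 in [N.+1]. *)
exists (2 ^ j * N0.*2.+1).-1; last first.
  rewrite /stage prednK ?muln_gt0 ?expn_gt0 // lognM ?expn_gt0 // pfactorK //.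
  by rewrite logn_coprime ?addn0 // coprime2n /= odd_double.
have : (N0.*2.+1 <= 2 ^ j * N0.*2.+1)%N by rewrite leq_pmull // expn_gt0.
by rewrite -addnn; lia.
Qed.

(** The ratio of the two numbers is [1 / (4 * stage N)], small unless [stage N], hence the run
    length, is bounded. *)
Lemma run_length_rare (R : realType) (a : nat) (e : R) : 0 < e ->
  exists B, forall N, (run_length a N)%:R <= e * (rarity a N)%:R \/ (run_length a N <= B)%N.
Proof.
move=> e0; pose J := Num.bound (e^-1); exists (J ^ a)%N => N.
have [sJ|Js] := leqP (stage N) J.
  by right; rewrite /run_length; case: (a) => // b; rewrite leq_exp2r.
left; rewrite /run_length /rarity expnS !natrM.
have J1 : 1 <= e * (stage N)%:R.
  rewrite mulrC -ler_pdivrMr // mul1r; apply: ltW.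
  apply: lt_trans (archi_boundP _) _; first by rewrite invr_ge0 ltW.
  by rewrite ltr_nat.
have : 1 <= e * (4 * (stage N)%:R) by rewrite mulrCA; lra.
by move=> /(ler_wpM2r (ler0n R (stage N ^ a))); rewrite mul1r -!mulrA.
Qed.

(** With [x] the stage, [l ^ beta / k = x ^ g / 4] for [g = a * beta - (a + 1) > 0], which exceeds
    any bound; [stage_recurs] repeats the pair. *)
Lemma run_length_moment (R : realType) (a : nat) (beta B : R) :
  1 < a%:R * (beta - 1) ->
  exists l k : nat, [/\ B < l%:R `^ beta / k%:R, (l <= k)%N &
    forall N0, exists N, [/\ (N0 <= N)%N, run_length a N = l & rarity a N = k]].
Proof.
move=> ab; pose g := a%:R * (beta - 1) - 1.
have g0 : 0 < g by rewrite subr_gt0.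
have B0 : 0 <= 4 * `|B| by rewrite mulr_ge0.
pose j := Num.bound ((4 * `|B|) `^ g^-1); pose x : R := j.+1%:R.
have x0 : 0 < x by rewrite ltr0n.
exists (j.+1 ^ a)%N, (4 * j.+1 ^ a.+1)%N; split.
- rewrite natrM !natrX -/x -!powR_mulrn ?ltW // -powRrM.
  have -> : x `^ (a%:R * beta) = x `^ g * x `^ a.+1%:R.
    have -> : a%:R * beta = g + a.+1%:R by rewrite /g -natr1; ring.
    by rewrite powRD // lt0r_neq0 ?implybT.
  rewrite invfM mulrA [_ / 4]mulrAC mulfK ?gt_eqF ?powR_gt0 //.
  rewrite ltr_pdivlMr // mulrC; apply: (@le_lt_trans _ _ (4 * `|B|)).
    by rewrite ler_wpM2l // ler_norm.
  have -> : 4 * `|B| = ((4 * `|B|) `^ g^-1) `^ g.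
    by rewrite -powRrM mulVf ?gt_eqF // powRr1.
  apply: gt0_ltr_powR; rewrite ?nnegrE ?powR_ge0 // ?ltW //.
  apply: lt_le_trans (archi_boundP (powR_ge0 _ _)) _.
  by rewrite ler_nat.
- by rewrite expnS mulnA leq_pmull.
- by move=> N0; have [N N0N sN] := stage_recurs j N0; exists N; rewrite /run_length /rarity sN.
Qed.

Theorem corollary3p3 (R : realType) (beta : R) (hbeta : 1 < beta) :
  exists (d : measure_display) (X : measurableType d)
         (mu : {measure set X -> \bar R}) (T : X -> X),
    [/\ sigma_finite setT mu, nonatomic mu, lebesgue_space mu & mu setT = +oo%E] /\
    [/\ invertible_measure_preserving mu T,
        weakly_rationally_ergodic mu T &
        ~ rationally_ergodic beta mu T].
Proof.
pose a := Num.bound ((beta - 1)^-1).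
have b0 : 0 < beta - 1 by rewrite subr_gt0.
have ab : 1 < a%:R * (beta - 1).
  by rewrite -ltr_pdivrMr // mul1r; apply: archi_boundP; rewrite invr_ge0 ltW.
have L0 := run_length_gt0 a; have K4 := rarity_ge4 a.
have col := leb_columns R L0 K4.
exists _, _, (leb R), (tower_map L0 K4).
split; first by split; [exact: leb_sigma_finite|exact: leb_nonatomic|exact: leb_lebesgue_space|exact: leb_setT].
split; first exact: col_invertible col.
- by apply: (columns_weakly_rationally_ergodic L0 K4 col) => e; exact: run_length_rare.
- apply: (columns_not_rationally_ergodic L0 K4 col hbeta) => B.
  exact: run_length_moment.
Qed.
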